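(* Let $\mathcal B$ be a separable complex Banach space and let $(X_t)$, $(\varepsilon_t)$ be sequences of random elements of $\mathcal B$ satisfying the autoregressive law of motion $$\sum_{j=0}^\infty A_{j,0}X_{t-j}=\varepsilon_t,\qquad t\ge1,$$ with bounded linear operators $A_{j,0}$ on $\mathcal B$, whose characteristic series $A(z)=\sum_{j=0}^\infty A_{j,0}z^j$ is an analytic function on an open connected set $U\subset\mathbb C$ containing $z_0=1$, with Fredholm values and Taylor series $A(z)=\sum_{j=0}^\infty A_{j,1}(z-1)^j$ around $z=1$. Assume further that $A(z)$ is invertible for any $z$ satisfying $|z|\le1+\eta$ for some $\eta>0$, except at $z=1$. Let $P_k$ and $A^{[k]}$ be as in the context with $z_0=1$. Then the following hold. (i) If $A^{[1]}(1)=A_{0,1}+(I-P_1)A_{1,1}$ is invertible, then $A(z)^{-1}$ has a pole of order $d=1$ at $z=1$ and $X_t$ can be represented as follows: for some $\tau_0\in\mathcal B$, $$X_t=\tau_0-\Psi_{-1}\sum_{s=1}^t\varepsilon_s+\nu_t,\qquad t\ge1,$$ where $\nu_t=\sum_{j=0}^\infty\Phi_j\varepsilon_{t-j}$, $\Phi_j=\sum_{k=j}^\infty(-1)^{k-j}\pi_j(k)\Psi_k$, and the $\Psi_j$ are the operators defined in the context with $d=1$. (ii) If $A^{[2]}(1)=A_{0,1}+(P_2-P_1)A_{1,1}+(I-P_2)A_{2,1}$ is invertible while $A^{[1]}(1)$ is not, then $A(z)^{-1}$ has a pole of order $d=2$ at $z=1$ and $X_t$ can be represented as follows: for some $\tau_0,\tau_1\in\mathcal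 B$, $$X_t=\tau_0+\tau_1t+\Psi_{-2}\sum_{s=1}^t\sum_{r=1}^s\varepsilon_r-\Psi_{-1}\sum_{s=1}^t\varepsilon_s+\nu_t,\qquad t\ge1,$$ where $\nu_t=\sum_{j=0}^\infty\Phi_j\varepsilon_{t-j}$, $\Phi_j=\sum_{k=j}^\infty(-1)^{k-j}\pi_j(k)\Psi_k$, and the $\Psi_j$ are the operators defined in the context with $d=2$.
   Context: $I$ is the identity on $\mathcal B$. A projection is a bounded idempotent operator; a bounded operator $T$ is Fredholm if $\dim(\ker T)<\infty$ and $\dim(\operatorname{coker}T)<\infty$. $\pi_0(k)=1$, $\pi_1(k)=k$, and $\pi_j(k)=k(k-1)\cdots(k-j+1)/j!$ for $j\ge2$. Here $A_{j,0}$ and $A_{j,1}$ denote the $j$-th Taylor coefficients of $A$ around $0$ and $1$, respectively; in particular $A_{0,1}=A(1)$, and $A(1)$ is not invertible. Successive factorization at $z_0=1$: starting from $A^{[0]}=A$, for $k=1,2,\ldots$ let $P_k$ be a projection with $\operatorname{ran}P_k=\operatorname{ran}A^{[k-1]}(1)$ (no other requirement is imposed on $P_k$; in particular its kernel may be any convenient choice), let $Q_k=I-P_k$, and let $A^{[k]}$ (the Fredholm quotient of order $k$) be the analytic function, with index-zero Fredholm values, satisfying $A^{[k-1]}(z)=(P_k+(z-1)Q_k)A^{[k]}(z)$. Set $P_0=0$; when $d$ is the order of the pole, $P_d\ne I$ and $P_{d+j}=I$ for $j>0$. Define $G_k=\sum_{j=0}^d(P_{j+1}-P_j)A_{k+j,1}$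 for $k\ge0$, $H_0=G_0^{-1}$, $H_j=-G_0^{-1}\sum_{k=1}^jG_kH_{j-k}$ for $j\ge1$, and $$\Psi_j=\sum_{\ell=0}^{j+d}H_{j+d-\ell}(P_{d+1-\ell}-P_{d-\ell})\ \ (-d\le j<0),\qquad\Psi_j=\sum_{\ell=0}^dH_{j+\ell}(P_{\ell+1}-P_\ell)\ \ (j\ge0);$$ these are the Laurent coefficients of $A(z)^{-1}=\sum_{j\ge-d}\Psi_j(z-1)^j$ around $z=1$.
   Formalization: Corrected: the law also holds for t≤0 and a.s. ‖X_{-s}‖≤M(1+η)^s; τ_0, τ_1 are random; a divergent sum for Φ_j is read by analytic continuation; in (ii) the formulas for A^{[2]}(1), Ψ_j need ran P_1⊆ran P_2, else Ψ_j are the Laurent coefficients. *)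

(* Defs.v *)
(* The definitions are over any [K : numFieldType]; complex scalars are the
   instance [K := R[i]] for [R : realType]. *)
From HB Require Import structures.
From mathcomp Require Import all_boot all_order all_algebra.
From mathcomp Require Import all_classical all_reals all_analysis.

Set Implicit Arguments.
Unset Strict Implicit.
Unset Printing Implicit Defensive.

Import Order.TTheory GRing.Theory Num.Theory.
Import numFieldNormedType.Exports.

Local Open Scope classical_set_scope.
Local Open Scope ring_scope.

Section Operators.
Context {K : numFieldType} {B : normedModType K}.
Implicit Types (T S : B -> B) (c u : nat -> B -> B).

(* Operators are plain functions [B -> B], so that [+], [-], [*:] and [\sum]
   are the pointwise operations and [\o] is the product. *)
Definition bounded_op T : Prop :=
  linear T /\ exists M : K, forall x, `|T x| <= M * `|x|.

Definition op_inverse T S : Prop :=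
  [/\ bounded_op S, T \o S = id & S \o T = id].

Definition op_invertible T : Prop := exists S, op_inverse T S.

(* A junk value is returned when [T] is not invertible. *)
Definition op_inv T : B -> B := xget 0 [set S | op_inverse T S].

Definition projection T : Prop := bounded_op T /\ T \o T = T.

(* For a subspace [F] of [E]: the quotient E/F has dimension n, i.e. some
   e_1, ..., e_n in E induce a basis of E/F. *)
Definition quot_dim (E F : set B) (n : nat) : Prop :=
  exists e : 'I_n -> B, (forall i, E (e i)) /\
    forall v, E v ->
      exists! a : 'rV[K]_n, F (v - \sum_(i < n) a ord0 i *: e i).

Definition ker_dim T n : Prop := quot_dim [set x | T x = 0] [set 0] n.
Definition coker_dim T n : Prop := quot_dim [set: B] (range T) n.

Definition fredholm T : Prop :=
  [/\ bounded_op T, exists n, ker_dim T n & exists n, coker_dim T n].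

Definition fredholm_index0 T : Prop :=
  bounded_op T /\ exists n, ker_dim T n /\ coker_dim T n.

(* [S = \sum_(k >= m) u k], with convergence in operator norm *)
Definition op_sum (m : nat) u S : Prop :=
  forall e : K, 0 < e -> \forall n \near \oo,
    forall x, `|(\sum_(m <= k < n) u k) x - S x| <= e * `|x|.

Definition taylor_coefs (A : K -> B -> B) (w : K) c : Prop :=
  (forall n, bounded_op (c n)) /\
  \forall z \near w, op_sum 0 (fun n => (z - w) ^+ n *: c n) (A z).

Definition op_analytic (U : set K) (A : K -> B -> B) : Prop :=
  forall w, U w -> exists c, taylor_coefs A w c.

(* A(z)^-1 = \sum_(j >= - d) Psi_j (z - w)^j in a punctured neighbourhood of
   w; coefficients of index smaller than -d play no role. *)
Definition laurent_coefs (A : K -> B -> B) (w : K) (d : nat)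
    (Psi : int -> B -> B) : Prop :=
  (forall j, bounded_op (Psi j)) /\
  \forall z \near w, z != w -> exists S, op_inverse (A z) S /\
    op_sum 0 (fun n => (z - w) ^+ n *: Psi n%:Z)
      (S - \sum_(1 <= i < d.+1) (z - w) ^- i *: Psi (- i%:Z)).

Definition inverse_has_pole (A : K -> B -> B) (w : K) (d : nat) : Prop :=
  (0 < d)%N /\ exists Psi, laurent_coefs A w d Psi /\ Psi (- d%:Z) <> 0.

(* Successive factorization of A at w; [P k] and [Aq k] (the Fredholm quotient
   of order k) stand for P_k and A^[k], with P_0 = 0 and A^[0] = A. *)
Definition successive_factorization (U : set K) (A : K -> B -> B) (w : K)
    (P : nat -> B -> B) (Aq : nat -> K -> B -> B) : Prop :=
  [/\ P 0%N = 0 /\ Aq 0%N = A,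
      forall k, projection (P k.+1) /\ range (P k.+1) = range (Aq k w),
      forall k, op_analytic U (Aq k.+1) /\
                forall z, U z -> fredholm_index0 (Aq k.+1 z) &
      forall k z, U z ->
        Aq k z = (P k.+1 + (z - w) *: (id - P k.+1)) \o Aq k.+1 z].

Section LaurentFormula.
Variables (P : nat -> B -> B) (A1 : nat -> B -> B) (d : nat).

Definition Gcoef (k : nat) : B -> B :=
  \sum_(0 <= j < d.+1) ((P j.+1 - P j) \o A1 (k + j)%N).

(* [:: H_0; ...; H_n] *)
Fixpoint Hseq (n : nat) : seq (B -> B) :=
  if n is m.+1 then
    let s := Hseq m in
    rcons s (- (op_inv (Gcoef 0)
                  \o \sum_(1 <= k < m.+2) (Gcoef k \o nth 0 s (m.+1 - k)%N)))
  else [:: op_inv (Gcoef 0)].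

Definition Hcoef (j : nat) : B -> B := nth 0 (Hseq j) j.

Lemma size_Hseq n : size (Hseq n) = n.+1.
Proof. by elim: n => //= n IHn; rewrite size_rcons IHn. Qed.

Lemma nth_Hseq n j : (j <= n)%N -> nth 0 (Hseq n) j = Hcoef j.
Proof.
elim: n => [|n IHn]; first by rewrite leqn0 => /eqP ->.
rewrite leq_eqVlt => /orP[/eqP -> //|]; rewrite ltnS => le_jn /=.
by rewrite nth_rcons size_Hseq ltnS le_jn IHn.
Qed.

Lemma Hcoef0 : Hcoef 0 = op_inv (Gcoef 0).
Proof. by []. Qed.

Lemma HcoefE j : (0 < j)%N ->
  Hcoef j = - (op_inv (Gcoef 0)
                 \o \sum_(1 <= k < j.+1) (Gcoef k \o Hcoef (j - k)%N)).
Proof.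
case: j => // m _; rewrite {1}/Hcoef /= nth_rcons size_Hseq ltnn eqxx.
congr (- (_ \o _)); apply: eq_big_nat => k /andP[k_gt0 _].
by case: k k_gt0 => // k _; rewrite nth_Hseq // subSS leq_subr.
Qed.

(* [Negz i] is -(i+1). *)
Definition Psi_formula (j : int) : B -> B :=
  match j with
  | Posz i => \sum_(0 <= l < d.+1) (Hcoef (i + l)%N \o (P l.+1 - P l))
  | Negz i =>
      if (i.+1 <= d)%N then
        \sum_(0 <= l < (d - i.+1).+1)
          (Hcoef (d - i.+1 - l)%N \o (P (d.+1 - l)%N - P (d - l)%N))
      else 0
  end.

End LaurentFormula.

(* k (k - 1) ... (k - j + 1) / j! *)
Definition pi_ (j k : nat) : K := (k ^_ j)%:R / j`!%:R.

(* [L] is the value at z of the power series \sum_n c_n (y - w)^n, the series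
   being continued analytically to D when z lies outside its disc of
   convergence; D is meant to be a connected open set containing w and z. *)
Definition continued_sum (D : set K) c (w z : K) (L : B -> B) : Prop :=
  exists F : K -> B -> B, [/\ op_analytic D F, taylor_coefs F w c & F z = L].

(* Phi_j = \sum_(k >= j) (-1)^(k-j) pi_j(k) Psi_k for all j.  The right-hand
   side is the power series \sum_(k >= j) pi_j(k) Psi_k (z - 1)^(k-j) at z = 0.
   It may diverge, e.g. Psi_k = c 2^k for A(z) = (1 - z) (1 - 2 z / 3), and is
   then summed by analytic continuation to the disc |z| < r; whenever it
   converges in operator norm, Phi_j is its ordinary sum. *)
Definition Phi_coefs (r : K) (Psi : int -> B -> B) (Phi : nat -> B -> B) :=
  forall j : nat,
    continued_sum [set z : K | `|z| < r]
      (fun n => pi_ j (j + n) *: Psi (j + n)%N%:Z) 1 0 (Phi j) /\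
    forall L,
      op_sum j (fun k => ((-1) ^+ (k - j) * pi_ j k) *: Psi k%:Z) L ->
      Phi j = L.

Definition separable : Prop := exists D : set B, countable D /\ dense D.

Definition random_element d (T : measurableType d) (X : T -> B) : Prop :=
  measurable_fun [set: T] (X : T -> g_sigma_algebraType (@open B)).

Definition law_of_motion (A0 : nat -> B -> B) (Omega : Type)
    (X eps : int -> Omega -> B) (t : int) (w : Omega) : Prop :=
  [series A0 j (X (t - j%:Z) w)]_j @ \oo --> eps t w.

(* nu_t = \sum_(j >= 0) Phi_j eps_(t-j) *)
Definition linear_process (Phi : nat -> B -> B) (Omega : Type)
    (eps : int -> Omega -> B) (t : int) (w : Omega) (nu : B) : Prop :=
  [series Phi j (eps (t - j%:Z) w)]_j @ \oo --> nu.

End Operators.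

(* Main.v *)
Require Import Defs.
From mathcomp Require Import all_boot all_order all_algebra.
From mathcomp Require cyclic separable cyclotomic.
From mathcomp Require Import complex.
From mathcomp Require Import all_classical all_reals all_analysis.
From mathcomp Require Import ring lra zify.

Set Implicit Arguments.
Unset Strict Implicit.
Unset Printing Implicit Defensive.

Import Order.TTheory GRing.Theory Num.Theory.
Import numFieldNormedType.Exports.

Local Open Scope classical_set_scope.
Local Open Scope ring_scope.
Local Open Scope complex_scope.

(** Invert A near z = 1 by undoing the factorization. If the quotient A^[d](1) is
    invertible, so is A^[d](z) nearby, with a power series inverse whose
    coefficients are the H_j (taylor_inv_Hcoef), and
    A(z) = (P_1 + (z-1)(id - P_1)) ... (P_d + (z-1)(id - P_d)) A^[d](z); each
    factor is inverted by replacing z - 1 with its inverse, which contributes one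
    order to the pole (inverse_step). Applying P_k and id - P_k to the Taylor
    series of A^[k-1] gives those of A^[k] (factor_coefs), hence the formulas for
    A^[1](1), A^[2](1), the G_k and the Psi_j. The leading Laurent coefficient
    cannot vanish, otherwise P_d = id and A^[d-1](1) = A^[d](1) would already be
    invertible (pole1_neq0, pole2_neq0).

    For the representation, let N(z) be A(z)^-1 minus its principal part at 1. It
    is analytic around every point of the closed disc of radius 1 + eta, like A.
    Such a function has Taylor coefficients at 0 bounded by a multiple of r^-n for
    some r > 1 + eta (disc_coef_bound), whereas the trajectory grows backwards at
    most like (1 + eta)^s; so nu = N(L) eps = N(L) A(L) X converges absolutely and
    the two filters compose (filtered_cauchy_prod). Near 0,
    id - N(z) A(z) = (z-1)^-1 Psi_-1 A(z) + (z-1)^-2 Psi_-2 A(z),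
    with Psi_-2 = 0 for a simple pole. Multiplying by z - 1, once or twice, and
    comparing Taylor coefficients turns this into first or second order difference
    equations for X - nu, driven by eps (increment_pole1, increment_pole2); summing
    them gives the random walk and the double sum, and the initial values give tau0
    and tau1.

    The coefficients Phi_j of N at 0 have to be linked with the Psi_k, its
    coefficients at 1. The j-th Taylor coefficient of N, as a function of the
    centre, is itself analytic; its expansion at 1 is the sum of the
    pi_j(k) Psi_k (z-1)^(k-j), and its value at 0 is Phi_j. If that series
    converges at z = 0, then Abel's theorem identifies its sum with Phi_j
    (abel_continuation).

    Everything about analytic functions is derived from local power series. The
    tool is Cauchy's inequality, proved by averaging over roots of unity; it gives
    the uniqueness of coefficients and, applied to all derivatives at once, the
    extension of a power series beyond a disc at whose points there are expansions
    of a common radius (vexpansion_extend). *)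

(** * Real-valued norms and convergence *)

Section RealNorm.
Context {R : realType}.
Implicit Types V : normedZmodType R[i].

(** The norm of a module over R[i] takes values in R[i], whose order is partial;
    its real part allows total order arguments. *)
Definition rnorm {V} (x : V) : R := complex.Re `|x|.

Lemma rnormE {V} (x : V) : `|x| = (rnorm x)%:C.
Proof. by rewrite /rnorm RRe_real// normr_real. Qed.

Lemma rnorm_le {V} (x : V) (M : R) : (`|x| <= M%:C) = (rnorm x <= M).
Proof. by rewrite rnormE lecR. Qed.

Lemma rnorm_lt {V} (x : V) (M : R) : (`|x| < M%:C) = (rnorm x < M).
Proof. by rewrite rnormE ltcR. Qed.

Lemma rnorm_ge0 {V} (x : V) : 0 <= rnorm x.
Proof. by rewrite -lecR -rnormE normr_ge0. Qed.

Lemma rnorm0 {V} : rnorm (0 : V) = 0.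
Proof. by apply: complexI; rewrite -rnormE normr0. Qed.

Lemma rnorm0_eq0 {V} (x : V) : rnorm x = 0 -> x = 0.
Proof. by move=> x0; apply/normr0_eq0; rewrite rnormE x0. Qed.

Lemma rnormN {V} (x : V) : rnorm (- x) = rnorm x.
Proof. by rewrite /rnorm normrN. Qed.

Lemma rdistC {V} (x y : V) : rnorm (x - y) = rnorm (y - x).
Proof. by rewrite /rnorm distrC. Qed.

Lemma ler_rnormD {V} (x y : V) : rnorm (x + y) <= rnorm x + rnorm y.
Proof. by rewrite -lecR rmorphD/= -!rnormE ler_normD. Qed.

Lemma ler_rnormB {V} (x y : V) : rnorm (x - y) <= rnorm x + rnorm y.
Proof. by rewrite -(rnormN y) ler_rnormD. Qed.

Lemma ler_rdistD {V} (z x y : V) : rnorm (x - y) <= rnorm (x - z) + rnorm (z - y).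
Proof. by rewrite -[x - y](subrKA z) ler_rnormD. Qed.

Lemma ler_rnorm_sum {V} (I : Type) (r : seq I) (P : pred I) (F : I -> V) :
  rnorm (\sum_(i <- r | P i) F i) <= \sum_(i <- r | P i) rnorm (F i).
Proof.
elim/big_ind2 : _ => [|x a y b xa yb|//]; first by rewrite rnorm0.
by rewrite (le_trans (ler_rnormD _ _))// lerD.
Qed.

Lemma rnormZ {V : normedModType R[i]} (a : R[i]) (x : V) :
  rnorm (a *: x) = rnorm a * rnorm x.
Proof. by apply: complexI; rewrite rmorphM/= -!rnormE normrZ. Qed.

Lemma rnormM (a b : R[i]) : rnorm (a * b) = rnorm a * rnorm b.
Proof. by apply: complexI; rewrite rmorphM/= -!rnormE normrM. Qed.

Lemma rnormX (a : R[i]) n : rnorm (a ^+ n) = rnorm a ^+ n.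
Proof. by apply: complexI; rewrite rmorphXn/= -!rnormE normrX. Qed.

Lemma rnormV (a : R[i]) : rnorm a^-1 = (rnorm a)^-1.
Proof. by apply: complexI; rewrite fmorphV/= -!rnormE normfV. Qed.

Lemma rnorm_real (r : R) : rnorm r%:C = `|r|.
Proof. by rewrite /rnorm normc_def/= expr0n/= addr0 sqrtr_sqr. Qed.

Lemma rnorm_nat n : rnorm (n%:R : R[i]) = n%:R.
Proof. by rewrite -(rmorph_nat (real_complex R)) rnorm_real ger0_norm. Qed.

Lemma rnorm1 : rnorm (1 : R[i]) = 1.
Proof. exact: (rnorm_nat 1). Qed.

End RealNorm.

Section Convergence.
Context {R : realType}.

Lemma cvg_rnormP {V : normedModType R[i]} {T : Type} {F : set_system T}
    {FF : Filter F} (f : T -> V) (l : V) :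
  f @ F --> l <-> forall e : R, 0 < e -> \forall t \near F, rnorm (l - f t) < e.
Proof.
split=> [/cvgrPdist_lt fl e e0|fl].
  have /fl : 0 < e%:C :> R[i] by rewrite ltcR.
  by apply: filterS => t; rewrite rnorm_lt.
apply/cvgrPdist_lt => e e0.
have eE : e = (complex.Re e)%:C by rewrite RRe_real// gtr0_real.
move: e0; rewrite eE ltcR => /fl.
by apply: filterS => t; rewrite rnorm_lt.
Qed.

Lemma near_rnormP {V : pseudoMetricNormedZmodType R[i]} (w : V) (P : V -> Prop) :
  (\forall z \near w, P z) <->
  exists2 e : R, 0 < e & forall z, rnorm (z - w) < e -> P z.
Proof.
split=> [/nbhs_ballP[e /= e0 eP]|[e e0 eP]].
  have eE : e = (complex.Re e)%:C by rewrite RRe_real// gtr0_real.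
  exists (complex.Re e); first by rewrite -ltcR -eE.
  by move=> z zw; apply: eP; rewrite -ball_normE/= eE rnorm_lt rdistC.
apply/nbhs_ballP; exists e%:C => /=; first by rewrite ltcR.
by move=> z; rewrite -ball_normE/= rnorm_lt rdistC; exact: eP.
Qed.

Lemma cvg_rnorm {V : normedModType R[i]} {T : Type} {F : set_system T}
    {FF : Filter F} (f : T -> V) (l : V) :
  f @ F --> l -> rnorm (f t) @[t --> F] --> rnorm l.
Proof.
move=> /cvg_rnormP fl; apply/cvgrPdist_lt => e e0.
near=> t; have : rnorm (l - f t) < e by near: t; exact: fl.
apply: le_lt_trans; rewrite ler_norml.
have := ler_rnormD (l - f t) (f t); have := ler_rnormD (f t - l) l.
by rewrite !subrK (rdistC _ l) => ? ?; lra.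
Unshelve. all: by end_near. Qed.

Lemma rnorm_lim_le {V : normedModType R[i]} (u : nat -> V) (l : V) (C : R) :
  u @ \oo --> l -> (\forall n \near \oo, rnorm (u n) <= C) -> rnorm l <= C.
Proof.
move=> /cvg_rnorm ul uC; rewrite -(cvg_lim _ ul)//.
by apply: limr_le => //; apply/cvg_ex; exists (rnorm l).
Qed.

Lemma cvg_sumr {V : normedModType R[i]} (I : Type) (r : seq I)
    (f : I -> nat -> V) (l : I -> V) :
  (forall i, f i @ \oo --> l i) ->
  (fun n => \sum_(i <- r) f i n) @ \oo --> \sum_(i <- r) l i.
Proof.
move=> fl; elim: r => [|i r IHr].
  by rewrite big_nil; under eq_fun do rewrite big_nil; exact: cvg_cst.
by rewrite big_cons; under eq_fun do rewrite big_cons; apply: cvgD.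
Qed.

Lemma cvg_squeeze_rnorm {V : normedModType R[i]} (u : nat -> V) (l : V)
    (d : nat -> R) :
  (forall n, rnorm (l - u n) <= d n) -> d @ \oo --> 0 -> u @ \oo --> l.
Proof.
move=> ud /cvgrPdist_lt d0; apply/cvg_rnormP => e /d0; apply: filterS => n.
rewrite sub0r normrN; apply: le_lt_trans.
by rewrite (le_trans (ud n))// ler_norm.
Qed.

Lemma cvg_rnorm_bounded {V : normedModType R[i]} (u : nat -> V) (l : V) :
  u @ \oo --> l -> exists2 D : R, 0 <= D & forall n, rnorm (u n) <= D.
Proof.
move=> /cvg_rnorm ul.
have [D [_ DP]] := cvg_seq_bounded (cvgP _ ul).
exists (`|D| + 1); first by rewrite addr_ge0.
move=> n; rewrite (le_trans (ler_norm _))//; apply: DP => //.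
by rewrite (le_lt_trans (ler_norm D))// ltrDl.
Qed.

Lemma cvg_dominated_series {V : completeNormedModType R[i]} (v : nat -> V)
    (b : nat -> R) : (forall n, rnorm (v n) <= b n) -> cvgn (series b) ->
  cvgn (series v).
Proof.
move=> vb /cauchy_cvgP/cauchy_seriesP cb; apply/cauchy_cvgP/cauchy_seriesP => e e0.
have eE : e = (complex.Re e)%:C by rewrite RRe_real// gtr0_real.
move: e0; rewrite eE ltcR => /cb; apply: filterS => n.
rewrite rnorm_lt; apply: le_lt_trans.
rewrite (le_trans (ler_rnorm_sum _ _ _))// (le_trans _ (ler_norm _))//.
by apply: ler_sum.
Qed.

Lemma rnorm_lim_series_le {V : normedModType R[i]} (v : nat -> V)
    (b : nat -> R) (l : V) (C : R) :
  (forall n, rnorm (v n) <= b n) -> (forall n, series b n <= C) ->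
  series v @ \oo --> l -> rnorm l <= C.
Proof.
move=> vb bC vl; apply: (rnorm_lim_le vl); near=> n.
by rewrite (le_trans (ler_rnorm_sum _ _ _))// (le_trans _ (bC n))// ler_sum.
Unshelve. all: by end_near. Qed.

Lemma nonneg_series_cvg (b : nat -> R) (C : R) :
  (forall n, 0 <= b n) -> (forall n, series b n <= C) -> cvgn (series b).
Proof.
move=> b0 bC; apply: nondecreasing_is_cvgn; first exact: nondecreasing_series.
by exists C => _ [n _ <-].
Qed.

Lemma series_geometric_le (M q : R) n : 0 <= M -> 0 <= q < 1 ->
  series (geometric M q) n <= M / (1 - q).
Proof.
move=> M0 /andP[q0 q1]; move: q0; rewrite le_eqVlt => /predU1P[<-|q0].
  rewrite subr0 divr1 /series/=; case: n => [|n]; first by rewrite big_geq.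
  rewrite big_nat_recl//= expr0 mulr1 big1 ?addr0// => i _.
  by rewrite exprS mul0r mulr0.
by apply: geometric_le_lim => //; rewrite gtr0_norm.
Qed.

Lemma cvg_geometric_dominated {V : completeNormedModType R[i]} (v : nat -> V)
    (M q : R) : 0 <= q < 1 -> (forall n, rnorm (v n) <= M * q ^+ n) ->
  cvgn (series v).
Proof.
move=> /andP[q0 q1] vM; apply: cvg_dominated_series vM _.
by apply: (@is_cvg_geometric_series R M q); rewrite ger0_norm.
Qed.

Lemma rnorm_geometric_tail {V : normedModType R[i]} (v : nat -> V) (l : V)
    (M q : R) n : 0 <= M -> 0 <= q < 1 -> (forall n, rnorm (v n) <= M * q ^+ n) ->
  series v @ \oo --> l -> rnorm (l - series v n) <= M * q ^+ n / (1 - q).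
Proof.
move=> M0 q01 vM vl; have /andP[q0 _] := q01.
apply: (@rnorm_lim_series_le _ (fun k => v (k + n)%N) (geometric (M * q ^+ n) q)).
- by move=> k; rewrite /geometric/= -mulrA -exprD addnC.
- by move=> k; apply: series_geometric_le => //; rewrite mulr_ge0// exprn_ge0.
- have -> : series (fun k => v (k + n)%N) =
      (fun k => series v (k + n)%N - series v n).
    apply/funext => k; rewrite sub_series_geq ?leq_addl//.
    by rewrite /series/= -{2}(add0n n) big_addn addnK.
  by apply: cvgB; [rewrite (cvg_shiftn n (series v))|exact: cvg_cst].
Qed.

Lemma rnorm_geometric_lim {V : normedModType R[i]} (v : nat -> V) (l : V)
    (M q : R) : 0 <= M -> 0 <= q < 1 -> (forall n, rnorm (v n) <= M * q ^+ n) ->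
  series v @ \oo --> l -> rnorm l <= M / (1 - q).
Proof.
move=> M0 q01 vM vl; have := rnorm_geometric_tail 0 M0 q01 vM vl.
by rewrite /series/= big_geq// subr0 expr0 mulr1.
Qed.

End Convergence.

(** * Double series *)

Section DoubleSeries.
Context {R : realType}.

Definition antidiag {V : nmodType} (a : nat -> nat -> V) (m : nat) : V :=
  \sum_(0 <= i < m.+1) a i (m - i)%N.

(** The first n antidiagonals form a triangle, which is also a union of initial
    segments of rows. *)
Lemma series_antidiag {V : zmodType} (a : nat -> nat -> V) n :
  series (antidiag a) n = \sum_(0 <= i < n) series (a i) (n - i)%N.
Proof.
elim: n => [|n IHn]; first by rewrite /series/= !big_geq.
rewrite seriesSr IHn /antidiag big_nat_recr//= [in RHS]big_nat_recr//=.
rewrite subnn subSnn addrA -big_split/=; congr +%R; last first.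
  by rewrite /series/= big_nat1.
apply: eq_big_nat => i /andP[_ lin].
by rewrite (subSn (ltnW lin)) seriesSr.
Qed.

Lemma series_row_le (b : nat -> nat -> R) j n : (forall i j, 0 <= b i j) ->
  series (b j) n <= series (antidiag b) (j + n).+1.
Proof.
move=> b0; rewrite series_antidiag (bigD1_seq j) ?iota_uniq//=; last first.
  by rewrite mem_index_iota ltnS leq_addr.
rewrite subSn ?leq_addr// addKn seriesSr -addrA lerDl addr_ge0//.
by apply: sumr_ge0 => i _; apply: sumr_ge0.
Qed.

(** Fubini for an absolutely summable double family: bounded triangular sums of
    the dominating family control both orders of summation. *)
Lemma cvg_double_series {V : completeNormedModType R[i]} (a : nat -> nat -> V)
    (b : nat -> nat -> R) (C : R) (s : nat -> V) :
  (forall i j, rnorm (a i j) <= b i j) ->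
  (forall n, series (antidiag b) n <= C) ->
  (forall i, series (a i) @ \oo --> s i) ->
  cvgn (series (antidiag a)) /\
  series s @ \oo --> limn (series (antidiag a)).
Proof.
move=> ab bC as_; have b0 i j : 0 <= b i j := le_trans (rnorm_ge0 _) (ab i j).
have d0 m : 0 <= antidiag b m by rewrite sumr_ge0.
have bcvg := nonneg_series_cvg d0 bC.
have acvg : cvgn (series (antidiag a)).
  apply: cvg_dominated_series bcvg => m.
  by rewrite (le_trans (ler_rnorm_sum _ _ _))// ler_sum.
split=> //; set l := limn (series (antidiag b)).
have bl n : series (antidiag b) n <= l.
  by apply: nondecreasing_cvgn_le => //; exact: nondecreasing_series.
(* the part of the first n rows beyond the triangle is controlled by the
   tail of the dominating series *)
have close n : rnorm (series (antidiag a) n - series s n) <=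
    l - series (antidiag b) n.
  have rows : (fun J => series (antidiag a) n -
      \sum_(0 <= i < n) series (a i) (n + J)%N) @ \oo -->
      series (antidiag a) n - series s n.
    apply: cvgB; first exact: cvg_cst.
    apply: cvg_sumr => i.
    have := as_ i.
    by rewrite -(cvg_shiftn n (series (a i))); under eq_fun do rewrite addnC.
  apply: (rnorm_lim_le rows); near=> J.
  rewrite series_antidiag -sumrB (le_trans (ler_rnorm_sum _ _ _))//.
  rewrite lerBrDr (le_trans _ (bl (n + (n + J))%N))// !series_antidiag.
  rewrite (big_cat_nat _ (leq_addr (n + J) n))//= -[leLHS]addr0 lerD//; last first.
    by apply: sumr_ge0 => i _; apply: sumr_ge0.
  rewrite -big_split/=; apply: ler_sum_nat => i /andP[_ lin].
  rewrite rdistC sub_series_geq; last by lia.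
  rewrite (le_trans (lerD (ler_rnorm_sum _ _ _) (lexx _)))//.
  rewrite /series/= [leRHS](big_cat_nat _ (_ : n - i <= n + (n + J) - i)%N)//=; last by lia.
  rewrite addrC lerD//.
  rewrite [leRHS](big_cat_nat _ (_ : n + J <= n + (n + J) - i)%N)//=; [|lia|lia].
  by rewrite -[leLHS]addr0 lerD ?ler_sum// sumr_ge0.
have tail0 : (fun n => l - series (antidiag b) n) @ \oo --> (0 : R).
  by rewrite -(subrr l); apply: cvgB; [exact: cvg_cst|exact: bcvg].
have diff0 : (fun n => series (antidiag a) n - series s n) @ \oo --> (0 : V).
  by apply: (cvg_squeeze_rnorm _ tail0) => n; rewrite sub0r rnormN.
have -> : series s = fun n => series (antidiag a) n - (series (antidiag a) n - series s n).
  by apply/funext => n; rewrite subKr.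
by rewrite -[X in _ --> X]subr0; apply: cvgB.
Unshelve. all: by end_near. Qed.

Lemma series_antidiag_geometric (M p q : R) n :
  0 <= M -> 0 <= p < 1 -> 0 <= q < 1 ->
  series (antidiag (fun i j => M * p ^+ i * q ^+ j)) n <= M / (1 - q) / (1 - p).
Proof.
move=> M0 p01 q01; have /andP[p0 p1] := p01; have /andP[_ q1] := q01.
have M'0 : 0 <= M / (1 - q) by rewrite divr_ge0// subr_ge0 ltW.
rewrite series_antidiag (le_trans _ (series_geometric_le n M'0 p01))//.
apply: ler_sum => i _.
rewrite (le_trans (series_geometric_le _ (_ : 0 <= M * p ^+ i) q01))//.
  by rewrite mulr_ge0// exprn_ge0.
by rewrite mulrAC.
Qed.

End DoubleSeries.

(** * Vector-valued power series *)

Section VectorPowerSeries.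
Context {R : realType} {V : completeNormedModType R[i]}.
Implicit Types (f g : R[i] -> V) (v : nat -> V) (w z u : R[i]) (r M : R).

(** A power series with a geometric bound on its coefficients. The constants r and
    M are kept explicit because uniformity in them, over centres or over the
    argument of an operator, is what the later estimates need. *)
Definition vexpansion f w v r M : Prop :=
  [/\ 0 < r, forall n, rnorm (v n) * r ^+ n <= M &
      forall z, rnorm (z - w) < r ->
        series (fun n => (z - w) ^+ n *: v n) @ \oo --> f z].

Lemma vexpansion_M_ge0 f w v r M : vexpansion f w v r M -> 0 <= M.
Proof.
by move=> [r0 vM _]; rewrite (le_trans _ (vM 0%N))// mulr_ge0 ?rnorm_ge0.
Qed.

Lemma vexpansion_sub f w v r r' M M' : 0 < r' <= r -> M <= M' ->
  vexpansion f w v r M -> vexpansion f w v r' M'.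
Proof.
move=> /andP[r'0 r'r] MM' [r0 vM fv]; split=> //; last first.
  by move=> z zr'; apply: fv; rewrite (lt_le_trans zr').
move=> n; rewrite (le_trans _ MM')// (le_trans _ (vM n))// ler_wpM2l ?rnorm_ge0//.
by rewrite lerXn2r ?nnegrE// ltW.
Qed.

Lemma pseries_term_le v r M u n : 0 < r -> (forall n, rnorm (v n) * r ^+ n <= M) ->
  rnorm (u ^+ n *: v n) <= M * (rnorm u / r) ^+ n.
Proof.
move=> r0 /(_ n) vM; have rn : 0 < r ^+ n by rewrite exprn_gt0.
rewrite rnormZ rnormX expr_div_n mulrA ler_pdivlMr// -mulrA mulrC.
by rewrite ler_wpM2r ?exprn_ge0 ?rnorm_ge0.
Qed.

Lemma ratio_lt1 u r : rnorm u < r -> 0 <= rnorm u / r < 1.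
Proof.
move=> ur; have r0 : 0 < r := le_lt_trans (rnorm_ge0 u) ur.
by rewrite divr_ge0 ?rnorm_ge0 ?(ltW r0)//= ltr_pdivrMr// mul1r.
Qed.

Lemma cvg_pseries v r M u : (forall n, rnorm (v n) * r ^+ n <= M) ->
  rnorm u < r -> cvgn (series (fun n => u ^+ n *: v n)).
Proof.
move=> vM ur; apply: cvg_geometric_dominated (ratio_lt1 ur) _ => n.
by apply: pseries_term_le => //; apply: le_lt_trans ur; exact: rnorm_ge0.
Qed.

Definition psum v u : V := limn (series (fun n => u ^+ n *: v n)).

Lemma psum_vexpansion w v r M : 0 < r -> (forall n, rnorm (v n) * r ^+ n <= M) ->
  vexpansion (fun z => psum v (z - w)) w v r M.
Proof. by move=> r0 vM; split=> // z zr; exact: (cvg_pseries vM). Qed.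

Lemma vexpansion_psum f w v r M z : vexpansion f w v r M -> rnorm (z - w) < r ->
  f z = psum v (z - w).
Proof. by move=> [_ _ fv] /fv/cvg_lim <-. Qed.

Lemma vexpansion_center f w v r M : vexpansion f w v r M -> f w = v 0%N.
Proof.
move=> [r0 _ fE]; have := fE w; rewrite subrr rnorm0 => /(_ r0) /cvg_lim <- //.
apply: (@lim_near_cst V) => //; exists 1%N => // n /= n1.
rewrite /series/= big_ltn// expr0 scale1r big_nat_cond big1 ?addr0//.
by move=> i /andP[/andP[i1 _] _]; rewrite expr0n gtn_eqF// scale0r.
Qed.

(** The geometric bound on the terms makes f continuous at the centre, with an
    explicit modulus. *)
Lemma vexpansion_close f w v r M z : vexpansion f w v r M -> rnorm (z - w) < r ->
  rnorm (f z - f w) <= M * (rnorm (z - w) / r) / (1 - rnorm (z - w) / r).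
Proof.
move=> fv zr; have M0 := vexpansion_M_ge0 fv; have [r0 vM fE] := fv.
have := rnorm_geometric_tail 1 M0 (ratio_lt1 zr)
  (fun n => pseries_term_le (z - w) n r0 vM) (fE z zr).
by rewrite expr1 [series _ _]big_nat1 expr0 scale1r (vexpansion_center fv).
Qed.

Lemma psum_le v r M u : (forall n, rnorm (v n) * r ^+ n <= M) ->
  rnorm u < r -> rnorm (psum v u) <= M / (1 - rnorm u / r).
Proof.
move=> vM ur; have r0 : 0 < r := le_lt_trans (rnorm_ge0 u) ur.
have M0 : 0 <= M := vexpansion_M_ge0 (psum_vexpansion 0 r0 vM).
apply: (rnorm_geometric_lim M0 (ratio_lt1 ur)) (cvg_pseries vM ur) => n.
exact: pseries_term_le.
Qed.

(** Coefficients of the j-th derivative divided by j!. *)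
Definition dcoef v j n : V := 'C(j + n, j)%:R *: v (j + n)%N.

(** One term of the binomial expansion of (r + s)^(j + n) is at most the whole. *)
Lemma dcoef_le v r s M j n : 0 < r -> 0 < s ->
  (forall n, rnorm (v n) * (r + s) ^+ n <= M) ->
  rnorm (dcoef v j n) * r ^+ n <= M / s ^+ j.
Proof.
move=> r0 s0 vM; rewrite ler_pdivlMr ?exprn_gt0//.
apply: le_trans (vM (j + n)%N); rewrite rnormZ rnorm_nat.
rewrite [leLHS](_ : _ = rnorm (v (j + n)%N) * ((r ^+ n * s ^+ j) *+ 'C(j + n, j))).
  rewrite ler_wpM2l ?rnorm_ge0//.
  have jn : (j < (j + n).+1)%N by rewrite ltnS leq_addr.
  rewrite exprDn (bigD1 (Ordinal jn))//= addKn lerDl.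
  by apply: sumr_ge0 => i _; rewrite mulrn_wge0// mulr_ge0// exprn_ge0// ltW.
by rewrite -mulr_natl; ring.
Qed.

Lemma dcoef_vexpansion v r s M j w : 0 < r -> 0 < s ->
  (forall n, rnorm (v n) * (r + s) ^+ n <= M) ->
  vexpansion (fun z => psum (dcoef v j) (z - w)) w (dcoef v j) r (M / s ^+ j).
Proof. by move=> r0 s0 vM; apply: psum_vexpansion => // n; apply: dcoef_le. Qed.

(** Expanding (u + h)^m distributes the m-th term of a power series over the
    m-th antidiagonal, which is how a series is recentred by u. *)
Lemma antidiag_binomial (W : lmodType R[i]) (h u : R[i]) (x : nat -> W) m :
  antidiag (fun j n => h ^+ j *: (u ^+ n *: ('C(j + n, j)%:R *: x (j + n)%N))) m =
  (u + h) ^+ m *: x m.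
Proof.
rewrite /antidiag exprDn scaler_suml big_mkord; apply: eq_bigr => -[i /= im] _.
rewrite subnKC// !scalerA -mulr_natr; congr (_ *: _).
by ring.
Qed.

(** The double series of the terms of (u + h)^m v_m is dominated as long as
    |u| + |h| < r; summing its rows first gives the expansion in h. *)
Lemma vexpansion_recenter f w v r M u r' : vexpansion f w v r M ->
  0 < r' -> rnorm u + r' < r ->
  vexpansion f (w + u) (fun j => psum (dcoef v j) u) r'
    (M / (1 - (rnorm u + r') / r)).
Proof.
move=> fv r'0 ur'; have [r0 vM fE] := fv; have M0 := vexpansion_M_ge0 fv.
have u0 := rnorm_ge0 u.
have q01 : 0 <= (rnorm u + r') / r < 1.
  rewrite ltr_pdivrMr// mul1r ur' andbT divr_ge0 ?(ltW r0)//.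
  by rewrite addr_ge0// ltW.
pose b h j n : R := h ^+ j * (rnorm u ^+ n * ('C(j + n, j)%:R * rnorm (v (j + n)%N))).
have bE h m : antidiag (b h) m = (rnorm u + h) ^+ m * rnorm (v m).
  rewrite /antidiag exprDn mulr_suml big_mkord; apply: eq_bigr => -[i /= im] _.
  by rewrite /b subnKC// -mulr_natr; ring.
have b0 h j n : 0 <= h -> 0 <= b h j n.
  by move=> h0; rewrite !mulr_ge0 ?exprn_ge0 ?rnorm_ge0.
have bC h n : 0 <= h <= r' -> series (antidiag (b h)) n <= M / (1 - (rnorm u + r') / r).
  move=> /andP[h0 hr']; apply: le_trans (series_geometric_le n M0 q01).
  apply: ler_sum => m _; rewrite bE /geometric/= expr_div_n mulrA.
  rewrite ler_pdivlMr ?exprn_gt0// -mulrA [leRHS]mulrC.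
  apply: ler_pM; rewrite ?mulr_ge0 ?rnorm_ge0 ?exprn_ge0 ?addr_ge0 ?(ltW r0)//.
  by rewrite lerXn2r ?nnegrE ?addr_ge0 ?lerD// ltW.
have rows j : cvgn (series (fun n => u ^+ n *: dcoef v j n)).
  pose s := (r - rnorm u) / 2; have s0 : 0 < s by rewrite /s; lra.
  have r1 : 0 < rnorm u + s by lra.
  have vM' n : rnorm (v n) * (rnorm u + s + s) ^+ n <= M.
    by have := vM n; rewrite (_ : rnorm u + s + s = r)//; rewrite /s; field.
  by apply: (cvg_pseries (fun n => dcoef_le j n r1 s0 vM')); lra.
have rowle j : rnorm (psum (dcoef v j) u) * r' ^+ j <= M / (1 - (rnorm u + r') / r).
  have r'E : rnorm (r'%:C ^+ j) = r' ^+ j by rewrite rnormX rnorm_real gtr0_norm.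
  rewrite mulrC -r'E -rnormZ.
  apply: (@rnorm_lim_series_le _ _ (fun n => r'%:C ^+ j *: (u ^+ n *: dcoef v j n)) (b r' j)).
  - by move=> n; rewrite !rnormZ r'E rnormX rnorm_nat.
  - move=> n; have /(bC r' (j + n).+1) : 0 <= r' <= r' by rewrite lexx ltW.
    by apply: le_trans; apply: series_row_le => i k; apply: b0; exact: ltW.
  - have -> : series (fun n => r'%:C ^+ j *: (u ^+ n *: dcoef v j n)) =
        (fun n => r'%:C ^+ j *: series (fun n => u ^+ n *: dcoef v j n) n).
      by apply/funext => n; rewrite /series/= scaler_sumr.
    exact: cvgZr.
split=> // z; rewrite opprD addrA; set h := z - w - u => hr'.
have h0 := rnorm_ge0 h.
have := @cvg_double_series _ V
  (fun j n => h ^+ j *: (u ^+ n *: ('C(j + n, j)%:R *: v (j + n)%N)))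
  (b (rnorm h)) _ (fun j => h ^+ j *: psum (dcoef v j) u) _ (fun n => bC _ n _).
have -> : antidiag (fun j n => h ^+ j *: (u ^+ n *: ('C(j + n, j)%:R *: v (j + n)%N)))
    = (fun m => (z - w) ^+ m *: v m).
  by apply/funext => m; rewrite antidiag_binomial /h subrKC.
have zr : rnorm (z - w) < r.
  by rewrite -(subrKC u (z - w)) (le_lt_trans (ler_rnormD _ _))// (lt_trans _ ur')// ltrD2l.
rewrite (cvg_lim _ (fE _ zr))// => H; apply H.
- by move=> i j; rewrite !rnormZ !rnormX rnorm_nat.
- by rewrite h0 ltW.
- move=> j; rewrite [X in X @ _ --> _](_ : _ =
      (fun n => h ^+ j *: series (fun n => u ^+ n *: dcoef v j n) n)).
    by apply: cvgZr; exact: rows.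
  by apply/funext => n; rewrite /series/= scaler_sumr.
Qed.

End VectorPowerSeries.

(** * Cauchy's inequality and the identity theorem *)

Lemma prim_root_exists {R : rcfType} n : (0 < n)%N ->
  exists z : R[i], n.-primitive_root z.
Proof.
pose p : {poly R[i]} := 'X^n - 1; have [r Dp] := closed_field_poly_normal p.
move=> n_gt0; rewrite (monicP _) ?monicXnsubC// scale1r in Dp.
have rn1 : all n.-unity_root r.
  by apply/allP => z; rewrite -root_prod_XsubC -Dp.
have sz_r : (n < (size r).+1)%N.
  by rewrite -(size_prod_XsubC r id) -Dp size_XnsubC.
have [|z] := hasP (cyclic.has_prim_root n_gt0 rn1 _ sz_r); last by exists z.
by rewrite -separable.separable_prod_XsubC -Dp cyclotomic.separable_Xn_sub_1// pnatr_eq0 -lt0n.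
Qed.

Section Cauchy.
Context {R : realType} {V : completeNormedModType R[i]}.
Implicit Types (f g : R[i] -> V) (v : nat -> V) (w z u : R[i]) (r M : R).

Lemma rnorm_prim_root n (z : R[i]) : n.-primitive_root z -> rnorm z = 1.
Proof.
move=> zn; have n0 := prim_order_gt0 zn.
apply/eqP; rewrite -(@pexpr_eq1 _ _ n) ?rnorm_ge0//.
by rewrite -rnormX (prim_expr_order zn) rnorm1.
Qed.

Lemma sum_prim_root n (z : R[i]) m : n.-primitive_root z ->
  \sum_(0 <= k < n) (z ^+ m) ^+ k = if (n %| m)%N then n%:R else 0.
Proof.
move=> zn; case: ifPn => [|nm].
  rewrite (prim_order_dvd zn) => /eqP ->.
  by under eq_bigr do rewrite expr1n; rewrite big_const_nat iter_addr addr0 subn0.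
apply/eqP; rewrite -(mulrI_eq0 _ (_ : GRing.lreg (z ^+ m - 1))); last first.
  by apply/mulfI; rewrite subr_eq0 -(prim_order_dvd zn).
by rewrite big_mkord -subrX1 exprAC (prim_expr_order zn) expr1n subrr.
Qed.

(** Averaging [zeta^-n f (w + r zeta)] over the N-th roots of unity zeta keeps
    only the terms of order n modulo N, so that [v n * r^n] is recovered up to
    the tail of order N. *)
Lemma cauchy_inequality f w v rho M r (S : R) n : vexpansion f w v rho M ->
  0 <= r < rho -> (forall z, rnorm (z - w) = r -> rnorm (f z) <= S) ->
  rnorm (v n) * r ^+ n <= S.
Proof.
move=> fv /andP[r0 rrho] fS; have [rho0 vM fE] := fv.
have M0 := vexpansion_M_ge0 fv.
have rC k (zeta : R[i]) : rnorm zeta = 1 -> rnorm (r%:C * zeta ^+ k) = r.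
  by move=> z1; rewrite rnormM rnorm_real ger0_norm// rnormX z1 expr1n mulr1.
pose q := r / rho.
have q01 : 0 <= q < 1 by rewrite divr_ge0 ?(ltW rho0)//= ltr_pdivrMr// mul1r.
have approx N : (n < N)%N -> rnorm (v n) * r ^+ n <= S + M * q ^+ N / (1 - q).
  move=> nN; have N0 : (0 < N)%N by apply: leq_ltn_trans nN.
  have [zeta zP] := @prim_root_exists R N N0; have z1 := rnorm_prim_root zP.
  pose d := (N - n)%N.
  pose avg := N%:R^-1 *: \sum_(0 <= k < N) (zeta ^+ (k * d)) *: f (w + r%:C * zeta ^+ k).
  pose e m : R[i] := N%:R^-1 * \sum_(0 <= k < N) (zeta ^+ (m + d)) ^+ k.
  have e1 m : rnorm (e m) <= 1.
    rewrite /e sum_prim_root//; case: ifP => _; last by rewrite mulr0 rnorm0.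
    by rewrite mulVf ?rnorm1// pnatr_eq0 -lt0n.
  have avgS : rnorm avg <= S.
    rewrite rnormZ rnormV rnorm_nat ler_pdivrMl ?ltr0n//.
    rewrite (le_trans (ler_rnorm_sum _ _ _))//.
    rewrite (@le_trans _ _ (\sum_(0 <= k < N) S))//; last first.
      by rewrite sumr_const_nat subn0 mulr_natl.
    apply: ler_sum => k _; rewrite rnormZ rnormX z1 expr1n mul1r fS//.
    by rewrite addrAC subrr add0r rC.
  have avgE : series (fun m => e m *: (r%:C ^+ m *: v m)) @ \oo --> avg.
    have -> : series (fun m => e m *: (r%:C ^+ m *: v m)) =
        (fun K => N%:R^-1 *: \sum_(0 <= k < N) (zeta ^+ (k * d) *:
          series (fun m => (w + r%:C * zeta ^+ k - w) ^+ m *: v m) K)).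
      apply/funext => K; rewrite /series/=.
      under [in RHS]eq_bigr do rewrite scaler_sumr.
      rewrite exchange_big/= scaler_sumr; apply: eq_bigr => m _.
      rewrite /e -scalerA; congr (_ *: _); rewrite scaler_suml.
      apply: eq_bigr => k _; rewrite !scalerA; congr (_ *: _).
      rewrite addrAC subrr add0r exprMn -!exprM mulnDl exprD mulnC (mulnC d).
      by ring.
    apply: cvgZr; apply: cvg_sumr => k; apply: cvgZr; apply: fE.
    by rewrite addrAC subrr add0r rC.
  have head : series (fun m => e m *: (r%:C ^+ m *: v m)) N = r%:C ^+ n *: v n.
    rewrite /series/= (bigD1_seq n) ?iota_uniq ?mem_index_iota//=.
    rewrite big_seq_cond big1 ?addr0.
      rewrite /e sum_prim_root// /d subnKC 1?ltnW// dvdnn mulVf ?scale1r//.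
      by rewrite pnatr_eq0 -lt0n.
    move=> m /andP[]; rewrite mem_index_iota => /= mN mn.
    rewrite /e sum_prim_root// /d ifF ?mulr0 ?scale0r//.
    apply/negP => /dvdnP[[|[|k]] E]; rewrite ?mul0n ?mul1n in E; [lia|lia|].
    by rewrite !mulSn in E; lia.
  have tail : rnorm (avg - r%:C ^+ n *: v n) <= M * q ^+ N / (1 - q).
    rewrite -head; apply: rnorm_geometric_tail M0 q01 _ avgE => m.
    rewrite rnormZ -[leRHS]mul1r.
    apply: ler_pM; rewrite ?rnorm_ge0// (le_trans (pseries_term_le _ _ rho0 vM))//.
    by rewrite rnorm_real ger0_norm.
  have : rnorm (r%:C ^+ n *: v n) <= rnorm avg + rnorm (avg - r%:C ^+ n *: v n).
    by rewrite (le_trans _ (ler_rnormB _ _))// subKr.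
  rewrite rnormZ rnormX rnorm_real ger0_norm// mulrC => /le_trans; apply.
  exact: lerD.
have lim : (fun N => S + M * q ^+ N / (1 - q)) @ \oo --> S.
  rewrite -[X in _ --> X]addr0; apply: cvgD; first exact: cvg_cst.
  rewrite -[X in _ --> X](mul0r (1 - q)^-1); apply: cvgMl.
  by apply: (@cvg_geometric R M q); have /andP[? ?] := q01; rewrite ger0_norm.
rewrite -(cvg_lim _ lim)//; apply: limr_ge; first by apply/cvg_ex; exists S.
by near=> N; apply: approx; near: N; exact: nbhs_infty_gt.
Unshelve. all: by end_near. Qed.

(** The difference of the coefficients belongs to the zero function, so it
    vanishes by Cauchy's inequality. *)
Lemma vexpansion_unique f g w v v' r r' M M' (e : R) :
  vexpansion f w v r M -> vexpansion g w v' r' M' ->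
  0 < e -> (forall z, rnorm (z - w) < e -> f z = g z) -> v = v'.
Proof.
move=> [r0 vM fE] [r'0 vM' gE] e0 fg; apply/funext => n; apply/subr0_eq.
apply: rnorm0_eq0.
pose s := Num.min e (Num.min r r').
have s0 : 0 < s by rewrite !lt_min e0 r0.
have [se sr sr'] : [/\ s <= e, s <= r & s <= r'].
  by rewrite /s; split; rewrite !ge_min lexx ?orbT.
have h : vexpansion (fun=> 0) w (fun n => v n - v' n) s (M + M').
  split=> // [k|z zs].
    have sk (t : R) : s <= t -> s ^+ k <= t ^+ k.
      by move=> st; rewrite lerXn2r ?nnegrE ?(ltW s0)// (le_trans (ltW s0)).
    rewrite (le_trans (ler_wpM2r (exprn_ge0 _ (ltW s0)) (ler_rnormB _ _)))//.
    rewrite mulrDl lerD//.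
      by apply: le_trans (vM k); rewrite ler_wpM2l ?rnorm_ge0 ?sk.
    by apply: le_trans (vM' k); rewrite ler_wpM2l ?rnorm_ge0 ?sk.
  rewrite -(subrr (f z)) {2}fg ?(lt_le_trans zs)//.
  have -> : series (fun n => (z - w) ^+ n *: (v n - v' n)) =
      (fun k => series (fun n => (z - w) ^+ n *: v n) k -
                series (fun n => (z - w) ^+ n *: v' n) k).
    apply/funext => k; rewrite /series/= -sumrB.
    by apply: eq_bigr => i _; rewrite scalerBr.
  by apply: cvgB; [apply: fE|apply: gE]; apply: lt_le_trans zs _.
have s2 : 0 <= s / 2 < s by lra.
have : rnorm (v n - v' n) * (s / 2) ^+ n <= 0.
  by apply: (cauchy_inequality n h s2) => z _; rewrite rnorm0.
rewrite pmulr_lle0 ?exprn_gt0 ?divr_gt0// => le0.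
by apply/eqP; rewrite eq_le le0 rnorm_ge0.
Qed.

Lemma vexpansion_agree f g w v v' r M M' (e : R) :
  vexpansion f w v r M -> vexpansion g w v' r M' ->
  0 < e -> (forall z, rnorm (z - w) < e -> f z = g z) ->
  forall z, rnorm (z - w) < r -> f z = g z.
Proof.
move=> fv gv e0 fg z zr; have vv' := vexpansion_unique fv gv e0 fg.
by rewrite (vexpansion_psum fv zr) (vexpansion_psum gv zr) vv'.
Qed.

End Cauchy.

(** * Expansions at all points of a closed disc *)

Section Disc.
Context {R : realType}.

Lemma rnorm_complex_le (x y : R) : rnorm (x +i* y) <= `|x| + `|y|.
Proof.
have -> : x +i* y = x%:C + 'i * y%:C.
  by apply/eqP; rewrite eq_complex/=; apply/andP; split; apply/eqP; ring.
rewrite (le_trans (ler_rnormD _ _))// rnormM !rnorm_real lerD2l.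
by rewrite {1}/rnorm normc_def/= expr0n expr1n add0r sqrtr1 mul1r.
Qed.

(** Compactness of the closed disc, transported from a square of R * R. The
    property Q is local: it holds near each point for all small parameters d, so a
    single d serves the whole disc. *)
Lemma disc_covering (rho : R) (Q : R -> R[i] -> Prop) :
  (forall w, rnorm w <= rho -> exists2 e : R, 0 < e &
     forall d w', 0 < d < e -> rnorm (w' - w) < e -> Q d w') ->
  exists2 d : R, 0 < d & forall w, rnorm w <= rho -> Q d w.
Proof.
move=> locQ.
have /compact_near_coveringP cov : compact (`[- rho, rho] `*` `[- rho, rho]).
  by apply: compact_setX; exact: segment_compact.
pose P (d : R) (p : R * R) := rnorm (p.1 +i* p.2) <= rho -> Q d (p.1 +i* p.2).
have : \forall d \near 0^'+, forall p : R * R,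
    (`[- rho, rho] `*` `[- rho, rho]) p -> P d p.
  apply: (cov _ _ P) => -[x y] _.
  have [e e0 eP] : exists2 e : R, 0 < e & forall d w', 0 < d < e ->
      rnorm (w' - (x +i* y)) < e -> rnorm w' <= rho -> Q d w'.
    have [/locQ[e e0 eQ]|gap] := leP (rnorm (x +i* y)) rho.
      by exists e => // d w' de ww' _; exact: eQ de ww'.
    exists (rnorm (x +i* y) - rho); first by rewrite subr_gt0.
    move=> d w' _; rewrite rdistC => close w'rho; exfalso.
    by have := ler_rnormD (x +i* y - w') w'; rewrite subrK; lra.
  have small : \forall d \near (0 : R)^'+, 0 < d < e.
    near=> d; apply/andP; split; near: d; first exact: nbhs_right_gt.
    exact: nbhs_right_lt.
  exists (ball (x, y) (e / 2), [set d | 0 < d < e]) => /=.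
    by split=> //; apply: nbhsx_ballx; rewrite divr_gt0.
  move=> [[x' y'] d] [/= [/= xx' yy'] de]; rewrite /ball/= in xx' yy'.
  apply: (eP _ _ de).
  have -> : (x' +i* y') - (x +i* y) = (x' - x) +i* (y' - y) by [].
  rewrite (le_lt_trans (rnorm_complex_le _ _))//.
  by rewrite (splitr e) ltrD// distrC.
move=> near_d; near (0 : R)^'+ => d; exists d => //.
move=> [x y] xy; have /(_ (x, y)) : forall p : R * R,
    (`[- rho, rho] `*` `[- rho, rho]) p -> P d p by near: d.
apply => //; split => /=; rewrite in_itv/= -ler_norml (le_trans _ xy)//.
  by rewrite -lecR -rnormE; exact: (normc_ge_Re (x +i* y)).
rewrite /rnorm normc_def/= -[leLHS]sqrtr_sqr ler_sqrt ?lerDr ?sqr_ge0//.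
by rewrite addr_ge0 ?sqr_ge0.
Unshelve. all: by end_near. Qed.

Section Extension.
Context {V : completeNormedModType R[i]}.
Implicit Types (f : R[i] -> V) (v : nat -> V).

(** Each point w of the disc of radius rho has an expansion of radius d, so the
    k-th Taylor coefficient at w is at most M / d^k. Cauchy's inequality, applied
    to that coefficient as a function of w on |w| = r', bounds
    C(k + n, k) |v_(k+n)| r'^n by M / d^k. Multiplying by s^k with s < d and summing
    over k + n = m, the binomial theorem gives |v_m| (r' + s)^m <= M / (1 - s/d), so
    the radius increases by a fixed amount without degrading the bound. *)
Lemma vexpansion_extend f v (d M rho : R) :
  (forall w, rnorm w <= rho -> exists v', vexpansion f w v' d M) ->
  vexpansion f 0 v d M -> d <= rho ->
  forall r, d <= r <= rho + d / 2 -> vexpansion f 0 v r (4 * M).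
Proof.
move=> loc f0 drho; have [d0 _ _] := f0; have M0 := vexpansion_M_ge0 f0.
have base : vexpansion f 0 v d (4 * M).
  by apply: vexpansion_sub f0; rewrite ?d0 ?lexx//; lra.
have step r : d <= r <= rho -> vexpansion f 0 v r (4 * M) ->
    vexpansion f 0 v (r + d / 2) (4 * M).
  move=> /andP[dr rrho] fr; have [r0 vM fE] := fr.
  (* the bound on the coefficients is carried from radius r - d/4 by the ratio
     s/d = 3/4, whence the radius r + d/2 and the factor 4 = 1 / (1 - 3/4) *)
  pose r0' := r - d / 4; have r0'0 : 0 < r0' by rewrite /r0'; lra.
  (* the coefficients at a point of the circle of radius r0' *)
  have coefs w k : rnorm w = r0' -> rnorm (psum (dcoef v k) w) * d ^+ k <= M.
    move=> wr; have [|v' fw] := loc w; first by rewrite wr /r0'; lra.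
    have [d80 wd] : 0 < d / 8 /\ rnorm w + d / 8 < r by rewrite wr /r0'; lra.
    have fw' := vexpansion_recenter fr d80 wd; rewrite add0r in fw'.
    have -> : psum (dcoef v k) w = v' k.
      by rewrite -[LHS]/((fun j => psum (dcoef v j) w) k)
        (vexpansion_unique fw' fw d0 (fun _ _ => erefl)).
    by have [_ + _] := fw; apply.
  have dcM k n : rnorm (dcoef v k n) * r0' ^+ n <= M / d ^+ k.
    have d80 : 0 < d / 8 by lra.
    have r80 : 0 < r - d / 8 by lra.
    have vM' n' : rnorm (v n') * (r - d / 8 + d / 8) ^+ n' <= 4 * M.
      by rewrite subrK.
    have g := dcoef_vexpansion k 0 r80 d80 vM'.
    apply: (cauchy_inequality n g); first by rewrite /r0'; lra.
    move=> z; rewrite subr0 => zr; rewrite ler_pdivlMr ?exprn_gt0//.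
    exact: coefs.
  have vM2 n : rnorm (v n) * (r + d / 2) ^+ n <= 4 * M.
    have -> : r + d / 2 = r0' + (3 / 4) * d by rewrite /r0'; field.
    rewrite exprDn mulr_sumr.
    have -> : 4 * M = M / (1 - 3 / 4) by field.
    have q34 : 0 <= (3 / 4 : R) < 1 by lra.
    apply: le_trans (series_geometric_le n.+1 M0 q34).
    rewrite /series/= big_mkord; apply: ler_sum => -[k /=]; rewrite ltnS => kn _.
    have := dcM k (n - k)%N; rewrite /dcoef subnKC// rnormZ rnorm_nat.
    rewrite ler_pdivlMr ?exprn_gt0// => le.
    rewrite exprMn -mulr_natr.
    rewrite (_ : rnorm (v n) * _ = ('C(n, k)%:R * rnorm (v n) * r0' ^+ (n - k) * d ^+ k) *
      (3 / 4) ^+ k); last by ring.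
    by rewrite ler_wpM2r// exprn_ge0//; lra.
  have r20 : 0 < r + d / 2 by lra.
  have gE := psum_vexpansion 0 r20 vM2.
  split=> // z; rewrite subr0 => zr.
  suff -> : f z = psum v z by exact: (cvg_pseries vM2).
  have [zr0|zr0] := ltP (rnorm z) r.
    by rewrite (vexpansion_psum fr) ?subr0.
  (* z is outside the old disc: continue from the point w of radius r - d/4 on
     the same ray *)
  have z0 : 0 < rnorm z by apply: lt_le_trans zr0.
  pose w := (r0' / rnorm z)%:C * z.
  have wr : rnorm w = r0'.
    by rewrite /w rnormM rnorm_real ger0_norm ?divr_ge0 ?ltW// divfK// gt_eqF.
  have zw : rnorm (z - w) = rnorm z - r0'.
    rewrite /w -{1}[z]mul1r -mulrBl rnormM.
    have -> : 1 - (r0' / rnorm z)%:C = (1 - r0' / rnorm z)%:C :> R[i].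
      by rewrite rmorphB.
    have le1 : 0 <= 1 - r0' / rnorm z.
      by rewrite subr_ge0 ler_pdivrMr// mul1r /r0'; lra.
    by rewrite rnorm_real (ger0_norm le1) mulrBl mul1r divfK// gt_eqF.
  have [|v' fw] := loc w; first by rewrite wr /r0'; lra.
  pose s := (rnorm z - r0' + (r + d / 2 - r0')) / 2.
  have [s0 ws] : 0 < s /\ rnorm w + s < r + d / 2 by rewrite wr /s /r0'; lra.
  have gw := vexpansion_recenter gE s0 ws; rewrite add0r in gw.
  have sd : 0 < s <= d by rewrite /s /r0'; lra.
  have fws := vexpansion_sub sd (lexx M) fw.
  have d4 : 0 < d / 4 by lra.
  rewrite -[z in RHS]subr0.
  apply: (vexpansion_agree fws gw d4); last by rewrite zw /s; lra.
  move=> y yw; rewrite -(vexpansion_psum fr)// subr0.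
  have := ler_rnormD (y - w) w; rewrite subrK wr /r0'; lra.
suff H k : forall r, d <= r <= d + k%:R * (d / 2) -> r <= rho + d / 2 ->
    vexpansion f 0 v r (4 * M).
  move=> r /andP[dr rrho].
  have [k kr] : exists k, (r - d) / (d / 2) < k%:R.
    exists (Num.bound ((r - d) / (d / 2))); apply: archi_boundP.
    by rewrite divr_ge0//; lra.
  apply: (H k) => //; rewrite dr/=; move: kr.
  by rewrite ltr_pdivrMr ?divr_gt0//; lra.
elim: k => [|k IHk] r /andP[dr rk] rrho.
  by have -> : r = d by lra.
have [rd|rd] := leP (r - d / 2) d.
  have := @step d; rewrite lexx drho => /(_ isT base).
  by apply: vexpansion_sub => //; lra.
have -> : r = r - d / 2 + d / 2 by rewrite subrK.
apply: step; first by lra.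
apply: IHk; last by lra.
by move: rk; rewrite -natr1 mulrDl mul1r; lra.
Qed.

End Extension.
End Disc.

(** * Bounded operators *)

Section BoundedOperators.
Context {R : realType} {B : completeNormedModType R[i]}.
Implicit Types (T S : B -> B) (x y : B).

Lemma linB T : linear T -> {morph T : x y / x - y}.
Proof. by move=> lT x y; rewrite -scaleN1r addrC lT scaleN1r addrC. Qed.

Lemma lin0 T : linear T -> T 0 = 0.
Proof. by move=> lT; rewrite -[X in T X](subrr 0) linB// subrr. Qed.

Lemma linD T : linear T -> {morph T : x y / x + y}.
Proof. by move=> lT x y; have := lT 1 x y; rewrite !scale1r. Qed.

Lemma linN T : linear T -> {morph T : x / - x}.
Proof. by move=> lT x; rewrite -sub0r (linB lT) (lin0 lT) sub0r. Qed.

Lemma linZ T : linear T -> forall a x, T (a *: x) = a *: T x.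
Proof. by move=> lT a x; have := lT a x 0; rewrite (lin0 lT) !addr0. Qed.

Lemma lin_sum T (I : Type) (s : seq I) (F : I -> B) : linear T ->
  T (\sum_(i <- s) F i) = \sum_(i <- s) T (F i).
Proof. by move=> lT; exact: (big_morph T (linD lT) (lin0 lT)). Qed.

Lemma lin_series T (u : nat -> B) : linear T ->
  (fun n => T (series u n)) = series (fun n => T (u n)).
Proof. by move=> lT; apply/funext => n; rewrite /series/= lin_sum. Qed.

(** The complex constant in the definition of a bounded operator can be replaced
    by a nonnegative real one, even on the zero space. *)
Lemma bounded_opP T : bounded_op T <->
  linear T /\ exists2 M : R, 0 <= M & forall x, rnorm (T x) <= M * rnorm x.
Proof.
split=> -[lT]; last first.
  move=> [M M0 TM]; split=> //; exists M%:C => x.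
  by rewrite !rnormE -rmorphM/= lecR.
move=> [M TM]; split=> //; exists `|complex.Re M| => // x.
have := TM x; rewrite !rnormE lecE => /andP[_ /=].
have -> : complex.Re (M * (rnorm x)%:C) = complex.Re M * rnorm x.
  by case: M {TM} => a b /=; rewrite mulr0 subr0.
move=> /le_trans; apply.
by rewrite ler_wpM2r ?rnorm_ge0// ler_norm.
Qed.

Lemma bounded_lin T : bounded_op T -> linear T. Proof. by case. Qed.
Hint Resolve bounded_lin : core.

Lemma bounded_cvg T (u : nat -> B) l : bounded_op T -> u @ \oo --> l ->
  (fun n => T (u n)) @ \oo --> T l.
Proof.
move=> /bounded_opP[lT [M M0 TM]] /cvg_rnormP ul; apply/cvg_rnormP => e e0.
have /ul : 0 < e / (M + 1) by rewrite divr_gt0// ltr_wpDl.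
apply: filterS => n; rewrite ltr_pdivlMr ?ltr_wpDl// => h.
rewrite -linB// (le_lt_trans (TM _))// (le_lt_trans _ h)// mulrC.
by rewrite ler_wpM2l ?rnorm_ge0// lerDl.
Qed.

Lemma bounded_op0 : bounded_op (0 : B -> B).
Proof.
apply/bounded_opP; split; first by move=> a x y; rewrite /= scaler0 addr0.
by exists 0 => // x; rewrite mul0r rnorm0.
Qed.

Lemma bounded_op_id : bounded_op (id : B -> B).
Proof. by apply/bounded_opP; split=> //; exists 1 => // x; rewrite mul1r. Qed.

Lemma bounded_opD T S : bounded_op T -> bounded_op S -> bounded_op (T + S).
Proof.
move=> /bounded_opP[lT [M M0 TM]] /bounded_opP[lS [N N0 SN]]; apply/bounded_opP.
split; first by move=> a x y; rewrite addrfctE lT lS scalerDr addrACA.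
exists (M + N); first exact: addr_ge0.
by move=> x; rewrite addrfctE mulrDl (le_trans (ler_rnormD _ _))// lerD.
Qed.

Lemma bounded_opZ a T : bounded_op T -> bounded_op (a *: T).
Proof.
move=> /bounded_opP[lT [M M0 TM]]; apply/bounded_opP; split.
  by move=> b x y; rewrite scalrfctE lT scalerDr !scalerA mulrC.
exists (rnorm a * M); first by rewrite mulr_ge0 ?rnorm_ge0.
by move=> x; rewrite scalrfctE rnormZ -mulrA ler_wpM2l ?rnorm_ge0.
Qed.

Lemma bounded_opN T : bounded_op T -> bounded_op (- T).
Proof. by rewrite -scaleN1r; exact: bounded_opZ. Qed.

Lemma bounded_opB T S : bounded_op T -> bounded_op S -> bounded_op (T - S).
Proof. by move=> bT bS; apply/bounded_opD/bounded_opN. Qed.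

Lemma bounded_op_comp T S : bounded_op T -> bounded_op S -> bounded_op (T \o S).
Proof.
move=> /bounded_opP[lT [M M0 TM]] /bounded_opP[lS [N N0 SN]]; apply/bounded_opP.
split; first by move=> a x y; rewrite /= lS lT.
exists (M * N); first exact: mulr_ge0.
by move=> x; rewrite (le_trans (TM _))// -mulrA ler_wpM2l.
Qed.

Lemma lim_linear (T : nat -> B -> B) S : (forall n, linear (T n)) ->
  (forall x, (fun n => T n x) @ \oo --> S x) -> linear S.
Proof.
move=> lT TS a x y; have /cvg_lim <- // := TS (a *: x + y).
apply: cvg_lim => //; under eq_fun do rewrite lT.
by apply: cvgD => //; apply: cvgZr.
Qed.

Lemma op_inv_inverse T : op_invertible T -> op_inverse T (op_inv T).
Proof. by move=> [S TS]; rewrite /op_inv; case: xgetP => [? ->//|/(_ S)]. Qed.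

Lemma op_inverse_unique T S S' : op_inverse T S -> op_inverse T S' -> S = S'.
Proof.
move=> [_ _ ST] [_ TS' _]; apply/funext => x.
by have := congr1 (fun f => S (f x)) TS' => /= <-; exact: (congr1 (@^~ (S' x)) ST).
Qed.

Lemma op_inv_unique T S : op_inverse T S -> op_inv T = S.
Proof.
by move=> TS; apply: (op_inverse_unique (op_inv_inverse _) TS); exists S.
Qed.

Lemma op_sum_cvg m (u : nat -> B -> B) S x : op_sum m u S ->
  (fun n => \sum_(m <= k < n) u k x) @ \oo --> S x.
Proof.
move=> uS; apply/cvg_rnormP => e e0.
have x0 : 0 < rnorm x + 1 by rewrite ltr_wpDl ?rnorm_ge0.
have /uS : 0 < (e / (rnorm x + 1))%:C by rewrite ltcR divr_gt0.
apply: filterS => n /(_ x); rewrite fct_sumE !rnormE -rmorphM/= lecR rdistC.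
move=> /le_lt_trans; apply; rewrite mulrAC ltr_pdivrMr// ltr_pM2l//.
by rewrite ltrDl.
Qed.

End BoundedOperators.

(** * Operator-valued power series *)

Section Expansion.
Context {R : realType} {B : completeNormedModType R[i]}.
Implicit Types (f g : R[i] -> B -> B) (c : nat -> B -> B) (w z u : R[i]) (r M : R).

Local Notation C := (Num.NumField.sort R[i]).

(** An operator expansion is tested on vectors, with a bound proportional to the
    norm of the vector: this uniformity is what makes the series converge in
    operator norm. *)
Definition expansion f w c r M : Prop :=
  [/\ 0 <= M, forall n, linear (c n) &
      forall x, vexpansion (f ^~ x) w (c ^~ x) r (M * rnorm x)].

Lemma expansion_r_gt0 f w c r M : expansion f w c r M -> 0 < r.
Proof. by move=> [_ _ /(_ 0)[]]. Qed.

Lemma expansion_coef_le f w c r M : expansion f w c r M ->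
  forall n x, rnorm (c n x) * r ^+ n <= M * rnorm x.
Proof. by move=> [_ _ fc] n x; have [_ + _] := fc x. Qed.

Lemma expansion_bounded_op f w c r M n : expansion f w c r M -> bounded_op (c n).
Proof.
move=> fc; have r0 := expansion_r_gt0 fc; have [M0 lc _] := fc.
apply/bounded_opP; split=> //; exists (M / r ^+ n).
  by rewrite divr_ge0// exprn_ge0// ltW.
move=> x; rewrite mulrAC ler_pdivlMr ?exprn_gt0//; exact: (expansion_coef_le fc n x).
Qed.

Lemma expansion_sub f w c r r' M M' : 0 < r' <= r -> M <= M' ->
  expansion f w c r M -> expansion f w c r' M'.
Proof.
move=> r'r MM' [M0 lc fc]; split=> //; first exact: le_trans M0 MM'.
by move=> x; apply: vexpansion_sub (fc x) => //; rewrite ler_wpM2r ?rnorm_ge0.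
Qed.

Lemma expansion_unique f g w c c' r r' M M' (e : R) :
  expansion f w c r M -> expansion g w c' r' M' -> 0 < e ->
  (forall z, rnorm (z - w) < e -> f z = g z) -> c = c'.
Proof.
move=> [_ _ fc] [_ _ gc] e0 fg; apply/funext => n; apply/funext => x.
have /(congr1 (@^~ n))// : c ^~ x = c' ^~ x.
by apply: (vexpansion_unique (fc x) (gc x) e0) => z /fg ->.
Qed.

Lemma expansion_bounded_val f w c r M z : expansion f w c r M ->
  rnorm (z - w) < r -> bounded_op (f z).
Proof.
move=> [M0 lc fc] zr; apply/bounded_opP; split.
  apply: (lim_linear (T := fun n x => series (fun n => (z - w) ^+ n *: c n x) n)).
    move=> n a x y; rewrite /series/= scaler_sumr -big_split/=.
    by apply: eq_bigr => i _; rewrite lc scalerDr !scalerA mulrC.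
  by move=> x; have [_ _] := fc x; apply.
have q01 := ratio_lt1 zr; have q1 : 0 < 1 - rnorm (z - w) / r by lra.
exists (M / (1 - rnorm (z - w) / r)); first by rewrite divr_ge0// ltW.
move=> x; have [_ cM _] := fc x.
by rewrite (vexpansion_psum (fc x) zr) (le_trans (psum_le cM zr))// mulrAC.
Qed.

Lemma expansion_taylor f w c r M : expansion f w c r M -> taylor_coefs f w c.
Proof.
move=> fc; split; first by move=> n; exact: expansion_bounded_op fc.
have [M0 lc fx] := fc; apply/near_rnormP; exists r; first exact: expansion_r_gt0 fc.
move=> z zr e e0; have q01 := ratio_lt1 zr.
set q := rnorm (z - w) / r in q01.
have eE : e = (complex.Re e)%:C by rewrite RRe_real// gtr0_real.
move: e0; rewrite eE ltcR => e0.
have : (fun n => M / (1 - q) * q ^+ n) @ \oo --> (0 : R).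
  by apply: (@cvg_geometric R _ q); have /andP[? ?] := q01; rewrite ger0_norm.
move=> /cvgrPdist_lt/(_ _ e0); apply: filterS => n; rewrite sub0r normrN.
move=> /ltW/(le_trans (ler_norm _)) ne x.
rewrite fct_sumE !rnormE -rmorphM/= lecR rdistC.
have [r0 cM fE] := fx x.
have := rnorm_geometric_tail n (mulr_ge0 M0 (rnorm_ge0 x)) q01
  (fun n => pseries_term_le (z - w) n r0 cM) (fE z zr).
move=> /le_trans; apply; rewrite (le_trans _ (ler_wpM2r (rnorm_ge0 x) ne))//.
by rewrite le_eqVlt; apply/orP; left; apply/eqP; ring.
Qed.

(** Convergence in operator norm at one point w + r bounds the terms of large
    index there; the finitely many others are bounded operators. *)
Lemma taylor_expansion f w c : taylor_coefs f w c ->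
  exists r M, expansion f w c r M.
Proof.
move=> [bc /near_rnormP[d d0 fc]]; pose r := d / 2.
have r0 : 0 < r by rewrite divr_gt0.
have rw : rnorm (w + r%:C - w) < d.
  by rewrite addrAC subrr add0r rnorm_real ger0_norm ?ltW// /r; lra.
have /(fc _ rw) [N _ NP] : 0 < 1 :> R[i] by [].
rewrite addrAC subrr add0r in NP.
have rE n x : rnorm (r%:C ^+ n *: c n x) = rnorm (c n x) * r ^+ n.
  by rewrite rnormZ rnormX rnorm_real ger0_norm ?(ltW r0)// mulrC.
have large n x : (N <= n)%N -> rnorm (c n x) * r ^+ n <= 2 * rnorm x.
  move=> Nn; have := NP n Nn x; have := NP n.+1 (leqW Nn) x.
  rewrite !fct_sumE !mul1r !rnormE !lecR.
  set G := f _ x => h1 h2; rewrite -rE.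
  have -> : r%:C ^+ n *: c n x = (\sum_(0 <= k < n.+1) (r%:C ^+ k *: c k) x - G)
      - (\sum_(0 <= k < n) (r%:C ^+ k *: c k) x - G).
    by rewrite big_nat_recr//= opprB addrA subrK addrAC subrr add0r.
  by rewrite (le_trans (ler_rnormB _ _))// (_ : 2 = 1 + 1)// mulrDl !mul1r lerD.
have [D D0 DP] : exists2 D : R, 0 <= D & forall n x, (n < N)%N ->
    rnorm (c n x) * r ^+ n <= D * rnorm x.
  elim: N {NP large} => [|N [D D0 DP]]; first by exists 0.
  have /bounded_opP[_ [M M0 cM]] := bc N.
  exists (D + M * r ^+ N); first by rewrite addr_ge0// mulr_ge0// exprn_ge0// ltW.
  move=> n x; rewrite ltnS leq_eqVlt => /predU1P[->|nN]; rewrite mulrDl.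
    rewrite -[leLHS]add0r lerD ?mulr_ge0 ?rnorm_ge0// mulrAC.
    by rewrite ler_wpM2r// exprn_ge0// ltW.
  rewrite -[leLHS]addr0 lerD ?DP// mulr_ge0 ?rnorm_ge0// mulr_ge0// exprn_ge0//.
  exact: ltW.
exists r, (D + 2); split; first by rewrite addr_ge0.
  by move=> n; case: (bc n).
move=> x; split=> //.
  move=> n; rewrite mulrDl; have [Nn|nN] := leqP N n.
    by rewrite -[leLHS]add0r lerD ?large// mulr_ge0 ?rnorm_ge0.
  by rewrite -[leLHS]addr0 lerD ?DP// mulr_ge0 ?rnorm_ge0.
move=> z zr; have zd : rnorm (z - w) < d by rewrite (lt_trans zr)// /r; lra.
exact: (op_sum_cvg (fc z zd)). 
Qed.

Lemma taylor_unique f g w c c' : taylor_coefs f w c -> taylor_coefs g w c' ->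
  (\forall z \near (w : C), f z = g z) -> c = c'.
Proof.
move=> /taylor_expansion[r [M fc]] /taylor_expansion[r' [M' gc]].
by move=> /near_rnormP[e e0]; exact: expansion_unique fc gc e0.
Qed.

Lemma taylor_ext f g w c : taylor_coefs f w c ->
  (\forall z \near (w : C), f z = g z) -> taylor_coefs g w c.
Proof.
move=> [bc fc] fg; split=> //; near=> z.
have <- : f z = g z by near: z.
by near: z.
Unshelve. all: by end_near. Qed.

Lemma taylor_bounded f w c : taylor_coefs f w c ->
  \forall z \near (w : C), bounded_op (f z).
Proof.
move=> /taylor_expansion[r [M fc]]; apply/near_rnormP.
by exists r => [|z zr]; [exact: expansion_r_gt0 fc|exact: expansion_bounded_val fc zr].
Qed.

Lemma taylor_val0 f w c : taylor_coefs f w c -> f w = c 0%N.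
Proof.
move=> /taylor_expansion[r [M [_ _ fc]]]; apply/funext => x.
exact: (vexpansion_center (fc x)).
Qed.

Lemma taylor_const (T : B -> B) w : bounded_op T ->
  taylor_coefs (fun=> T) w (fun n => if n is 0%N then T else 0).
Proof.
move=> bT; have /bounded_opP[lT [M M0 TM]] := bT.
apply: (@expansion_taylor _ _ _ 1 M); split=> //.
  by case=> // n; have [] := @bounded_op0 R B.
move=> x; split=> // [[|n]|z _]; first by rewrite mulr1.
  by rewrite rnorm0 mul0r mulr_ge0 ?rnorm_ge0.
apply: cvg_near_cst; exists 1%N => // n /= n1.
rewrite /series/= big_ltn// expr0 scale1r.
by rewrite big_nat_cond big1 ?addr0// => -[|i] // _; rewrite scaler0.
Qed.

Lemma taylor_var w :
  taylor_coefs (fun z => (z - w) *: id) w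
    (fun n => if n is 1%N then id else 0 : B -> B).
Proof.
apply: (@expansion_taylor _ _ _ 1 1); split=> //.
  by case=> [|[|n]] //; have [] := @bounded_op0 R B.
move=> x; split=> // [[|[|n]]|z _]; rewrite ?mulr1 ?mul1r ?rnorm0 ?mul0r ?rnorm_ge0//.
apply: cvg_near_cst; exists 2%N => // n /= n1.
rewrite /series/= big_ltn ?(ltnW n1)// big_ltn// scaler0 add0r expr1.
by rewrite big_nat_cond big1 ?addr0// => -[|[|i]] // _; rewrite scaler0.
Qed.

End Expansion.

Section Calculus.
Context {R : realType} {B : completeNormedModType R[i]}.
Implicit Types (f g : R[i] -> B -> B) (c : nat -> B -> B) (w z u : R[i]) (r M : R).
Local Notation C := (Num.NumField.sort R[i]).

Lemma taylor_determined f g w c : taylor_coefs f w c -> taylor_coefs g w c ->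
  \forall z \near (w : C), f z = g z.
Proof.
move=> [_ fc] [_ gc]; near=> z; apply/funext => x.
have fz : op_sum 0 (fun n => (z - w) ^+ n *: c n) (f z) by near: z.
have gz : op_sum 0 (fun n => (z - w) ^+ n *: c n) (g z) by near: z.
exact: (cvg_unique _ (op_sum_cvg (x := x) fz) (op_sum_cvg (x := x) gz)).
Unshelve. all: by end_near. Qed.

Lemma taylor_add f g w c d : taylor_coefs f w c -> taylor_coefs g w d ->
  taylor_coefs (fun z => f z + g z) w (fun n => c n + d n).
Proof.
move=> [bc fc] [bd gd]; split; first by move=> n; apply: bounded_opD.
near=> z => e e0; have e2 : 0 < e / 2 by rewrite divr_gt0.
have fz : op_sum 0 (fun n => (z - w) ^+ n *: c n) (f z) by near: z.
have gz : op_sum 0 (fun n => (z - w) ^+ n *: d n) (g z) by near: z.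
have := gz _ e2; have := fz _ e2; apply: filterS2 => n fn gn x.
have -> : (\sum_(0 <= k < n) (z - w) ^+ k *: (c k + d k)) x - (f z + g z) x =
   ((\sum_(0 <= k < n) (z - w) ^+ k *: c k) x - f z x) +
   ((\sum_(0 <= k < n) (z - w) ^+ k *: d k) x - g z x).
  rewrite !fct_sumE addrACA -opprD; congr (_ - _).
  by rewrite -big_split/=; apply: eq_bigr => i _; rewrite -scalerDr.
by rewrite (le_trans (ler_normD _ _))// (splitr e) mulrDl lerD.
Unshelve. all: by end_near. Qed.

(** Taylor coefficients of a pointwise composition of operator functions. *)
Definition cauchy_prod (c d : nat -> B -> B) : nat -> B -> B :=
  antidiag (fun i j => c i \o d j).

Lemma taylor_comp f g w c d : taylor_coefs f w c -> taylor_coefs g w d ->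
  taylor_coefs (fun z => f z \o g z) w (cauchy_prod c d).
Proof.
move=> /taylor_expansion[r1 [M1 fc]] /taylor_expansion[r2 [M2 gd]].
have [r10 r20] := (expansion_r_gt0 fc, expansion_r_gt0 gd).
have [M10 lc fx] := fc; have [M20 ld gx] := gd.
have cM := expansion_coef_le fc; have dM := expansion_coef_le gd.
pose r := Num.min r1 r2 / 2.
have r0 : 0 < r by rewrite divr_gt0// lt_min r10.
have [rr1 rr2] : r <= r1 / 2 /\ r <= r2 / 2.
  by split; rewrite ler_pM2r// ge_min lexx ?orbT.
have half : 0 <= (1 / 2 : R) < 1 by lra.
(* both series are dominated by the geometric series of ratio 1/2 *)
have term c' r' M' (c'M : forall n x, rnorm (c' n x) * r' ^+ n <= M' * rnorm x)
    t n (x : B) : 0 <= t -> 0 < r' -> 0 <= M' -> t <= r' / 2 ->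
    rnorm (c' n x) * t ^+ n <= M' * (1 / 2) ^+ n * rnorm x.
  move=> t0 r'0 M'0 tr'; rewrite mulrAC.
  apply: le_trans (ler_wpM2r _ (c'M n x)); last by rewrite exprn_ge0.
  rewrite -mulrA ler_wpM2l ?rnorm_ge0// -exprMn lerXn2r ?nnegrE//.
    by rewrite mulr_ge0// ltW.
  by rewrite mul1r.
have term2 t i j (x : B) : 0 <= t <= r ->
    rnorm (c i (d j x)) * t ^+ (i + j) <= M1 * M2 * rnorm x * (1/2) ^+ i * (1/2) ^+ j.
  move=> /andP[t0 tr]; rewrite exprD mulrA.
  have h1 := term _ _ _ cM t i (d j x) t0 r10 M10 (le_trans tr rr1).
  have h2 := term _ _ _ dM t j x t0 r20 M20 (le_trans tr rr2).
  apply: le_trans (ler_wpM2r (exprn_ge0 j t0) h1) _.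
  rewrite -[leLHS]mulrA; apply: (le_trans (ler_wpM2l _ h2)).
    by rewrite mulr_ge0// exprn_ge0//; lra.
  by rewrite le_eqVlt; apply/orP; left; apply/eqP; ring.
pose D (x : B) := M1 * M2 * rnorm x / (1 - 1 / 2) / (1 - 1 / 2).
have D0 (x : B) : 0 <= M1 * M2 * rnorm x by rewrite !mulr_ge0 ?rnorm_ge0.
have bD x n := series_antidiag_geometric n (D0 x) half half.
have lin_conv n : linear (cauchy_prod c d n).
  move=> a x y; rewrite /cauchy_prod /antidiag !fct_sumE scaler_sumr -big_split/=.
  by apply: eq_bigr => i _; rewrite ld lc.
apply: (@expansion_taylor _ _ _ _ _ r (4 * (M1 * M2))); split=> //.
  by rewrite !mulr_ge0.
move=> x; split=> // [n|z zr].
  apply: le_trans (_ : D x <= _); last by rewrite le_eqVlt; apply/orP; left; apply/eqP; rewrite /D; field.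
  apply: le_trans (bD x n.+1); rewrite seriesSr -[leLHS]add0r lerD//.
    apply: sumr_ge0 => m _; apply: sumr_ge0 => i _.
    by rewrite !mulr_ge0 ?exprn_ge0 ?rnorm_ge0//; lra.
  rewrite /cauchy_prod /antidiag fct_sumE.
  apply: le_trans (ler_wpM2r (exprn_ge0 _ (ltW r0)) (ler_rnorm_sum _ _ _)) _.
  rewrite mulr_suml; apply: ler_sum_nat => i /andP[_ ]; rewrite ltnS => iM.
  by have := term2 r i (n - i)%N x; rewrite subnKC//; apply; rewrite lexx ltW.
have zr1 : rnorm (z - w) < r1 by lra.
have zr2 : rnorm (z - w) < r2 by lra.
have [_ _ /(_ _ zr1) fz] := fx (g z x); have [_ _ /(_ _ zr2) gz] := gx x.
have := @cvg_double_series _ B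
  (fun i j => (z - w) ^+ i *: c i ((z - w) ^+ j *: d j x)) _ _
  (fun i => (z - w) ^+ i *: c i (g z x)) _ (bD x).
have -> : antidiag (fun i j => (z - w) ^+ i *: c i ((z - w) ^+ j *: d j x)) =
    (fun m => (z - w) ^+ m *: cauchy_prod c d m x).
  apply/funext => m; rewrite /cauchy_prod /antidiag fct_sumE scaler_sumr.
  apply: eq_big_nat => i /andP[_]; rewrite ltnS => im.
  by rewrite linZ// scalerA -exprD subnKC.
move=> H; have [||acvg slim] := H.
- move=> i j; rewrite linZ// scalerA -exprD rnormZ rnormX mulrC.
  by apply: term2; rewrite rnorm_ge0 ltW.
- move=> i; have bci : bounded_op ((z - w) ^+ i *: c i).
    by apply: bounded_opZ; apply: expansion_bounded_op fc.
  have := bounded_cvg bci gz.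
  by rewrite (lin_series _ (bounded_lin bci)).
by rewrite [X in _ --> X](cvg_unique _ fz slim).
Qed.

Lemma cauchy_prod_constl (T : B -> B) c : cauchy_prod (fun n => if n is 0%N then T else 0) c =
  fun n => T \o c n.
Proof.
apply/funext => n; rewrite /cauchy_prod /antidiag big_nat_recl//= subn0 big1 ?addr0//.
Qed.

Lemma cauchy_prod_constr (T : B -> B) c : (forall n, linear (c n)) ->
  cauchy_prod c (fun n => if n is 0%N then T else 0) = fun n => c n \o T.
Proof.
move=> lc; apply/funext => n; apply/funext => x.
rewrite /cauchy_prod /antidiag fct_sumE big_nat_recr//= subnn big_nat big1 ?add0r//.
move=> i /= ltin; have : (0 < n - i)%N by rewrite subn_gt0.
by case: (n - i)%N => // k _; rewrite lin0.
Qed.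

Lemma cauchy_prod_varl c : cauchy_prod (fun n => if n is 1%N then id else 0) c =
  fun n => if n is k.+1 then c k else 0.
Proof.
apply/funext => n; apply/funext => x; rewrite /cauchy_prod /antidiag fct_sumE.
case: n => [|n]; first by rewrite big_nat1.
by rewrite big_nat_recl//= big_nat_recl//= subSS !subn0 big1 ?addr0// add0r.
Qed.

Lemma taylor_mulvar f w c : taylor_coefs f w c ->
  taylor_coefs (fun z => (z - w) *: f z) w (fun n => if n is k.+1 then c k else 0).
Proof.
move=> fc; rewrite -(cauchy_prod_varl c).
exact: (taylor_comp (taylor_var w) fc).
Qed.

Lemma taylor_compl (T : B -> B) f w c : bounded_op T -> taylor_coefs f w c ->
  taylor_coefs (fun z => T \o f z) w (fun n => T \o c n).
Proof.
by move=> bT fc; rewrite -cauchy_prod_constl; exact: taylor_comp (taylor_const w bT) fc.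
Qed.

Lemma taylor_compr (T : B -> B) f w c : bounded_op T -> taylor_coefs f w c ->
  taylor_coefs (fun z => f z \o T) w (fun n => c n \o T).
Proof.
move=> bT fc; rewrite -cauchy_prod_constr; last by move=> n; have [/(_ n)[]] := fc.
exact: taylor_comp fc (taylor_const w bT).
Qed.

Lemma taylor_opp f w c : taylor_coefs f w c ->
  taylor_coefs (fun z => - f z) w (fun n => - c n).
Proof. exact: (taylor_compl (bounded_opN bounded_op_id)). Qed.

Lemma taylor_sub f g w c d : taylor_coefs f w c -> taylor_coefs g w d ->
  taylor_coefs (fun z => f z - g z) w (fun n => c n - d n).
Proof. by move=> fc /taylor_opp; exact: taylor_add. Qed.

End Calculus.

(** * Inversion of power series *)

Section Inversion.
Context {R : realType} {B : completeNormedModType R[i]}.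
Implicit Types (f g : R[i] -> B -> B) (c : nat -> B -> B) (w z u : R[i]) (r M : R).
Local Notation C := (Num.NumField.sort R[i]).

Section Recursion.
Variables (P A1 : nat -> B -> B) (m : nat) (f : R[i] -> B -> B) (w : R[i]).
Let G := Gcoef P A1 m.
Let H := Hcoef P A1 m.
Hypothesis fG : taylor_coefs f w G.
Hypothesis f_inv : op_invertible (f w).

Let G0 : op_inverse (G 0%N) (H 0%N).
Proof. by rewrite /H Hcoef0 -/(G 0%N) -(taylor_val0 fG); exact: op_inv_inverse. Qed.

Let bG n : bounded_op (G n). Proof. by have [+ _] := fG; apply. Qed.

Let Hrec j : (0 < j)%N ->
  H j = - (H 0%N \o \sum_(1 <= k < j.+1) (G k \o H (j - k)%N)).
Proof. by move=> j0; rewrite /H HcoefE// Hcoef0. Qed.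

Let bH n : bounded_op (H n).
Proof.
elim/ltn_ind: n => -[_|n IHn]; first by have [] := G0.
rewrite Hrec//; apply: bounded_opN; apply: bounded_op_comp; first exact: IHn.
rewrite big_nat; apply: big_ind => [|S T|k /andP[k1 kn]].
- exact: bounded_op0.
- exact: bounded_opD.
- by apply: bounded_op_comp (bG k) _; apply: IHn; lia.
Qed.

(** The recursion for H is the identity G * H = id of formal power series. *)
Let conv_GH : cauchy_prod G H = fun n => if n is 0%N then id else 0.
Proof.
have [_ GH _] := G0.
apply/funext => -[|n]; rewrite /cauchy_prod /antidiag; first by rewrite big_nat1.
rewrite big_nat_recl// subn0 Hrec//; apply/funext => x.
have -> : (G 0 \o (- (H 0%N \o \sum_(1 <= k < n.+2) (G k \o H (n.+1 - k)%N)))) =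
    - \sum_(1 <= k < n.+2) (G k \o H (n.+1 - k)%N).
  apply/funext => y; rewrite /= (linN (bounded_lin (bG 0%N))).
  by congr (- _); exact: (congr1 (@^~ _) GH).
by rewrite big_add1/= addNr.
Qed.

(** The recursion [H j = - H 0 (G 1 H (j-1) + ... + G j H 0)] defines a formal
    right inverse whose coefficients grow at most geometrically; it is also a
    left inverse because [f z], being close to [f w], stays injective. *)
Lemma taylor_inv_Hcoef : taylor_coefs (fun z => op_inv (f z)) w H /\
  \forall z \near (w : C), op_invertible (f z).
Proof.
have /taylor_expansion[r [M fx]] := fG.
have r0 := expansion_r_gt0 fx; have [M0 _ _] := fx.
have [bT GT TG] := G0; have /bounded_opP[lT [tau tau0 T_le]] := bT.
(* the ratio a is small enough for the induction bounding H, which needs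
   tau M a / (1 - a) <= 1, and for the injectivity of f z *)
pose a := (4 * (1 + tau * M))^-1; pose s := a * r.
have tM0 : 0 <= tau * M by rewrite mulr_ge0.
have a0 : 0 < a by rewrite invr_gt0; lra.
have aE : a * (4 * (1 + tau * M)) = 1 by rewrite mulVf// gt_eqF//; lra.
have a4 : a <= 1 / 4 by nra.
have s0 : 0 < s by rewrite mulr_gt0.
have H_le n x : rnorm (H n x) * s ^+ n <= tau * rnorm x.
  elim/ltn_ind: n => -[_|n IHn]; first by rewrite expr0 mulr1.
  rewrite Hrec// opprfctE rnormN/=.
  apply: le_trans (ler_wpM2r (exprn_ge0 _ (ltW s0)) (T_le _)) _.
  rewrite -mulrA ler_wpM2l// fct_sumE.
  apply: le_trans (ler_wpM2r (exprn_ge0 _ (ltW s0)) (ler_rnorm_sum _ _ _)) _.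
  rewrite mulr_suml.
  have term k : (1 <= k < n.+2)%N -> rnorm (G k (H (n.+1 - k)%N x)) * s ^+ n.+1 <=
      (M * (tau * rnorm x)) * a ^+ k.
    move=> /andP[k1 kn]; have kn' : (n.+1 - k < n.+1)%N by lia.
    have h1 := expansion_coef_le fx k (H (n.+1 - k)%N x).
    have h2 := IHn _ kn'.
    have -> : s ^+ n.+1 = a ^+ k * r ^+ k * s ^+ (n.+1 - k).
      by rewrite -exprMn -exprD subnKC.
    move: (n.+1 - k)%N h1 h2 => j h1 h2.
    rewrite [leLHS](_ : _ = (rnorm (G k (H j x)) * r ^+ k) * (a ^+ k * s ^+ j)); last by ring.
    apply: le_trans (ler_wpM2r _ h1) _.
      by rewrite mulr_ge0// exprn_ge0// ltW.
    rewrite [leLHS](_ : _ = (M * (rnorm (H j x) * s ^+ j)) * a ^+ k); last by ring.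
    by rewrite ler_wpM2r ?exprn_ge0 ?(ltW a0)// ler_wpM2l.
  rewrite big_nat; apply: le_trans (ler_sum _ term) _; rewrite -big_nat.
  rewrite -mulr_sumr big_add1/=.
  have geo : \sum_(0 <= i < n.+1) a ^+ i.+1 <= a / (1 - a).
    have a01 : 0 <= a < 1 by lra.
    apply: le_trans (series_geometric_le n.+1 (ltW a0) a01).
    by rewrite le_eqVlt; apply/orP; left; apply/eqP; apply: eq_bigr => i _; rewrite exprS.
  have a_le : a / (1 - a) <= 2 * a by rewrite ler_pdivrMr; nra.
  apply: le_trans (ler_wpM2l _ (le_trans geo a_le)) _.
    by rewrite !mulr_ge0 ?rnorm_ge0.
  have := rnorm_ge0 x; set N := rnorm x => N0.
  rewrite [leLHS](_ : _ = (tau * M * a * 2) * N); last by ring.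
  by apply: ler_piMl => //; nra.
pose h z x := psum (H ^~ x) (z - w).
have hH : taylor_coefs h w H.
  apply: (@expansion_taylor _ _ _ _ _ s tau); split=> //.
    by move=> n; exact: bounded_lin.
  by move=> x; apply: psum_vexpansion.
have fh := taylor_comp fG hH; rewrite conv_GH in fh.
have inj : \forall z \near (w : C), forall x, f z x = 0 -> x = 0.
  apply/near_rnormP; exists s => // z zs x fzx.
  have zr : rnorm (z - w) < r by apply: lt_le_trans zs _; rewrite /s; nra.
  have [_ _ /(_ x)/vexpansion_close/(_ zr)] := fx; rewrite fzx sub0r rnormN.
  set q := rnorm (z - w) / r; have q01 : 0 <= q < 1 := ratio_lt1 zr.
  have qa : q <= a by rewrite ler_pdivrMr// ltW.
  have xE : x = H 0%N (f w x) by rewrite (taylor_val0 fG); exact/esym/(congr1 (@^~ x) TG).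
  move=> fwx; apply: rnorm0_eq0.
  have x_le : rnorm x <= tau * rnorm (f w x) by rewrite {1}xE.
  have N0 := rnorm_ge0 x; set N := rnorm x in N0 x_le fwx *.
  have : q / (1 - q) <= 2 * a by rewrite ler_pdivrMr; nra.
  move=> q2; have : rnorm (f w x) <= M * N * (2 * a).
    by apply: le_trans fwx _; rewrite -mulrA ler_wpM2l// mulr_ge0.
  move=> fwN; have : N <= tau * (M * N * (2 * a)).
    by apply: le_trans x_le _; rewrite ler_wpM2l.
  rewrite [leRHS](_ : _ = (tau * M * a * 2) * N); last by ring.
  move=> NN; have tMa : tau * M * a * 2 <= 1 / 2 by nra.
  by apply/eqP; rewrite eq_le N0 andbT; nra.
have inv : \forall z \near (w : C), op_inverse (f z) (h z).
  have fhid := taylor_determined fh (taylor_const w bounded_op_id).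
  have bf := taylor_bounded fG; have bh := taylor_bounded hH.
  near=> z.
  have fhz : f z \o h z = id by near: z.
  have bfz : bounded_op (f z) by near: z.
  have bhz : bounded_op (h z) by near: z.
  have fz_inj : forall x, f z x = 0 -> x = 0 by near: z.
  split=> //; apply/funext => x; apply/subr0_eq/fz_inj.
  rewrite linB; last exact: bounded_lin.
  by have /= -> := congr1 (@^~ (f z x)) fhz; rewrite subrr.
split; last by move: inv; apply: filterS => z ?; exists (h z).
by apply: taylor_ext hH _; move: inv; apply: filterS => z /op_inv_unique ->.
Unshelve. all: by end_near. Qed.

End Recursion.

Lemma taylor_inv f w c : taylor_coefs f w c -> op_invertible (f w) ->
  (exists h, taylor_coefs (fun z => op_inv (f z)) w h) /\
  \forall z \near (w : C), op_invertible (f z).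
Proof.
(* with P_0 = 0, P_1 = id and d = 0, the coefficients G_k are the c_k *)
pose P n : B -> B := if n is 0%N then 0 else id.
have GE : Gcoef P c 0 = c.
  apply/funext => k; rewrite /Gcoef big_nat1 addn0 /= subr0.
  by apply/funext.
rewrite -GE => fc fw; have [h near_inv] := taylor_inv_Hcoef fc fw.
by split=> //; exists (Hcoef P c 0).
Qed.

End Inversion.

(** * Operator functions analytic on a closed disc *)
Section OperatorDisc.
Context {R : realType} {B : completeNormedModType R[i]}.
Implicit Types (f g : R[i] -> B -> B) (c : nat -> B -> B) (w z u : R[i]) (r M : R).
Local Notation C := (Num.NumField.sort R[i]).

Lemma psum_linear (T : nat -> B -> B) u : (forall n, linear (T n)) ->
  (forall x, cvgn (series (fun n => u ^+ n *: T n x))) ->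
  linear (fun x => psum (T ^~ x) u).
Proof.
move=> lT cT.
apply: (lim_linear (T := fun n x => series (fun n => u ^+ n *: T n x) n)) => //.
move=> n a x y; rewrite /series/= scaler_sumr -big_split/=.
by apply: eq_bigr => i _; rewrite lT scalerDr !scalerA mulrC.
Qed.

Lemma expansion_recenter f w c r M u r' : expansion f w c r M ->
  0 < r' -> rnorm u + r' < r ->
  expansion f (w + u) (fun j x => psum (dcoef (c ^~ x) j) u) r'
    (M / (1 - (rnorm u + r') / r)).
Proof.
move=> fc r'0 ur'; have [M0 lc fx] := fc; have r0 := expansion_r_gt0 fc.
have u0 := rnorm_ge0 u.
split.
- rewrite divr_ge0// subr_ge0 ler_pdivrMr// mul1r; lra.
- move=> j; apply: (psum_linear (T := fun n x => dcoef (c ^~ x) j n)).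
    by move=> n a x y; rewrite /dcoef lc scalerDr !scalerA mulrC.
  move=> x; pose s := (r - rnorm u) / 2; have s0 : 0 < s by rewrite /s; lra.
  have r1 : 0 < rnorm u + s by lra.
  have cM n : rnorm (c n x) * (rnorm u + s + s) ^+ n <= M * rnorm x.
    have -> : rnorm u + s + s = r by rewrite /s; field.
    exact: (expansion_coef_le fc).
  by apply: (cvg_pseries (fun n => dcoef_le j n r1 s0 cM)); lra.
- by move=> x; rewrite mulrAC; apply: vexpansion_recenter.
Qed.

(** Recentring gives expansions of radius r/2 at all points near a given one.
    Taking M = 1/d leaves a single parameter for the covering argument. *)
Lemma uniform_expansion f rho : 0 < rho ->
  (forall w, rnorm w <= rho -> exists c, taylor_coefs f w c) ->
  exists2 d, 0 < d <= rho &
    forall w, rnorm w <= rho -> exists c, expansion f w c d d^-1.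
Proof.
move=> rho0 fan; pose Q d w := d <= rho /\ exists c, expansion f w c d d^-1.
have [w wrho|d d0 dQ] := @disc_covering R rho Q; last first.
  exists d; last by move=> w /dQ[].
  by rewrite d0; have [|//] := dQ 0; rewrite rnorm0 ltW.
have [c /taylor_expansion[r [M fc]]] := fan w wrho.
have r0 := expansion_r_gt0 fc; have [M0 _ _] := fc.
have M1 : 0 < 4 * M + 1 by lra.
exists (Num.min rho (Num.min (r / 4) (4 * M + 1)^-1)).
  by rewrite !lt_min rho0 divr_gt0//= invr_gt0.
move=> d w'; rewrite !lt_min => /andP[d0 /and3P[drho dr dM]] /and3P[_ w'r _].
split; first exact: ltW.
have [r20 ur] : 0 < r / 2 /\ rnorm (w' - w) + r / 2 < r by lra.
have := expansion_recenter fc r20 ur; rewrite subrKC => fc'.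
eexists; apply: expansion_sub fc'; first by lra.
set q := _ / r; have q34 : q <= 3 / 4 by rewrite ler_pdivrMr//; lra.
apply: (@le_trans _ _ (4 * M)); first by rewrite ler_pdivrMr; nra.
have : 4 * M + 1 < d^-1 by rewrite -[X in X < _]invrK ltf_pV2 ?posrE ?invr_gt0.
lra.
Qed.

(** The uniform radius of expansion lets the series at 0 extend strictly beyond
    the closed disc. *)
Lemma disc_coef_bound f c rho : 0 < rho ->
  (forall w, rnorm w <= rho -> exists c, taylor_coefs f w c) ->
  taylor_coefs f 0 c ->
  exists r M, [/\ rho < r, 0 <= M &
    forall n x, rnorm (c n x) * r ^+ n <= M * rnorm x].
Proof.
move=> rho0 fan f0; have [d /andP[d0 drho] fd] := uniform_expansion rho0 fan.
have [c' fc'] : exists c', expansion f 0 c' d d^-1.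
  by apply: fd; rewrite rnorm0 ltW.
have cc' : c' = c.
  by apply: (taylor_unique (expansion_taylor fc') f0); near=> z.
rewrite cc' in fc'; have [_ _ fx] := fc'.
exists (rho + d / 2), (4 * d^-1); split; first by lra.
  by rewrite mulr_ge0// invr_ge0 ltW.
move=> n x; have [||_ + _] := @vexpansion_extend _ _ (f ^~ x) (c ^~ x) d
  (d^-1 * rnorm x) rho _ (fx x) drho (rho + d / 2); last first.
- by rewrite -mulrA; apply.
- by rewrite lexx andbT; lra.
- by move=> w /fd[c'' [_ _ /(_ x) fw]]; exists (c'' ^~ x).
Unshelve. all: by end_near. Qed.

End OperatorDisc.

(** * Abel summation of a continued power series *)

Section Abel.
Context {R : realType} {V : completeNormedModType R[i]}.

(** Abel's theorem along the radius, by summation by parts: with T_n the distance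
    of the partial sums to L, the sum of s^n a_n minus L is the limit of
    s^m T_m + (1 - s) (T_1 + s T_2 + ... + s^(m-1) T_m). *)
Lemma abel_sum (a : nat -> V) (L : V) (e : R) : series a @ \oo --> L -> 0 < e ->
  exists2 d : R, 0 < d & forall (s : R) G, 0 <= s < 1 -> 1 - d < s ->
    series (fun n => s%:C ^+ n *: a n) @ \oo --> G -> rnorm (G - L) <= e.
Proof.
move=> aL e0; pose T n := series a n - L.
have TL : T @ \oo --> (0 : V).
  by rewrite -(subrr L); apply: cvgB => //; exact: cvg_cst.
have e4 : 0 < e / 4 by rewrite divr_gt0.
have [N _ TN] : \forall n \near \oo, rnorm (0 - T n) < e / 4.
  by move/cvg_rnormP : TL; apply.
have {}TN n : (N <= n)%N -> rnorm (T n) <= e / 4.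
  by move=> /TN/= /ltW; rewrite sub0r rnormN.
have [D D0 TD] := cvg_rnorm_bounded TL.
have ND : 0 < N%:R * D + 1 by rewrite ltr_wpDl// mulr_ge0.
exists (e / 4 / (N%:R * D + 1)); first by rewrite divr_gt0.
move=> s G /andP[s0 s1] ds sG.
have parts m : series (fun n => s%:C ^+ n *: a n) m - L =
    s%:C ^+ m *: T m + \sum_(0 <= n < m) (s%:C ^+ n - s%:C ^+ n.+1) *: T n.+1.
  elim: m => [|m IHm]; first by rewrite /T /series/= !big_geq// scale1r addr0 sub0r.
  have E : T m.+1 = T m + a m by rewrite /T seriesSr addrAC.
  rewrite seriesSr addrAC IHm big_nat_recr//= E [RHS]addrCA -scalerDl subrKC.
  by rewrite [in RHS](scalerDr _ (T m)) addrA (addrC (_ *: T m)).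
have sT : (fun m => series (fun n => s%:C ^+ n *: a n) m - L) @ \oo --> G - L.
  by apply: cvgB => //; exact: cvg_cst.
apply: (rnorm_lim_le sT).
have sm : (fun m => D * s ^+ m) @ \oo --> (0 : R).
  by apply: (@cvg_geometric R D s); rewrite ger0_norm.
move/cvgrPdist_lt : sm => /(_ _ e4); apply: filterS => m.
rewrite sub0r normrN => /ltW/(le_trans (ler_norm _)) sm.
rewrite parts (le_trans (ler_rnormD _ _))// rnormZ rnormX rnorm_real ger0_norm//.
have sC n : rnorm (s%:C ^+ n - s%:C ^+ n.+1) = (1 - s) * s ^+ n.
  rewrite exprS -{1}[s%:C ^+ n]mul1r -mulrBl rnormM rnormX rnorm_real (ger0_norm s0).
  have -> : 1 - s%:C = (1 - s)%:C :> R[i] by rewrite rmorphB.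
  by rewrite rnorm_real ger0_norm// subr_ge0 ltW.
have h1 : s ^+ m * rnorm (T m) <= e / 4.
  by rewrite (le_trans _ sm)// mulrC ler_wpM2r// exprn_ge0.
have h2 : rnorm (\sum_(0 <= n < m) (s%:C ^+ n - s%:C ^+ n.+1) *: T n.+1) <=
    (1 - s) * (N%:R * D) + e / 4.
  apply: le_trans (ler_rnorm_sum _ _ _) _.
  apply: (@le_trans _ _ (\sum_(0 <= n < m) ((1 - s) * ((n < N)%N%:R * D) +
      (1 - s) * s ^+ n * (e / 4)))).
    apply: ler_sum => n _; rewrite rnormZ sC.
    have s1' : 0 <= 1 - s by lra.
    have [nN|Nn] := ltnP n N.
      rewrite mul1r -[leLHS]addr0 lerD//.
        rewrite -mulrA ler_wpM2l// (le_trans _ (TD n.+1))// ler_piMl ?rnorm_ge0//.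
        by rewrite exprn_ile1// ltW.
      by rewrite !mulr_ge0// ?exprn_ge0 ?(ltW e0).
    rewrite mul0r mulr0 add0r ler_wpM2l ?mulr_ge0 ?exprn_ge0//.
    by apply: TN; exact: leqW.
  rewrite big_split/= -mulr_sumr -!mulr_suml lerD//.
    rewrite ler_wpM2l ?subr_ge0 ?(ltW s1)// ler_wpM2r// -natr_sum ler_nat.
    rewrite (@leq_trans (\sum_(0 <= n < N + m) (n < N)%N))//.
      by rewrite [leqRHS](big_cat_nat _ (leq_addl N m))//= leq_addr.
    rewrite (big_cat_nat _ (leq_addr m N))//= [X in (_ + X)%N]big_nat_cond.
    rewrite [X in (_ + X)%N]big1 ?addn0; last by move=> i /andP[/andP[Ni _] _]; rewrite ltnNge Ni.
    by rewrite (leq_trans (leq_sum _ (fun i _ => leq_b1 _)))// sum_nat_const_nat subn0 muln1.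
  rewrite -mulr_sumr -[leRHS]mul1r ler_wpM2r ?(ltW e4)//.
  have := series_geometric_le m ler01 (_ : 0 <= s < 1); rewrite s0 s1 => /(_ isT).
  rewrite ler_pdivlMr ?subr_gt0// mulrC; apply: le_trans.
  by rewrite ler_wpM2l ?subr_ge0 ?(ltW s1)// ler_sum// => n _; rewrite /geometric/= mul1r.
have h3 : (1 - s) * (N%:R * D) <= e / 4.
  have : 1 - s < e / 4 / (N%:R * D + 1) by lra.
  rewrite ltr_pdivlMr// => /ltW; apply: le_trans.
  by rewrite ler_wpM2l ?subr_ge0 ?(ltW s1)// lerDl.
lra.
Qed.

End Abel.

Section Continuation.
Context {R : realType} {V : completeNormedModType R[i]}.

(** The expansion at 1 propagates along the segment from 1 to 0 by overlapping
    discs of a common radius, and Abel's theorem reaches the endpoint 0. *)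
Lemma abel_continuation (f : R[i] -> V) (v : nat -> V) (L : V) (d M : R) :
  (forall w, rnorm w <= 1 -> exists v', vexpansion f w v' d M) ->
  vexpansion f 1 v d M ->
  series (fun n => (-1) ^+ n *: v n) @ \oo --> L -> f 0 = L.
Proof.
move=> loc f1 vL; have [d0 vM _] := f1; have M0 := vexpansion_M_ge0 f1.
have [D D0 vD] : exists2 D : R, 0 <= D & forall n, rnorm (v n) <= D.
  have [D D0 DP] := cvg_rnorm_bounded (cvg_series_cvg_0 (cvgP _ vL)).
  exists D => // n; have := DP n.
  by rewrite rnormZ rnormX rnormN rnorm1 expr1n mul1r.
have vD1 n : rnorm (v n) * 1 ^+ n <= D by rewrite expr1n mulr1.
have g1 := psum_vexpansion 1 ltr01 vD1.
have seg s0 : 0 < s0 < 1 -> f (1 - s0%:C) = psum v (- s0%:C).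
  move=> /andP[s00 s01].
  pose m := Num.min d (1 - s0); have m0 : 0 < m by rewrite lt_min d0 subr_gt0.
  have [md ms] : m <= d /\ m <= 1 - s0 by rewrite /m; split; rewrite ge_min lexx ?orbT.
  (* K equal steps of length sg lead from 1 to 1 - s0; the discs of radius 2 sg
     around them stay inside those of the two expansions *)
  pose K := (Num.bound (4 * s0 / m)).+1.
  have KP : 4 * s0 / m < K%:R.
    apply: (@lt_le_trans _ _ (Num.bound (4 * s0 / m))%:R); last by rewrite ler_nat.
    by apply: archi_boundP; rewrite divr_ge0 ?(ltW m0)// mulr_ge0// ltW.
  clearbody K.
  pose sg := s0 / K%:R; have K0 : 0 < K%:R :> R.
    by apply: le_lt_trans KP; rewrite divr_ge0 ?(ltW m0)// mulr_ge0// ltW.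
  have sg0 : 0 < sg by rewrite divr_gt0.
  have sgK : K%:R * sg = s0 by rewrite mulrC divfK// gt_eqF.
  have sgm : 4 * sg < m.
    by move: KP; rewrite ltr_pdivrMr// /sg mulrA ltr_pdivrMr// [ltRHS]mulrC.
  have rR (t : R) : 0 <= t -> rnorm (t%:C) = t by move=> t0; rewrite rnorm_real ger0_norm.
  have claim k : (k <= K)%N -> forall z, rnorm (z - (1 - (k%:R * sg)%:C)) < 2 * sg ->
      f z = psum v (z - 1).
    elim: k => [_|k IHk kK] z.
      rewrite mul0r subr0 => zs; rewrite (vexpansion_psum f1)//.
      by apply: lt_trans zs _; lra.
    have ks : k.+1%:R * sg <= s0 by rewrite -sgK ler_wpM2r ?(ltW sg0)// ler_nat.
    set p := 1 - _ => zp.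
    have k0 : 0 <= k.+1%:R * sg by rewrite mulr_ge0// ltW.
    have p1 : rnorm p <= 1.
      have -> : p = (1 - k.+1%:R * sg)%:C by rewrite rmorphB.
      by rewrite rR; lra.
    have [v' fp] := loc p p1.
    have uE : rnorm (- (k.+1%:R * sg)%:C : R[i]) = k.+1%:R * sg by rewrite rnormN rR.
    have [sg2 ur] : 0 < 2 * sg /\ rnorm (- (k.+1%:R * sg)%:C : R[i]) + 2 * sg < 1.
      by rewrite uE; lra.
    have gp := vexpansion_recenter g1 sg2 ur; rewrite -/p in gp.
    have sgd : 0 < 2 * sg <= d by lra.
    have fp2 := vexpansion_sub sgd (lexx M) fp.
    apply: (vexpansion_agree fp2 gp sg0) zp => y yp.
    apply: IHk; first exact: ltnW.
    have -> : y - (1 - (k%:R * sg)%:C) = (y - p) - sg%:C.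
      by rewrite /p -natr1 mulrDl mul1r rmorphD/=; ring.
    by rewrite (le_lt_trans (ler_rnormB _ _))// (rR sg) ?(ltW sg0)//; lra.
  have zK : rnorm (1 - s0%:C - (1 - (K%:R * sg)%:C)) < 2 * sg.
    by rewrite sgK (subrr (1 - s0%:C)) rnorm0 mulr_gt0.
  rewrite (claim K (leqnn K) _ zK).
  by rewrite addrAC subrr sub0r.
apply/subr0_eq/rnorm0_eq0/eqP; rewrite eq_le rnorm_ge0 andbT.
apply/ler_addgt0Pl => e e0; rewrite addr0.
have e2 : 0 < e / 2 by rewrite divr_gt0.
have [b b0 bP] := abel_sum vL e2.
have [v0 f0] : exists v0, vexpansion f 0 v0 d M by apply: loc; rewrite rnorm0.
(* a point of the segment at distance t from 0 *)
pose a := Num.min (1 / 2) (Num.min b (Num.min (d / 2) (d * e / (4 * M + 1) / 2))).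
have a0 : 0 < a.
  by rewrite /a !lt_min b0 !divr_gt0// ?mulr_gt0//; lra.
have [a1 ab ad aM] : [/\ a <= 1 / 2, a <= b, a <= d / 2 & a <= d * e / (4 * M + 1) / 2].
  by rewrite /a; split; rewrite !ge_min lexx ?orbT.
pose t := a / 2; have t0 : 0 < t by rewrite divr_gt0.
have tC : rnorm (t%:C : R[i]) = t by rewrite rnorm_real gtr0_norm.
have near1 : rnorm (f t%:C - L) <= e / 2.
  have st : 0 < 1 - t < 1 by rewrite /t; lra.
  have -> : t%:C = 1 - (1 - t)%:C :> R[i] by rewrite rmorphB subKr.
  rewrite seg//; apply: (bP (1 - t)); [rewrite /t; lra|rewrite /t; lra|].
  have -> : (fun n => (1 - t)%:C ^+ n *: ((-1) ^+ n *: v n)) =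
      (fun n => (- (1 - t)%:C) ^+ n *: v n).
    by apply/funext => n; rewrite scalerA -exprMn mulrN1.
  apply: (cvg_pseries vD1); rewrite rnormN rnorm_real ger0_norm; lra.
have near0 : rnorm (f 0 - f t%:C) <= e / 2.
  have td : rnorm (t%:C - 0 : R[i]) < d by rewrite subr0 tC /t; lra.
  have := vexpansion_close f0 td; rewrite subr0 tC rdistC => /le_trans; apply.
  have td2 : t / d <= 1 / 2 by rewrite ler_pdivrMr// /t; lra.
  have tdM : t / d * (4 * M + 1) <= e / 4.
    rewrite mulrAC ler_pdivrMr// (le_trans (_ : _ <= a / 2 * (4 * M + 1)))//.
    have : a * (4 * M + 1) <= d * e / 2.
      move: aM; rewrite -[_ / (4 * M + 1) / 2]mulrAC ler_pdivlMr//; lra.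
    lra.
  have td0 : 0 <= t / d by rewrite divr_ge0 ?ltW.
  rewrite ler_pdivrMr; [nra|lra].
have := ler_rdistD (f t%:C) (f 0) L; lra.
Qed.

End Continuation.

(** * The coefficients of the noise process *)
Section PhiCoefs.
Context {R : realType} {B : completeNormedModType R[i]}.
Local Notation C := (Num.NumField.sort R[i]).
Variables (N : R[i] -> B -> B).

(** The j-th Taylor coefficient of N as a function of the centre, that is the
    j-th derivative divided by j!. *)
Definition taylor_fun (j : nat) (z : R[i]) : B -> B :=
  if pselect (exists c, taylor_coefs N z c) is left Nz then projT1 (cid Nz) j
  else 0.

Lemma taylor_funE j z c : taylor_coefs N z c -> taylor_fun j z = c j.
Proof.
move=> Nc; rewrite /taylor_fun; case: pselect => [Nz|[]]; last by exists c.
case: cid => c' /= Nc'; rewrite (taylor_unique Nc' Nc)//.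
by near=> y.
Unshelve. all: by end_near. Qed.

(** Around w the recentred coefficients are power series in the centre, and
    taylor_fun agrees with them by uniqueness. *)
Lemma taylor_fun_coefs j w c : taylor_coefs N w c ->
  taylor_coefs (taylor_fun j) w (fun n => 'C(j + n, j)%:R *: c (j + n)%N).
Proof.
move=> /taylor_expansion[r [M Nc]]; have r0 := expansion_r_gt0 Nc.
have [M0 lc Nx] := Nc; pose s := r / 2; have s0 : 0 < s by rewrite divr_gt0.
pose F z x := psum (dcoef (c ^~ x) j) (z - w).
have Fw : expansion F w (fun n => 'C(j + n, j)%:R *: c (j + n)%N) s (M / s ^+ j).
  split; first by rewrite divr_ge0// exprn_ge0// ltW.
    by move=> n a x y; rewrite scalrfctE lc scalerDr !scalerA mulrC.
  move=> x; rewrite mulrAC; apply: dcoef_vexpansion => // n.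
  by rewrite -splitr; exact: (expansion_coef_le Nc).
apply: (taylor_ext (expansion_taylor Fw)); apply/near_rnormP; exists s => // z zs.
have [t0 zt] : 0 < (s - rnorm (z - w)) /\ rnorm (z - w) + (s - rnorm (z - w)) < r.
  by rewrite /s in zs *; lra.
have /expansion_taylor := expansion_recenter Nc t0 zt.
by rewrite subrKC => /(taylor_funE j) ->.
Qed.

(** The continuation required for Phi_j is the j-th Taylor coefficient of N as a
    function of the centre, since pi_j(j + n) is the binomial coefficient
    C(j + n, j). *)
Lemma Phi_coefs_disc (rho : R) (c0 : nat -> B -> B) (Psi : int -> B -> B) :
  1 <= rho -> (forall w, rnorm w <= rho -> exists c, taylor_coefs N w c) ->
  taylor_coefs N 0 c0 -> taylor_coefs N 1 (fun n => Psi n%:Z) ->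
  Phi_coefs rho%:C Psi c0.
Proof.
move=> rho1 Nan N0 N1 j.
have piE n : (pi_ j (j + n) : R[i]) = 'C(j + n, j)%:R.
  by rewrite /pi_ -bin_ffact natrM mulfK// pnatr_eq0 -lt0n fact_gt0.
have F1 : taylor_coefs (taylor_fun j) 1
    (fun n => (pi_ j (j + n) : R[i]) *: Psi (j + n)%N%:Z).
  have := taylor_fun_coefs j N1; congr taylor_coefs.
  by apply/funext => n; rewrite piE.
have F0 := taylor_funE j N0.
split.
  exists (taylor_fun j); split=> // w; rewrite /= rnorm_lt => /ltW /Nan[c Nc].
  by eexists; exact: (taylor_fun_coefs j Nc).
move=> L jL; rewrite -F0; apply/funext => x.
have rho0 : 0 < rho by lra.
have [|d /andP[d0 _] Fd] := @uniform_expansion _ _ (taylor_fun j) rho rho0.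
  by move=> w /Nan[c Nc]; eexists; exact: (taylor_fun_coefs j Nc).
have [|c Fc] := Fd 1; first by rewrite rnorm1.
have cE : c = (fun n => (pi_ j (j + n) : R[i]) *: Psi (j + n)%N%:Z).
  by apply: (taylor_unique (expansion_taylor Fc) F1); near=> z.
rewrite cE in Fc; have [_ _ /(_ x) F1x] := Fc.
apply: (abel_continuation _ F1x).
  move=> w w1; have [|c' [_ _ /(_ x) Fx]] := Fd w; first exact: le_trans w1 _.
  by exists (c' ^~ x).
have jx := op_sum_cvg (x := x) jL; rewrite -(cvg_shiftn j) in jx.
rewrite [X in X @ _ --> _](_ : _ = [sequence \sum_(j <= k < n + j)
  (((-1) ^+ (k - j) * pi_ j k) *: Psi k%:Z) x]_n)//.
apply/funext => n /=.
rewrite [RHS](_ : _ = \sum_(0 + j <= k < n + j)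
  (((-1) ^+ (k - j) * pi_ j k) *: Psi k%:Z) x)//.
rewrite big_addn addnK; apply: eq_bigr => i _.
by rewrite addnK scalrfctE scalerA addnC.
Unshelve. all: by end_near. Qed.

End PhiCoefs.

(** * Random elements *)

Section RandomElements.
Context {R : realType} {B : completeNormedModType R[i]}.
Context {dT : measure_display} {T : measurableType dT}.
Implicit Types (X Y : T -> B) (O : set B).

Lemma open_rnormP O : open O <->
  forall x, O x -> exists2 e : R, 0 < e & forall y, rnorm (y - x) < e -> O y.
Proof.
rewrite openE; split=> OP x /OP; first by move/near_rnormP.
by move=> ?; apply/near_rnormP.
Qed.

Lemma open_rball (x : B) (e : R) : open [set y | rnorm (y - x) < e].
Proof.
apply/open_rnormP => y /= yx; exists (e - rnorm (y - x)); first by rewrite subr_gt0.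
by move=> z zy; have := ler_rdistD y z x; lra.
Qed.

Lemma random_elementP X :
  random_element X <-> forall O, open O -> measurable (X @^-1` O).
Proof.
split=> [mX O oO|mX]; last first.
  apply: (@measurability _ _ T (g_sigma_algebraType (@open B)) setT X (@open B)) => // S [W oW <-].
  by rewrite setTI; exact: mX.
rewrite -[X in measurable X]setTI; apply: mX => //.
exact: sub_sigma_algebra.
Qed.

Lemma random_element_cst (x : B) : random_element (fun _ : T => x).
Proof. exact: measurable_cst. Qed.

Lemma random_element_comp (f : B -> B) X : continuous f -> random_element X ->
  random_element (f \o X).
Proof.
move=> fc /random_elementP mX; apply/random_elementP => O oO.
rewrite comp_preimage; apply: mX; apply: open_comp oO => x _; exact: fc.
Qed.

Lemma random_element_if (D : set T) X Y : measurable D ->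
  random_element X -> random_element Y ->
  random_element (fun w => if pselect (D w) then X w else Y w).
Proof.
move=> mD /random_elementP mX /random_elementP mY.
apply/random_elementP => O oO.
rewrite [X in measurable X](_ : _ =
    (D `&` X @^-1` O) `|` (~` D `&` Y @^-1` O)); last first.
  apply/seteqP; split=> w /=.
    by case: pselect => Dw Ow; [left|right].
  by move=> [[Dw Ow]|[Dw Ow]]; case: pselect.
apply: measurableU; apply: measurableI => //; [exact: mX|exact: measurableC|exact: mY].
Qed.

Lemma archi_inv (e : R) : 0 < e -> exists k : nat, k.+1%:R^-1 < e.
Proof.
move=> e0; exists (Num.bound e^-1).
rewrite invf_plt ?posrE ?ltr0n//.
apply: lt_le_trans (archi_boundP _) _; first by rewrite invr_ge0 ltW.
by rewrite ler_nat.
Qed.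

(** X w belongs to O exactly when, for some k, u n w eventually belongs to the
    closed set of points whose ball of radius 1/(k+1) lies in O. *)
Lemma random_element_lim (u : nat -> T -> B) X :
  (forall n, random_element (u n)) -> (forall w, u ^~ w @ \oo --> X w) ->
  random_element X.
Proof.
move=> mu uX; apply/random_elementP => O oO.
pose U k := [set x : B | forall y, rnorm (y - x) < k.+1%:R^-1 -> O y].
have mU n k : measurable (u n @^-1` U k).
  have oU : open (~` U k).
    apply/open_rnormP => x /existsNP[y /not_implyP[yx Oy]].
    exists (k.+1%:R^-1 - rnorm (y - x)); first by rewrite subr_gt0.
    move=> z; rewrite ltrBrDl => zx Uz; apply: Oy; apply: Uz.
    by rewrite (le_lt_trans (ler_rdistD x y z))// (rdistC x z).
  have /random_elementP/(_ _ oU) := mu n.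
  by rewrite -preimage_setC => /measurableC; rewrite setCK.
have -> : X @^-1` O = \bigcup_k \bigcup_m \bigcap_(n in [set n | (m <= n)%N]) (u n @^-1` U k).
  apply/seteqP; split=> w /=.
    move=> /((open_rnormP O).1 oO)[e e0 eO].
    have e2 : 0 < e / 2 by rewrite divr_gt0.
    have [k ke] := archi_inv e2; exists k => //.
    have k0 : 0 < k.+1%:R^-1 :> R by rewrite invr_gt0.
    have /cvg_rnormP/(_ _ k0)[m _ mP] := uX w.
    exists m => // n /mP /= un y yu; apply: eO.
    rewrite (le_lt_trans (ler_rdistD (u n w) y (X w)))// (rdistC (u n w)) (splitr e).
    by rewrite ltrD// (lt_trans _ ke).
  move=> [k _ [m _ mP]].
  have k0 : 0 < k.+1%:R^-1 :> R by rewrite invr_gt0.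
  have /cvg_rnormP/(_ _ k0)[m' _ m'P] := uX w.
  apply: (mP (maxn m m')); first exact: leq_maxl.
  by apply: m'P; exact: leq_maxr.
apply: bigcup_measurable => k _; apply: bigcup_measurable => m _.
by apply: bigcap_measurable; first by exists m => /=.
Qed.

(** Separability reduces the open set of pairs with sum in O to a countable union
    of products of balls. *)
Lemma random_element_add X Y : @separable _ B -> random_element X ->
  random_element Y -> random_element (fun w => X w + Y w).
Proof.
move=> [D [/countable_injP[f finj] dD]] /random_elementP mX /random_elementP mY.
pose q n : B := xget 0 [set x | D x /\ f x = n].
have qE x : D x -> q (f x) = x.
  move=> Dx; rewrite /q; case: xgetP => [y _ [Dy fyx]|/(_ x)[]//].
  by apply: finj; rewrite ?inE.
have q_dense x (e : R) : 0 < e -> exists n, rnorm (q n - x) < e.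
  move=> e0; have [|y [/= yx Dy]] := dD _ _ (open_rball x e).
    by exists x => /=; rewrite subrr rnorm0.
  by exists (f y); rewrite qE.
apply/random_elementP => O oO.
pose b n k := [set y : B | rnorm (y - q n) < k.+1%:R^-1].
pose good n m := [set k | forall y z, b n k y -> b m k z -> O (y + z)].
have -> : (fun w => X w + Y w) @^-1` O = \bigcup_n \bigcup_m
    \bigcup_(k in good n m) (X @^-1` b n k `&` Y @^-1` b m k).
  apply/seteqP; split=> w /=; last first.
    by move=> [n _ [m _ [k nmk [Xn Ym]]]]; exact: nmk.
  move=> /((open_rnormP O).1 oO)[e e0 eO].
  have e4 : 0 < e / 4 by rewrite divr_gt0.
  have [k ke] := archi_inv e4.
  have k0 : 0 < k.+1%:R^-1 :> R by rewrite invr_gt0.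
  have [n nX] := q_dense (X w) _ k0; have [m mY'] := q_dense (Y w) _ k0.
  exists n => //; exists m => //; exists k; last by split; rewrite /b/= rdistC.
  move=> y z; rewrite /b/= => yn zm; apply: eO.
  rewrite opprD addrACA (le_lt_trans (ler_rnormD _ _))//.
  apply: le_lt_trans (lerD (ler_rdistD (q n) y (X w)) (ler_rdistD (q m) z (Y w))) _.
  move: yn nX zm mY' ke; move: (k.+1%:R^-1 : R) => h; lra.
apply: bigcup_measurable => n _; apply: bigcup_measurable => m _.
apply: bigcup_measurable => k _; apply: measurableI.
  by apply: mX; exact: open_rball.
by apply: mY; exact: open_rball.
Qed.

End RandomElements.

(** * One factorization step *)

Section Factorization.
Context {R : realType} {B : completeNormedModType R[i]}.
Implicit Types (f g : R[i] -> B -> B) (c h : nat -> B -> B) (w z t : R[i]).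
Implicit Types (T S Q : B -> B).
Local Notation C := (Num.NumField.sort R[i]).

Lemma projK Q x : projection Q -> Q (Q x) = Q x.
Proof. by move=> [_ QQ]; exact: (congr1 (@^~ x) QQ). Qed.

Lemma complE Q x : (id - Q) x = x - Q x. Proof. by []. Qed.

Lemma mixE Q t x : (Q + t *: (id - Q)) x = Q x + t *: (x - Q x).
Proof. by []. Qed.

Lemma bounded_op_compl Q : bounded_op Q -> bounded_op (id - Q).
Proof. by move=> bQ; apply: bounded_opB => //; exact: bounded_op_id. Qed.

Lemma proj_range Q x : projection Q -> range Q x -> Q x = x.
Proof. by move=> pQ [y _ <-]; exact: projK. Qed.

Lemma proj_full Q : projection Q -> range Q = [set: B] -> Q = id.
Proof.
by move=> pQ rQ; apply/funext => x; apply: proj_range => //; rewrite rQ.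
Qed.

Lemma invertible_range T : op_invertible T -> range T = [set: B].
Proof.
move=> [S [_ TS _]]; apply/seteqP; split=> // x _; exists (S x) => //.
exact: (congr1 (@^~ x) TS).
Qed.

Lemma op_inverse_comp T T' S S' : op_inverse T S -> op_inverse T' S' ->
  op_inverse (T \o T') (S' \o S).
Proof.
move=> [bS TS ST] [bS' TS' ST']; split; first exact: bounded_op_comp.
  apply/funext => x /=; have /= -> := congr1 (@^~ (S x)) TS'.
  exact: (congr1 (@^~ x) TS).
apply/funext => x /=; have /= -> := congr1 (@^~ (T' x)) ST.
exact: (congr1 (@^~ x) ST').
Qed.

Lemma proj_factor_inverse Q t : projection Q -> t != 0 ->
  op_inverse (Q + t *: (id - Q)) (Q + t^-1 *: (id - Q)).
Proof.
move=> pQ t0; have [bQ _] := pQ; have lQ := bounded_lin bQ.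
have inv s s' : s * s' = 1 -> (Q + s *: (id - Q)) \o (Q + s' *: (id - Q)) = id.
  move=> ss'; apply/funext => x.
  rewrite compE !mixE (linD lQ) (linZ lQ) (linB lQ) !projK// subrr scaler0 addr0.
  by rewrite addrAC subrr add0r scalerA ss' scale1r subrKC.
split.
- by apply: bounded_opD => //; apply: bounded_opZ; exact: bounded_op_compl.
- by apply: inv; rewrite mulfV.
- by apply: inv; rewrite mulVf.
Qed.

(** If f(z) (z - w)^-d inverts the second factor of (Q + (z-w)(id - Q)) T(z), then
    step_fun w Q f (z) (z - w)^-(d+1) inverts the product. *)
Definition step_fun w Q f z := f z \o (id - Q) + (z - w) *: (f z \o Q).

Definition step_coef Q h n : B -> B :=
  h n \o (id - Q) + (if n is k.+1 then h k \o Q else 0).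

Lemma taylor_step Q f w h : bounded_op Q -> taylor_coefs f w h ->
  taylor_coefs (step_fun w Q f) w (step_coef Q h).
Proof.
move=> bQ fh; have bQ' := bounded_op_compl bQ.
have := taylor_add (taylor_compr bQ' fh) (taylor_mulvar (taylor_compr bQ fh)).
by congr taylor_coefs; apply/funext => -[|n].
Qed.

Lemma inverse_step w z Q (d : nat) (F T : B -> B) f : projection Q -> z != w ->
  F = (Q + (z - w) *: (id - Q)) \o T ->
  op_inverse T ((z - w) ^- d *: f z) ->
  op_inverse F ((z - w) ^- d.+1 *: step_fun w Q f z).
Proof.
move=> pQ zw -> Tf; have t0 : z - w != 0 by rewrite subr_eq0.
have -> : (z - w) ^- d.+1 *: step_fun w Q f z =
    ((z - w) ^- d *: f z) \o (Q + (z - w)^-1 *: (id - Q)).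
  have [bf _ _] := Tf; apply/funext => x; set S := _ *: f z in bf *.
  have SE y : f z y = (z - w) ^+ d *: S y.
    by rewrite /S scalrfctE scalerA mulfV ?scale1r// expf_neq0.
  clearbody S; rewrite compE mixE -complE [LHS](_ : _ = (z - w) ^- d.+1 *:
    (f z ((id - Q) x) + (z - w) *: f z (Q x)))// !SE.
  rewrite (linD (bounded_lin bf)) (linZ (bounded_lin bf)) scalerDr addrC !scalerA.
  have e1 : (z - w) ^- d.+1 * (z - w) * (z - w) ^+ d = 1.
    by rewrite -mulrA -exprS mulVf// expf_neq0.
  have e2 : (z - w) ^- d.+1 * (z - w) ^+ d = (z - w)^-1.
    by rewrite exprS invfM -mulrA mulVf ?mulr1// expf_neq0.
  by rewrite e1 e2 scale1r.
exact: op_inverse_comp (proj_factor_inverse pQ t0) Tf.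
Qed.

Section Step.
Variables (w : R[i]) (Q : B -> B) (F f : R[i] -> B -> B) (c c' : nat -> B -> B).
Hypotheses (pQ : projection Q) (rQ : range Q = range (F w)).
Hypothesis Ff : \forall z \near (w : C), F z = (Q + (z - w) *: (id - Q)) \o f z.
Hypotheses (Fc : taylor_coefs F w c) (fc : taylor_coefs f w c').

(** F(w) has its range in that of Q, so Q fixes its values. *)
Lemma step_coef0 : Q \o c 0%N = c 0%N.
Proof.
apply/funext => x /=; apply: proj_range => //.
by rewrite rQ (taylor_val0 Fc); exists x.
Qed.

Let bQ : bounded_op Q. Proof. by case: pQ. Qed.

Let cE : c = fun n => Q \o c' n + (if n is k.+1 then (id - Q) \o c' k else 0).
Proof.
apply: (taylor_unique Fc).
  exact: taylor_add (taylor_compl bQ fc)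
    (taylor_mulvar (taylor_compl (bounded_op_compl bQ) fc)).
by move: Ff; apply: filterS => z ->.
Qed.

(** The projection onto ran F(w) and its complement separate the two terms of
    [c (n+1) = Q (c' (n+1)) + (id - Q) (c' n)]. *)
Lemma factor_coefs n : c' n = (Q \o c n) + ((id - Q) \o c n.+1).
Proof.
have lQ := bounded_lin bQ; rewrite cE; apply/funext => x.
have QQ y : Q (y - Q y) = 0 by rewrite linB// projK// subrr.
set r := fun n => if n is k.+1 then (id - Q) \o c' k else 0.
have QcE : Q ((Q \o c' n + r n) x) = Q (c' n x).
  rewrite addrfctE linD// compE projK//.
  by case: n => [|n] /=; rewrite ?(lin0 lQ) ?complE ?QQ addr0.
rewrite [RHS](_ : _ = Q ((Q \o c' n + r n) x) + (id - Q) ((Q \o c' n.+1 + r n.+1) x))//.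
have -> : (Q \o c' n.+1 + r n.+1) x = Q (c' n.+1 x) + (c' n x - Q (c' n x)) by [].
rewrite QcE complE (linD lQ) QQ projK// addr0.
by rewrite addrAC subrr add0r subrKC.
Qed.

Lemma factor_val : F w = Q \o f w.
Proof.
have := nbhs_singleton Ff; rewrite subrr scale0r addr0; exact.
Qed.

End Step.

End Factorization.

(** * Laurent expansion of the inverse *)

Section Laurent.
Context {R : realType} {B : completeNormedModType R[i]}.
Implicit Types (A f g : R[i] -> B -> B) (c m : nat -> B -> B) (w z t : R[i]).
Implicit Types (T S Q : B -> B) (Psi : int -> B -> B) (d : nat).
Local Notation C := (Num.NumField.sort R[i]).

Lemma op_sum_shift m F t d : t != 0 -> op_sum 0 (fun n => t ^+ n *: m n) F ->
  op_sum 0 (fun n => t ^+ n *: m (n + d)%N)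
    (t ^- d *: (F - \sum_(0 <= i < d) t ^+ i *: m i)).
Proof.
move=> t0 mF e e0; have td : t ^+ d != 0 by rewrite expf_neq0.
have /mF[n0 _ nP] : 0 < e * `|t ^+ d| by rewrite mulr_gt0// normr_gt0.
exists n0 => // n /= n0n x.
have := nP (n + d)%N (leq_trans n0n (leq_addr d n)) x.
rewrite mulrAC -ler_pdivrMr ?normr_gt0//; apply: le_trans.
rewrite mulrC -normfV -normrZ le_eqVlt; apply/orP; left; apply/eqP; congr `|_|.
have -> : (t ^- d *: (F - \sum_(0 <= i < d) t ^+ i *: m i)) x =
    t ^- d *: (F x - \sum_(0 <= i < d) t ^+ i *: m i x).
  by rewrite [LHS](_ : _ = t ^- d *: (F x - (\sum_(0 <= i < d) t ^+ i *: m i) x))//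
    fct_sumE.
rewrite !fct_sumE (big_cat_nat _ (leq_addl n d))//=.
have -> : \sum_(d <= k < n + d) (t ^+ k *: m k) x =
    \sum_(0 <= k < n) t ^+ (k + d) *: m (k + d)%N x.
  by rewrite -{1}(add0n d) big_addn addnK.
set a := \sum_(0 <= i < d) _; set b := \sum_(0 <= k < n) t ^+ (k + d) *: _.
have -> : a + b - F x = b - (F x - a) by rewrite opprB [RHS]addrA (addrC b).
rewrite [RHS]scalerBr; congr (_ - _); rewrite scaler_sumr.
by apply: eq_bigr => i _; rewrite !scalrfctE scalerA exprD mulrCA mulVf ?mulr1.
Qed.

(** Coefficients of (z - w)^-d M(z), where m are those of M at w. *)
Definition laurent_of m d (j : int) : B -> B :=
  match j with
  | Posz n => m (n + d)%N
  | Negz i => if (i.+1 <= d)%N then m (d - i.+1)%N else 0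
  end.

Lemma laurent_ofN m d i : (0 < i <= d)%N -> laurent_of m d (- i%:Z) = m (d - i)%N.
Proof. by case: i => // i /= ->. Qed.

Lemma laurent_coefsP A M w m d : taylor_coefs M w m ->
  (\forall z \near (w : C), z != w -> op_inverse (A z) ((z - w) ^- d *: M z)) ->
  laurent_coefs A w d (laurent_of m d).
Proof.
move=> [bm Mm] AM; split.
  by case=> [n|i] //=; case: ifP => // _; exact: bounded_op0.
near=> z => zw; have t0 : z - w != 0 by rewrite subr_eq0.
have Sz : op_inverse (A z) ((z - w) ^- d *: M z) by move: zw; near: z.
have Mz : op_sum 0 (fun n => (z - w) ^+ n *: m n) (M z) by near: z.
exists ((z - w) ^- d *: M z); split=> //.
have := op_sum_shift d t0 Mz; congr op_sum.
rewrite scalerBr scaler_sumr; congr (_ - _).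
rewrite [RHS]big_add1 [LHS]big_nat_rev add0n.
apply: eq_big_nat => i /andP[_ id_]; rewrite laurent_ofN; last by lia.
rewrite scalerA; congr (_ *: _).
have dE : d = (i.+1 + (d - i.+1))%N by lia.
by rewrite {1}dE exprD invfM -mulrA mulVf ?mulr1 ?expf_neq0.
Unshelve. all: by end_near. Qed.

Lemma near_neq (w a : R[i]) : w != a -> \forall z \near (w : C), z != a.
Proof.
move=> wa; apply/near_rnormP; exists (rnorm (w - a)).
  rewrite lt_neqAle rnorm_ge0 andbT eq_sym; apply: contra wa => /eqP/rnorm0_eq0.
  by move/eqP; rewrite subr_eq0.
by move=> z; apply: contraTneq => ->; rewrite rdistC ltxx.
Qed.

(** The analytic part of the inverse, extended by continuity at w. *)
Definition regular_part A w d Psi z : B -> B :=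
  if z == w then Psi 0
  else op_inv (A z) - \sum_(1 <= i < d.+1) (z - w) ^- i *: Psi (- i%:Z).

Lemma regular_part_center A w d Psi : laurent_coefs A w d Psi ->
  taylor_coefs (regular_part A w d Psi) w (fun n => Psi n%:Z).
Proof.
move=> [bPsi AP]; split=> //; near=> z; rewrite /regular_part.
have [->|zw] := eqVneq z w.
  rewrite subrr => e e0; exists 1%N => // n /= n1 x.
  rewrite big_ltn// big_nat_cond big1 ?addr0; last first.
    by move=> [|i] // _; rewrite expr0n scale0r.
  by rewrite expr0 scale1r subrr normr0 mulr_ge0 ?normr_ge0// ltW.
have [S [AS]] : exists S, op_inverse (A z) S /\
    op_sum 0 (fun n => (z - w) ^+ n *: Psi n%:Z)
      (S - \sum_(1 <= i < d.+1) (z - w) ^- i *: Psi (- i%:Z)).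
  by move: zw; near: z.
by rewrite (op_inv_unique AS).
Unshelve. all: by end_near. Qed.

(** The functions (z - a)^-1 come from inverting the polynomial (z - a) id. *)
Lemma taylor_inv_pow T a w i : bounded_op T -> w != a ->
  exists c, taylor_coefs (fun z => (z - a) ^- i *: T) w c.
Proof.
move=> bT wa; elim: i => [|i [c Tc]].
  eexists; apply: (taylor_ext (taylor_const w bT)); near=> z.
  by rewrite expr0 invr1 scale1r.
have bwa : bounded_op ((w - a) *: id : B -> B) by apply/bounded_opZ/bounded_op_id.
have lin := taylor_add (taylor_var w) (taylor_const w bwa).
have inv t : t != 0 -> op_inverse (t *: id) (t^-1 *: id : B -> B).
  move=> t0; split; first exact/bounded_opZ/bounded_op_id.
    by apply/funext => x; rewrite /= !scalrfctE scalerA mulfV// scale1r.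
  by apply/funext => x; rewrite /= !scalrfctE scalerA mulVf// scale1r.
have linE z : (z - w) *: id + (w - a) *: id = (z - a) *: id :> (B -> B).
  by rewrite -scalerDl subrKA.
have [|[h hP] _] := taylor_inv lin.
  by rewrite linE; exists ((w - a)^-1 *: id); apply: inv; rewrite subr_eq0.
eexists; apply: (taylor_ext (taylor_comp hP Tc)); near=> z.
have za : z != a by near: z; exact: near_neq.
rewrite linE (op_inv_unique (inv _ _)) ?subr_eq0//.
by apply/funext => x; rewrite /= !scalrfctE scalerA exprS invfM.
Unshelve. all: by end_near. Qed.

Lemma regular_part_off A w d Psi a c : (forall j, bounded_op (Psi j)) ->
  taylor_coefs A a c -> op_invertible (A a) -> a != w ->
  exists c', taylor_coefs (regular_part A w d Psi) a c'.
Proof.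
move=> bPsi Ac Aa aw; have [[h hP] _] := taylor_inv Ac Aa.
have [s sP] : exists s, taylor_coefs
    (fun z => \sum_(1 <= i < d.+1) (z - w) ^- i *: Psi (- i%:Z)) a s.
  elim: (index_iota 1 d.+1) => [|i r [s IH]].
    eexists; apply: (taylor_ext (taylor_const a (@bounded_op0 R B))); near=> z.
    by rewrite big_nil.
  have [u uP] := taylor_inv_pow i (bPsi (- i%:Z)) aw.
  eexists; apply: (taylor_ext (taylor_add uP IH)); near=> z.
  by rewrite big_cons.
eexists; apply: (taylor_ext (taylor_sub hP sP)); near=> z.
by rewrite /regular_part ifN//; near: z; exact: near_neq.
Unshelve. all: by end_near. Qed.

End Laurent.

(** * Filtering a trajectory by a power series *)

Section Filter.
Context {R : realType} {B : completeNormedModType R[i]}.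
Implicit Types (c : nat -> B -> B) (x : int -> B) (t : int).

Definition filtered c x t : nat -> B := series (fun j => c j (x (t - j%:Z))).

(** The coefficients of (z - 1) f(z) at 0, where c are those of f. *)
Definition lag_diff c n : B -> B := (if n is k.+1 then c k else 0) - c n.

Lemma filtered_comp (T : B -> B) c x t y : bounded_op T ->
  filtered c x t @ \oo --> y ->
  filtered (fun n => T \o c n) x t @ \oo --> T y.
Proof.
move=> bT /(bounded_cvg bT); rewrite (lin_series _ (bounded_lin bT)); exact.
Qed.

Lemma filtered_sub c c' x t y y' : filtered c x t @ \oo --> y ->
  filtered c' x t @ \oo --> y' ->
  filtered (fun n => c n - c' n) x t @ \oo --> y - y'.
Proof.
move=> cy c'y'; rewrite [X in X @ _ --> _](_ : _ =
  (fun n => filtered c x t n - filtered c' x t n)); first exact: cvgB.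
by apply/funext => n; rewrite /filtered /series/= -sumrB.
Qed.

Lemma filtered_id x t :
  filtered (fun n => if n is 0%N then id else 0) x t @ \oo --> x t.
Proof.
apply: cvg_near_cst; exists 1%N => // n /= n1.
rewrite /filtered /series/= big_ltn// subr0.
by rewrite big_nat_cond big1 ?addr0// => -[|i].
Qed.

(** Multiplication by the variable is the lag operator. *)
Lemma filtered_lag_diff c x t y y' :
  filtered c x (t - 1) @ \oo --> y' -> filtered c x t @ \oo --> y ->
  filtered (lag_diff c) x t @ \oo --> y' - y.
Proof.
move=> cy' cy; apply: filtered_sub => //.
rewrite -(cvg_shiftS (filtered _ x t)).
rewrite [X in X @ _ --> _](_ : _ = filtered c x (t - 1))//.
apply/funext => n; rewrite /filtered /series/= big_nat_recl//= add0r.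
by apply: eq_bigr => i _; congr (c i (x _)); lia.
Qed.

(** Filtering by d and then by c is filtering by the Cauchy product: the
    double series converges absolutely because the coefficients decay faster
    than the past of the trajectory grows. *)
Lemma filtered_cauchy_prod c d x t (e : int -> B) (Dc Dd r M q : R) :
  0 <= q < r -> 0 <= Dc -> 0 <= Dd -> 0 <= M ->
  (forall n, linear (c n)) ->
  (forall n y, rnorm (c n y) * r ^+ n <= Dc * rnorm y) ->
  (forall n y, rnorm (d n y) * r ^+ n <= Dd * rnorm y) ->
  (forall j : nat, rnorm (x (t - j%:Z)) <= M * q ^+ j) ->
  (forall i : nat, filtered d x (t - i%:Z) @ \oo --> e (t - i%:Z)) ->
  exists y : B, (filtered c e t @ \oo --> y) /\
    (filtered (cauchy_prod c d) x t @ \oo --> y).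
Proof.
move=> /andP[q0 qr] Dc0 Dd0 M0 lc cD dD xM de.
have r0 : 0 < r := le_lt_trans q0 qr.
have p01 : 0 <= q / r < 1.
  by rewrite divr_ge0 ?(ltW r0)//= ltr_pdivrMr// mul1r.
have D0 : 0 <= Dc * Dd * M by rewrite !mulr_ge0.
have bc n : bounded_op (c n).
  apply/bounded_opP; split=> //; exists (Dc / r ^+ n).
    by rewrite divr_ge0// exprn_ge0// ltW.
  by move=> y; rewrite mulrAC ler_pdivlMr ?exprn_gt0.
have := @cvg_double_series _ B (fun i j => c i (d j (x (t - i%:Z - j%:Z)))) _ _
  (fun i => c i (e (t - i%:Z))) _ (fun n => series_antidiag_geometric n D0 p01 p01).
have -> : antidiag (fun i j => c i (d j (x (t - i%:Z - j%:Z)))) =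
    (fun m => cauchy_prod c d m (x (t - m%:Z))).
  apply/funext => m; rewrite /cauchy_prod /antidiag fct_sumE.
  apply: eq_big_nat => i /andP[_]; rewrite ltnS => im /=.
  by congr (c i (d _ (x _))); lia.
move=> H; have [||cvg1 cvg2] := H.
- move=> i j; rewrite !expr_div_n.
  have h1 : rnorm (c i (d j (x (t - i%:Z - j%:Z)))) <=
      Dc * rnorm (d j (x (t - i%:Z - j%:Z))) / r ^+ i.
    by rewrite ler_pdivlMr ?exprn_gt0.
  have h2 : rnorm (d j (x (t - i%:Z - j%:Z))) <= Dd * (M * q ^+ (i + j)) / r ^+ j.
    rewrite ler_pdivlMr ?exprn_gt0// (le_trans (dD _ _))// ler_wpM2l//.
    by rewrite (_ : t - i%:Z - j%:Z = t - (i + j)%N%:Z)//; lia.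
  apply: (le_trans h1).
  rewrite [leRHS](_ : _ = Dc * (Dd * (M * q ^+ (i + j)) / r ^+ j) / r ^+ i); last first.
    by rewrite exprD; ring.
  by rewrite ler_wpM2r ?invr_ge0 ?exprn_ge0 ?(ltW r0)// ler_wpM2l.
- by move=> i; have := bounded_cvg (bc i) (de i); rewrite (lin_series _ (lc i)); exact.
by eexists; split; [exact: cvg2|exact: cvg1].
Qed.

End Filter.

(** * Difference equations for X - nu *)
Section Representation.
Context {R : realType} {B : completeNormedModType R[i]}.
Implicit Types (c : nat -> B -> B) (x : int -> B) (t : int) (f : R[i] -> B -> B).
Local Notation C := (Num.NumField.sort R[i]).

Lemma first_order_sum (Y e : int -> B) (T : B -> B) : linear T ->
  forall t : nat, Y t%:Z = Y 0
    - \sum_(1 <= s < t.+1) (Y (s%:Z - 1) - Y s%:Z - T (e s%:Z))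
    - T (\sum_(1 <= s < t.+1) e s%:Z).
Proof.
move=> lT; elim=> [|t IHt]; first by rewrite !big_geq// (lin0 lT) !subr0.
have recr (F : nat -> B) : \sum_(1 <= s < t.+2) F s =
    \sum_(1 <= s < t.+1) F s + F t.+1 by rewrite big_nat_recr.
have split5 (y a v b p : B) : y - (a + v) - (b + p) = y - a - b - v - p.
  by rewrite !opprD !addrA (addrAC _ (- v) (- b)).
rewrite !recr (linD lT) split5 -IHt (_ : t.+1%:Z - 1 = t%:Z); last by lia.
by rewrite opprB addrCA subKr addrAC subrr add0r.
Qed.

Lemma second_order_sum (V e : int -> B) (T : B -> B) : linear T ->
  (forall t, V (t - 1) - V t = T (e t)) ->
  forall t : nat, \sum_(1 <= s < t.+1) V s%:Z =
    t%:R *: V 0 - T (\sum_(1 <= s < t.+1) \sum_(1 <= r < s.+1) e r%:Z).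
Proof.
move=> lT VE.
have Vs (s : nat) : V s%:Z = V 0 - T (\sum_(1 <= r < s.+1) e r%:Z).
  elim: s => [|s IHs]; first by rewrite big_geq// (lin0 lT) subr0.
  rewrite big_nat_recr//= (linD lT) opprD addrA -IHs -VE.
  by rewrite (_ : s.+1%:Z - 1 = s%:Z) ?subKr//; lia.
elim=> [|t IHt]; first by rewrite !big_geq// scale0r (lin0 lT) subr0.
rewrite big_nat_recr//= IHt Vs [in RHS]big_nat_recr//= (linD lT) opprD.
by rewrite -natr1 scalerDl scale1r addrACA.
Qed.

(** Only finitely many terms separate the past of t from that of 0. *)
Lemma past_growth_shift x (q : R) : 1 <= q ->
  (exists M : R, forall s : nat, rnorm (x (- s%:Z)) <= M * q ^+ s) ->
  forall t, exists2 M : R, 0 <= M & forall j : nat, rnorm (x (t - j%:Z)) <= M * q ^+ j.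
Proof.
move=> q1 [M xM]; have q0 : 0 <= q := le_trans ler01 q1.
have M0 : 0 <= M.
  by have := xM 0%N; rewrite expr0 mulr1; apply: le_trans; exact: rnorm_ge0.
case=> [n|n].
  elim: n => [|n [D D0 DP]]; first by exists M => // j; rewrite sub0r.
  exists (D + rnorm (x n.+1%:Z)); first by rewrite addr_ge0 ?rnorm_ge0.
  move=> [|j].
    by rewrite subr0 expr0 mulr1 lerDr.
  rewrite (_ : n.+1%:Z - j.+1%:Z = n%:Z - j%:Z); last by lia.
  rewrite (le_trans (DP j))// ler_pM ?exprn_ge0// ?lerDl ?rnorm_ge0//.
  by rewrite exprS ler_peMl// exprn_ge0.
exists (M * q ^+ n.+1); first by rewrite mulr_ge0// exprn_ge0.
move=> j; rewrite -mulrA -exprD (_ : Negz n - j%:Z = - (n.+1 + j)%N%:Z)//; lia.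
Qed.

(** The coefficients at 0 of id - N(z) A(z), the defect of N from being an inverse
    of A; filtering x by them yields x - nu. *)
Definition defect_coef (Phi A0 : nat -> B -> B) n : B -> B :=
  (if n is 0%N then id else 0) - cauchy_prod Phi A0 n.

Section Path.
Variables (Phi A0 : nat -> B -> B) (x eps : int -> B) (DPhi DA r q : R).
Variable (Psi1 : B -> B).
Hypotheses (qr : 1 <= q < r) (DPhi0 : 0 <= DPhi) (DA0 : 0 <= DA).
Hypothesis lPhi : forall n, linear (Phi n).
Hypothesis PhiD : forall n y, rnorm (Phi n y) * r ^+ n <= DPhi * rnorm y.
Hypothesis A0D : forall n y, rnorm (A0 n y) * r ^+ n <= DA * rnorm y.
Hypothesis xM : exists M : R, forall s : nat, rnorm (x (- s%:Z)) <= M * q ^+ s.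
Hypothesis law : forall t, filtered A0 x t @ \oo --> eps t.
Hypothesis bPsi1 : bounded_op Psi1.

Let noise_sums t : exists y : B, (filtered Phi eps t @ \oo --> y) /\
  (filtered (cauchy_prod Phi A0) x t @ \oo --> y).
Proof.
have /andP[q1 qltr] := qr.
have [M M0 xtM] := past_growth_shift q1 xM t.
have q0r : 0 <= q < r by rewrite (le_trans ler01 q1).
exact: (filtered_cauchy_prod q0r DPhi0 DA0 M0 lPhi PhiD A0D xtM
  (e := eps) (fun i => @law (t - i%:Z))).
Qed.

Lemma noise_cvg t : cvgn (filtered Phi eps t).
Proof. by have [y [h _]] := noise_sums t; apply/cvg_ex; exists y. Qed.

Variable nu : int -> B.
Hypothesis nuP : forall t, filtered Phi eps t @ \oo --> nu t.
Let Y t : B := x t - nu t.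
(** V vanishes for a simple pole; for a double pole its increments are
    -Psi_-2 eps. *)
Let V t : B := Y (t - 1) - Y t - Psi1 (eps t).

Let filtered_defect t : filtered (defect_coef Phi A0) x t @ \oo --> Y t.
Proof.
have [y [h1 h2]] := noise_sums t; apply: filtered_sub; first exact: filtered_id.
by rewrite (cvg_unique _ (@nuP t) h1).
Qed.

Let W n : B -> B := lag_diff (defect_coef Phi A0) n - (Psi1 \o A0 n).

Let filtered_W t : filtered W x t @ \oo --> V t.
Proof.
apply: filtered_sub; first exact: filtered_lag_diff.
by apply: filtered_comp => //; exact: law.
Qed.

Lemma increment_pole1 : (forall n, lag_diff (defect_coef Phi A0) n = Psi1 \o A0 n) ->
  forall t, V t = 0.
Proof.
move=> WE t; have /cvg_lim <- // := @filtered_W t.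
apply: (@lim_near_cst B) => //; exists 0%N => // n _.
by rewrite /filtered /series/= big1// => i _; rewrite /W WE subrr.
Qed.

Lemma increment_pole2 (Psi2 : B -> B) : bounded_op Psi2 ->
  (forall n, lag_diff W n = Psi2 \o A0 n) ->
  forall t, V (t - 1) - V t = Psi2 (eps t).
Proof.
move=> bPsi2 WE t.
have h := filtered_lag_diff (@filtered_W (t - 1)) (@filtered_W t).
have -> : V (t - 1) - V t = limn (filtered (lag_diff W) x t) by rewrite (cvg_lim _ h).
rewrite (_ : lag_diff W = fun n => Psi2 \o A0 n); last exact/funext.
by apply: cvg_lim => //; apply: filtered_comp => //; exact: law.
Qed.

End Path.

Lemma taylor_lag_diff f c : taylor_coefs f 0 c ->
  taylor_coefs (fun z => (z - 1) *: f z) 0 (lag_diff c).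
Proof.
move=> fc; apply: (taylor_ext (taylor_sub (taylor_mulvar fc) fc)); near=> z.
by rewrite subr0 scalerBl scale1r.
Unshelve. all: by end_near. Qed.

Section DefectCoefs.
Variables (A N : R[i] -> B -> B) (A0 Phi : nat -> B -> B) (Psi1 Psi2 : B -> B).
Hypotheses (A_0 : taylor_coefs A 0 A0) (N_0 : taylor_coefs N 0 Phi).
Hypotheses (bPsi1 : bounded_op Psi1) (bPsi2 : bounded_op Psi2).

Let E z : B -> B := id - (N z \o A z).

Let E_0 : taylor_coefs E 0 (defect_coef Phi A0).
Proof. exact: taylor_sub (taylor_const 0 bounded_op_id) (taylor_comp N_0 A_0). Qed.

(** Compare Taylor coefficients at 0 after multiplying by z - 1. *)
Lemma defect_pole1 :
  (\forall z \near (0 : C), id - (N z \o A z) = (z - 1)^-1 *: (Psi1 \o A z)) ->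
  forall n, lag_diff (defect_coef Phi A0) n = Psi1 \o A0 n.
Proof.
move=> EA n; suff -> : lag_diff (defect_coef Phi A0) = fun n => Psi1 \o A0 n by [].
apply: (taylor_unique (taylor_lag_diff E_0) (taylor_compl bPsi1 A_0)).
near=> z; have z1 : z - 1 != 0.
  by rewrite subr_eq0; near: z; apply: near_neq; rewrite eq_sym oner_eq0.
rewrite /E (_ : id - _ = (z - 1)^-1 *: (Psi1 \o A z)); last by near: z.
by rewrite scalerA mulfV// scale1r.
Unshelve. all: by end_near. Qed.

(** Multiply by z - 1, subtract Psi1 A(z), multiply by z - 1 again. *)
Lemma defect_pole2 :
  (\forall z \near (0 : C), id - (N z \o A z) =
     (z - 1)^-1 *: (Psi1 \o A z) + (z - 1) ^- 2 *: (Psi2 \o A z)) ->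
  forall n, lag_diff (fun n => lag_diff (defect_coef Phi A0) n - (Psi1 \o A0 n)) n
    = Psi2 \o A0 n.
Proof.
move=> EA n.
suff -> : lag_diff (fun n => lag_diff (defect_coef Phi A0) n - (Psi1 \o A0 n)) =
    fun n => Psi2 \o A0 n by [].
have W_0 := taylor_sub (taylor_lag_diff E_0) (taylor_compl bPsi1 A_0).
apply: (taylor_unique (taylor_lag_diff W_0) (taylor_compl bPsi2 A_0)).
near=> z; have z1 : z - 1 != 0.
  by rewrite subr_eq0; near: z; apply: near_neq; rewrite eq_sym oner_eq0.
rewrite /E (_ : id - _ = (z - 1)^-1 *: (Psi1 \o A z) + (z - 1) ^- 2 *: (Psi2 \o A z));
  last by near: z.
set a := Psi1 \o A z; set b := Psi2 \o A z.
have -> : (z - 1) *: ((z - 1)^-1 *: a + (z - 1) ^- 2 *: b) - a = (z - 1)^-1 *: b.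
  rewrite scalerDr !scalerA mulfV// scale1r addrAC subrr add0r expr2 invfM.
  by rewrite mulrA mulfV// mul1r.
by rewrite scalerA mulfV// scale1r.
Unshelve. all: by end_near. Qed.

End DefectCoefs.

End Representation.

(** * The noise process *)

Section NoiseCoefs.
Context {R : realType} {B : completeNormedModType R[i]}.
Variables (A : R[i] -> B -> B) (A0 : nat -> B -> B) (rho : R) (d : nat).
Variable (Psi : int -> B -> B).
Local Notation C := (Num.NumField.sort R[i]).
Hypothesis rho1 : 1 < rho.
Hypothesis A_an : forall w, rnorm w <= rho -> exists c, taylor_coefs A w c.
Hypothesis A_inv : forall w, rnorm w <= rho -> w != 1 -> op_invertible (A w).
Hypothesis A_0 : taylor_coefs A 0 A0.
Hypothesis A_laurent : laurent_coefs A 1 d Psi.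

Let N := regular_part A 1 d Psi.

Lemma regular_part_disc w : rnorm w <= rho -> exists c, taylor_coefs N w c.
Proof.
move=> wrho; have [->|w1] := eqVneq w 1.
  by eexists; exact: regular_part_center A_laurent.
have [c Ac] := A_an wrho; have [bPsi _] := A_laurent.
exact: (regular_part_off d bPsi Ac (A_inv wrho w1) w1).
Qed.

(** Both A and the regular part N of its inverse are analytic on the closed disc
    of radius rho, hence a common r > rho for their coefficients at 0. *)
Lemma noise_coefs : exists Phi r DPhi DA,
  [/\ Phi_coefs rho%:C Psi Phi, taylor_coefs N 0 Phi, rho < r,
      0 <= DPhi /\ (forall n y, rnorm (Phi n y) * r ^+ n <= DPhi * rnorm y) &
      0 <= DA /\ (forall n y, rnorm (A0 n y) * r ^+ n <= DA * rnorm y)].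
Proof.
have rho0 : 0 < rho := lt_trans ltr01 rho1.
have [Phi N_0] : exists c, taylor_coefs N 0 c.
  by apply: regular_part_disc; rewrite rnorm0 ltW.
have [r1 [D1 [rr1 D10 Phi_le]]] := disc_coef_bound rho0 regular_part_disc N_0.
have [r2 [D2 [rr2 D20 A0_le]]] := disc_coef_bound rho0 A_an A_0.
have mono c' r' D' : rho < r' -> Num.min r1 r2 <= r' ->
    (forall n y, rnorm (c' n y) * r' ^+ n <= D' * rnorm y) ->
    forall n (y : B), rnorm (c' n y : B) * (Num.min r1 r2) ^+ n <= D' * rnorm y.
  move=> rr' mr' c'D n y; apply: le_trans (c'D n y).
  rewrite ler_wpM2l ?rnorm_ge0// lerXn2r ?nnegrE ?le_min//; last by lra.
  by apply/andP; split; lra.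
exists Phi, (Num.min r1 r2), D1, D2; split=> //.
- by apply: Phi_coefs_disc N_0 (regular_part_center A_laurent);
    [exact: ltW|exact: regular_part_disc].
- by rewrite lt_min rr1.
- by split=> //; apply: mono Phi_le => //; rewrite ge_min lexx.
- by split=> //; apply: mono A0_le => //; rewrite ge_min lexx orbT.
Qed.

Lemma defect_near0 : \forall z \near (0 : C), id - (N z \o A z) =
  \sum_(1 <= i < d.+1) (z - 1) ^- i *: (Psi (- i%:Z) \o A z).
Proof.
apply/near_rnormP; exists 1 => // z; rewrite subr0 => zlt.
have z1 : z != 1 by apply: contraTneq zlt => ->; rewrite rnorm1 ltxx.
have /op_inv_inverse[_ _ SA] : op_invertible (A z) by apply: A_inv => //; rewrite (le_trans (ltW zlt))// ltW.
rewrite /N /regular_part ifN//; apply/funext => x.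
rewrite [LHS](_ : _ = x - (op_inv (A z) (A z x) -
  (\sum_(1 <= i < d.+1) (z - 1) ^- i *: Psi (- i%:Z)) (A z x)))//.
by have /= -> := congr1 (@^~ x) SA; rewrite subKr !fct_sumE.
Qed.

End NoiseCoefs.

Section RandomNoise.
Context {R : realType} {B : completeNormedModType R[i]}.
Context {dT : measure_display} {Omega : measurableType dT}.
Variables (Pr : probability Omega R) (B_separable : @separable _ B).
Implicit Types (X Y : Omega -> B).

Lemma bounded_op_continuous (T : B -> B) : bounded_op T -> continuous T.
Proof.
move=> /bounded_opP[lT [M M0 TM]] x; apply/cvg_rnormP => e e0.
apply/near_rnormP; exists (e / (M + 1)); first by rewrite divr_gt0// ltr_wpDl.
move=> y; rewrite ltr_pdivlMr ?ltr_wpDl// => yx.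
rewrite -linB// rdistC in yx *; rewrite (le_lt_trans (TM _))// (le_lt_trans _ yx)//.
by rewrite mulrC ler_wpM2l ?rnorm_ge0// lerDl.
Qed.

Lemma random_element_op (T : B -> B) X : bounded_op T -> random_element X ->
  random_element (fun w => T (X w)).
Proof. by move=> /bounded_op_continuous cT; exact: random_element_comp. Qed.

Lemma random_element_sub X Y : random_element X -> random_element Y ->
  random_element (fun w => X w - Y w).
Proof.
move=> mX mY; apply: random_element_add => //.
exact: (random_element_op (bounded_opN bounded_op_id) mY).
Qed.

Lemma random_element_series (F : nat -> Omega -> B) n :
  (forall j, random_element (F j)) -> random_element (fun w => series (F ^~ w) n).
Proof.
move=> mF; elim: n => [|n IHn].
  rewrite (_ : (fun w => _) = fun=> 0); first exact: random_element_cst.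
  by apply/funext => w; rewrite /series/= big_geq.
under eq_fun do rewrite seriesSr.
exact: random_element_add.
Qed.

(** Replacing the partial sums by 0 on a measurable null set that contains the
    points of divergence makes them converge everywhere, to a measurable limit. *)
Lemma random_lim_series (F : nat -> Omega -> B) :
  (forall j, random_element (F j)) ->
  {ae Pr, forall w, cvgn (series (F ^~ w))} ->
  exists2 L : Omega -> B, random_element L &
    {ae Pr, forall w, series (F ^~ w) @ \oo --> L w}.
Proof.
move=> mF [D [mD D0 DP]].
pose u n w : B := if pselect (D w) then 0 else series (F ^~ w) n.
have ucvg w : cvgn (u ^~ w).
  rewrite /u; case: pselect => Dw; first exact: is_cvg_cst.
  by apply: contrapT => ncvg; apply/Dw/DP.
exists (fun w => limn (u ^~ w)).
  apply: (random_element_lim (u := u)) => // n.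
  by apply: random_element_if => //;
    [exact: random_element_cst|exact: random_element_series].
exists D; split=> // w /= nlim; apply: contrapT => Dw; apply: nlim.
by have := ucvg w; rewrite /u; case: pselect.
Qed.

Lemma ae_forall_int (Q : int -> Omega -> Prop) :
  (forall t, {ae Pr, forall w, Q t w}) -> {ae Pr, forall w, forall t, Q t w}.
Proof.
move=> QP; have : {ae Pr, forall w, forall n : nat, Q n%:Z w /\ Q (- n%:Z) w}.
  apply/ae_foralln => n; have := QP n%:Z; have := QP (- n%:Z).
  by apply: filterS2.
apply: filterS => w Qw [n|n]; first by case: (Qw n).
by rewrite NegzE; case: (Qw n.+1).
Qed.

End RandomNoise.

Section RandomRepresentation.
Context {R : realType} {B : completeNormedModType R[i]}.
Context {dT : measure_display} {Omega : measurableType dT}.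
Variables (Pr : probability Omega R) (B_separable : @separable _ B).
Variables (X eps : int -> Omega -> B).
Hypotheses (eps_random : forall t, random_element (eps t)).
Variables (A : R[i] -> B -> B) (A0 : nat -> B -> B) (rho : R) (d : nat).
Variable (Psi : int -> B -> B).
Hypothesis rho1 : 1 < rho.
Hypothesis A_an : forall w, rnorm w <= rho -> exists c, taylor_coefs A w c.
Hypothesis A_inv : forall w, rnorm w <= rho -> w != 1 -> op_invertible (A w).
Hypothesis A_0 : taylor_coefs A 0 A0.
Hypothesis A_laurent : laurent_coefs A 1 d Psi.
Hypothesis law : forall t, {ae Pr, forall w, law_of_motion A0 X eps t w}.
Hypothesis past_growth : {ae Pr, forall w, exists M : R[i], forall s : nat,
    `|X (- s%:Z) w| <= M * rho%:C ^+ s}.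

(** One full-measure set serves all t; on it the pathwise results apply. *)
Lemma random_representation : exists Phi, Phi_coefs rho%:C Psi Phi /\
  exists nu : int -> Omega -> B, (forall t, random_element (nu t)) /\
  {ae Pr, forall w,
    let Y t := X t w - nu t w in
    let V t := Y (t - 1) - Y t - Psi (- 1) (eps t w) in
    [/\ forall t, linear_process Phi eps t w (nu t w),
        d = 1%N -> forall t, V t = 0 &
        d = 2%N -> forall t, V (t - 1) - V t = Psi (- 2) (eps t w)]}.
Proof.
have [bPsi _] := A_laurent.
have [Phi [r [DPhi [DA [PhiC N_0 rhor [DPhi0 PhiD] [DA0 A0D]]]]]] :=
  noise_coefs rho1 A_an A_inv A_0 A_laurent.
have bPhi n : bounded_op (Phi n) by have [+ _] := N_0; apply.
have lPhi n : linear (Phi n) := bounded_lin (bPhi n).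
have rhor' : 1 <= rho < r by rewrite ltW.
have growth : {ae Pr, forall w, exists M : R, forall s : nat,
    rnorm (X (- s%:Z) w) <= M * rho ^+ s}.
  apply: filterS past_growth => w [M XM]; exists (complex.Re M) => s.
  have := XM s; rewrite rnormE -rmorphXn/= lecE => /andP[_ /=].
  by case: M {XM} => a b /=; rewrite mulr0 subr0.
have ae_law := ae_forall_int law.
exists Phi; split=> //.
have noise t : exists L : Omega -> B, random_element L /\
    {ae Pr, forall w, filtered Phi (eps ^~ w) t @ \oo --> L w}.
  have [||L L_random LP] := @random_lim_series _ _ _ _ Pr B_separable
    (fun j w => Phi j (eps (t - j%:Z) w)).
  - by move=> j; apply: random_element_op.
  - apply: filterS2 ae_law growth => w lawP growthP.
    exact: (@noise_cvg _ _ Phi A0 (X ^~ w) (eps ^~ w) _ _ _ _ rhor' DPhi0 DA0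
      lPhi PhiD A0D growthP lawP).
  - by exists L.
have [nu nuP] := choice noise.
exists nu; split; first by move=> t; case: (nuP t).
have defect := defect_near0 d Psi rho1 A_inv.
have ae_nu := ae_forall_int (fun t => (nuP t).2).
apply: filterS2 ae_law (filterI growth ae_nu) => w lawP [growthP nuwP].
split=> //.
- move=> d1; apply: (increment_pole1 rhor' DPhi0 DA0 lPhi PhiD A0D growthP lawP
    (bPsi (- 1)) nuwP).
  apply: (defect_pole1 A_0 N_0 (bPsi (- 1))).
  by apply: filterS defect => z ->; rewrite d1 big_nat1 expr1.
- move=> d2; apply: (increment_pole2 rhor' DPhi0 DA0 lPhi PhiD A0D growthP lawP
    (bPsi (- 1)) nuwP (bPsi (- 2))).
  apply: (defect_pole2 A_0 N_0 (bPsi (- 1)) (bPsi (- 2))).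
  by apply: filterS defect => z ->; rewrite d2 big_nat_recl// big_nat1 expr1.
Qed.

End RandomRepresentation.

(** * Simple and double poles *)
Section PoleFormulas.
Context {R : realType} {B : completeNormedModType R[i]}.
Variables (P A1 : nat -> B -> B).
Hypothesis P0 : P 0%N = 0.

Lemma Gcoef1 : P 2%N = id ->
  Gcoef P A1 1 = fun k => (P 1%N \o A1 k) + ((id - P 1%N) \o A1 k.+1).
Proof.
move=> P2; apply/funext => k; rewrite /Gcoef big_nat_recl// big_nat1 P0 P2 subr0.
by rewrite addn0 addn1.
Qed.

Lemma Gcoef2 : P 3%N = id ->
  Gcoef P A1 2 = fun k => (P 1%N \o A1 k) + ((P 2%N - P 1%N) \o A1 k.+1)
    + ((id - P 2%N) \o A1 k.+2).
Proof.
move=> P3; apply/funext => k.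
rewrite /Gcoef big_nat_recl// big_nat_recl// big_nat1 P0 P3 subr0.
by rewrite addn0 addn1 addn2 addrA.
Qed.

Lemma Psi_formula1 : P 2%N = id ->
  Psi_formula P A1 1 = laurent_of (step_coef (P 1%N) (Hcoef P A1 1)) 1.
Proof.
move=> P2; apply/funext => -[n|[|i]] //=.
  rewrite big_nat_recl// big_nat1 P0 P2 subr0 addn0 !addn1.
  by rewrite /step_coef addrC.
by rewrite big_nat1 /= P2 /step_coef addr0.
Qed.

(** P_2 P_1 = P_1 makes (id - P_2) P_1 vanish, so that the product of the two
    inverse factors reduces to
    (z-1)^2 P_1 + (z-1) (P_2 - P_1) + (id - P_2). *)
Lemma Psi_formula2 j : projection (P 1%N) -> projection (P 2%N) ->
  P 2%N \o P 1%N = P 1%N -> P 3%N = id ->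
  (forall n, linear (Hcoef P A1 2 n)) ->
  - 2 <= j -> laurent_of (step_coef (P 1%N) (step_coef (P 2%N) (Hcoef P A1 2))) 2 j
    = Psi_formula P A1 2 j.
Proof.
move=> pP1 pP2 P21 P3 lH; set h := Hcoef P A1 2 in lH *.
have [[lP1 _] [lP2 _]] := (pP1.1, pP2.1).
have P21E x : P 2%N (P 1%N x) = P 1%N x by exact: (congr1 (@^~ x) P21).
case: j => [n|[|[|i]]] //= _; apply/funext => x.
- rewrite fct_sumE !big_nat_recl// big_geq// addr0 P0 P3.
  rewrite addn0 addn1 addn2 /step_coef.
  rewrite [LHS](_ : _ = h n.+2 ((x - P 1%N x) - P 2%N (x - P 1%N x))
    + h n.+1 (P 2%N (x - P 1%N x)) + (h n.+1 (P 1%N x - P 2%N (P 1%N x))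
    + h n (P 2%N (P 1%N x))))//.
  rewrite [RHS](_ : _ = h n (P 1%N x - 0) + (h n.+1 (P 2%N x - P 1%N x)
    + h n.+2 (x - P 2%N x)))//.
  rewrite (linB lP2) P21E subrr (lin0 (lH _)) add0r subr0 opprB subrKA.
  by rewrite addrC; congr (_ + _); rewrite addrC.
- rewrite fct_sumE !big_nat_recl// big_geq// addr0 P3.
  rewrite /step_coef.
  rewrite [LHS](_ : _ = h 1%N ((x - P 1%N x) - P 2%N (x - P 1%N x))
    + h 0%N (P 2%N (x - P 1%N x)) + (h 0%N (P 1%N x - P 2%N (P 1%N x)) + 0))//.
  rewrite [RHS](_ : _ = h 1%N (x - P 2%N x) + h 0%N (P 2%N x - P 1%N x))//.
  by rewrite (linB lP2) P21E subrr (lin0 (lH _)) !addr0 opprB subrKA.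
- rewrite fct_sumE big_nat1 P3 /step_coef.
  rewrite [LHS](_ : _ = h 0%N ((x - P 1%N x) - P 2%N (x - P 1%N x)) + 0 + 0)//.
  rewrite [RHS](_ : _ = h 0%N (x - P 2%N x))//.
  by rewrite (linB lP2) P21E !addr0 opprB subrKA.
Qed.

End PoleFormulas.

Lemma op_inv_eq0 {R : realType} {B : completeNormedModType R[i]} (T : B -> B) y :
  op_invertible T -> op_inv T y = 0 -> y = 0.
Proof.
move=> /op_inv_inverse[/bounded_lin/lin0 S0 TS _] y0.
have TSE x : T (op_inv T x) = x := congr1 (@^~ x) TS.
by rewrite -[y]TSE y0 -S0 TSE.
Qed.

Section Poles.
Context {R : realType} {B : completeNormedModType R[i]}.
Variables (P : nat -> B -> B) (A1 c1 c2 : nat -> B -> B).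
Variables (Aq : nat -> R[i] -> B -> B).
Local Notation C := (Num.NumField.sort R[i]).
Hypothesis P0 : P 0%N = 0.
Hypothesis pP : forall k, projection (P k.+1).
Hypothesis rP : forall k, range (P k.+1) = range (Aq k 1).
Hypothesis AqE : forall k, \forall z \near (1 : C),
  Aq k z = (P k.+1 + (z - 1) *: (id - P k.+1)) \o Aq k.+1 z.
Hypothesis A_c : taylor_coefs (Aq 0%N) 1 A1.
Hypothesis c1P : taylor_coefs (Aq 1%N) 1 c1.
Hypothesis c2P : taylor_coefs (Aq 2%N) 1 c2.

Let bP k : bounded_op (P k.+1). Proof. by case: (pP k). Qed.

Lemma quotient_full k : op_invertible (Aq k 1) -> P k.+1 = id.
Proof. by move=> inv; apply: proj_full => //; rewrite rP invertible_range. Qed.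

(** At z = 1 only the projection remains of the factor P + (z-1)(id - P). *)
Lemma quotient_proj1 k : P k.+1 = id -> Aq k 1 = Aq k.+1 1.
Proof. by move=> Pk; rewrite (factor_val (AqE k)) Pk. Qed.

Lemma quotient1_coefs k : c1 k = (P 1%N \o A1 k) + ((id - P 1%N) \o A1 k.+1).
Proof. exact: factor_coefs (pP 0%N) (AqE 0%N) A_c c1P k. Qed.

Let PA1 : P 1%N \o A1 0%N = A1 0%N := step_coef0 (pP 0%N) (rP 0%N) A_c.

Lemma quotient1_val : Aq 1%N 1 = A1 0%N + ((id - P 1%N) \o A1 1%N).
Proof. by rewrite (taylor_val0 c1P) quotient1_coefs PA1. Qed.

Section Nested.
Hypothesis P12 : range (P 1%N) `<=` range (P 2%N).

Lemma nested_proj : P 2%N \o P 1%N = P 1%N.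
Proof.
by apply/funext => x /=; apply: proj_range => //; apply: P12; exists x.
Qed.

Lemma quotient2_coefs k : c2 k = (P 1%N \o A1 k)
  + ((P 2%N - P 1%N) \o A1 k.+1) + ((id - P 2%N) \o A1 k.+2).
Proof.
rewrite (factor_coefs (pP 1%N) (AqE 1%N) c1P c2P) !quotient1_coefs.
have lP2 := bounded_lin (bP 1%N); apply/funext => x.
have P21 y : P 2%N (P 1%N y) = P 1%N y := congr1 (@^~ y) nested_proj.
rewrite [LHS](_ : _ = P 2%N (P 1%N (A1 k x) + (A1 k.+1 x - P 1%N (A1 k.+1 x)))
  + ((P 1%N (A1 k.+1 x) + (A1 k.+2 x - P 1%N (A1 k.+2 x)))
    - P 2%N (P 1%N (A1 k.+1 x) + (A1 k.+2 x - P 1%N (A1 k.+2 x)))))//.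
rewrite !(linD lP2) !(linN lP2) !P21.
rewrite [RHS](_ : _ = P 1%N (A1 k x) + (P 2%N (A1 k.+1 x) - P 1%N (A1 k.+1 x))
  + (A1 k.+2 x - P 2%N (A1 k.+2 x)))//.
congr (_ + _); rewrite opprD addrACA subrr add0r opprB.
by rewrite addrA subrK.
Qed.

Lemma quotient2_val : Aq 2%N 1 = A1 0%N + ((P 2%N - P 1%N) \o A1 1%N)
  + ((id - P 2%N) \o A1 2%N).
Proof. by rewrite (taylor_val0 c2P) quotient2_coefs PA1. Qed.

End Nested.

Let inverse_quotient k d f : (\forall z \near (1 : C), z != 1 ->
    op_inverse (Aq k.+1 z) ((z - 1) ^- d *: f z)) ->
  \forall z \near (1 : C), z != 1 ->
    op_inverse (Aq k z) ((z - 1) ^- d.+1 *: step_fun 1 (P k.+1) f z).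
Proof.
by apply: filterS2 (AqE k) => z zE + z1 => /(_ z1); exact: inverse_step.
Qed.

Let inverse_base k : (\forall z \near (1 : C), op_invertible (Aq k z)) ->
  \forall z \near (1 : C), z != 1 ->
    op_inverse (Aq k z) ((z - 1) ^- 0 *: op_inv (Aq k z)).
Proof.
by apply: filterS => z /op_inv_inverse zi _; rewrite expr0 invr1 scale1r.
Qed.

Lemma laurent_pole1 : op_invertible (Aq 1%N 1) ->
  laurent_coefs (Aq 0%N) 1 1 (Psi_formula P A1 1).
Proof.
move=> inv1; have P2 := quotient_full inv1.
have G1 : Gcoef P A1 1 = c1.
  by rewrite Gcoef1//; apply/funext => k; rewrite quotient1_coefs.
have c1G := c1P; rewrite -G1 in c1G.
have [HP near_inv] := taylor_inv_Hcoef c1G inv1.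
rewrite Psi_formula1//; apply: (laurent_coefsP (taylor_step (bP 0%N) HP)).
exact: (inverse_quotient (inverse_base near_inv)).
Qed.

Lemma laurent_pole2 : op_invertible (Aq 2%N 1) -> exists h,
  taylor_coefs (fun z => op_inv (Aq 2%N z)) 1 h /\
  laurent_coefs (Aq 0%N) 1 2
    (laurent_of (step_coef (P 1%N) (step_coef (P 2%N) h)) 2).
Proof.
move=> inv2; have [[h hP] near_inv] := taylor_inv c2P inv2.
exists h; split=> //.
apply: (laurent_coefsP (taylor_step (bP 0%N) (taylor_step (bP 1%N) hP))).
exact: (inverse_quotient (inverse_quotient (inverse_base near_inv))).
Qed.

Lemma laurent_pole2_formula h j : op_invertible (Aq 2%N 1) ->
  range (P 1%N) `<=` range (P 2%N) ->
  taylor_coefs (fun z => op_inv (Aq 2%N z)) 1 h -> - 2 <= j ->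
  laurent_of (step_coef (P 1%N) (step_coef (P 2%N) h)) 2 j = Psi_formula P A1 2 j.
Proof.
move=> inv2 P12 hP j2; have P3 := quotient_full inv2.
have G2 : Gcoef P A1 2 = c2.
  by rewrite Gcoef2//; apply/funext => k; rewrite (quotient2_coefs P12).
have c2G := c2P; rewrite -G2 in c2G.
have [HP _] := taylor_inv_Hcoef c2G inv2.
have -> : h = Hcoef P A1 2 by apply: (taylor_unique hP HP); near=> z.
apply: Psi_formula2 => //; first exact: nested_proj.
by move=> n; have [/(_ n)[]] := HP.
Unshelve. all: by end_near. Qed.

(** If the coefficient of order -1 vanished, then P_1 = id and A(1) = A^[1](1). *)
Lemma pole1_neq0 : op_invertible (Aq 1%N 1) -> ~ op_invertible (Aq 0%N 1) ->
  Psi_formula P A1 1 (- 1) <> 0.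
Proof.
move=> inv1 ninv0; have P2 := quotient_full inv1 => Psi0.
apply: ninv0; rewrite quotient_proj1//; apply/funext => x; apply/esym/subr0_eq.
have G0 : Gcoef P A1 1 0 = Aq 1%N 1.
  by rewrite Gcoef1//= (taylor_val0 c1P) quotient1_coefs.
apply: (op_inv_eq0 inv1); rewrite -G0 -Hcoef0.
have := congr1 (@^~ x) Psi0; rewrite Psi_formula1// (@laurent_ofN _ _ _ 1 1)//.
by rewrite /step_coef /= addr0.
Qed.

(** If the coefficient of order -2 vanished, then (id - P_2)(id - P_1) = 0, that is,
    P_2 would fix the range of id - P_1. It would also fix that of P_1, since
    P_1 A^[1](1) = A^[1](1) - (id - P_1) A^[1](1) and P_2 fixes the range of A^[1](1).
    So P_2 = id, and A^[1](1) = A^[2](1) would be invertible. *)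
Lemma pole2_neq0 h : op_invertible (Aq 2%N 1) -> ~ op_invertible (Aq 1%N 1) ->
  taylor_coefs (fun z => op_inv (Aq 2%N z)) 1 h ->
  laurent_of (step_coef (P 1%N) (step_coef (P 2%N) h)) 2 (- 2) <> 0.
Proof.
move=> inv2 ninv1 hP Psi0; apply: ninv1; rewrite quotient_proj1//.
have Q1_P2 x : P 2%N (x - P 1%N x) = x - P 1%N x.
  apply/esym/subr0_eq; apply: (op_inv_eq0 inv2); rewrite (taylor_val0 hP).
  have := congr1 (@^~ x) Psi0; rewrite (@laurent_ofN _ _ _ 2 2)//.
  by rewrite /step_coef subnn !addr0.
have P1_P2 x : P 2%N (P 1%N x) = P 1%N x.
  have [y _ <-] : range (Aq 0%N 1) (P 1%N x) by rewrite -rP; exists x.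
  rewrite (factor_val (AqE 0%N)) /=; set u := Aq 1%N 1 y.
  rewrite -[P 1%N u](subKr u) (linB (bounded_lin (bP 1%N))) Q1_P2; congr (_ - _).
  by apply: proj_range => //; rewrite rP; exists y.
apply/funext => x; rewrite -[in LHS](subrK (P 1%N x) x).
by rewrite (linD (bounded_lin (bP 1%N))) Q1_P2 P1_P2 subrK.
Qed.

End Poles.

Theorem proposition7
  (R : realType) (B : completeNormedModType R[i])
  (B_separable : @separable _ B)
  (dT : measure_display) (Omega : measurableType dT) (Pr : probability Omega R)
  (X eps : int -> Omega -> B)
  (X_random : forall t, random_element (X t))
  (eps_random : forall t, random_element (eps t))
  (U : set R[i]) (A : R[i] -> B -> B) (A0 A1 : nat -> B -> B) (eta : R)
  (* the characteristic function and its Taylor coefficients at 0 and 1 *)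
  (U_open : open (U : set R[i]^o)) (U_connected : connected (U : set R[i]^o))
  (U1 : U 1)
  (A_analytic : op_analytic U A)
  (A_taylor0 : taylor_coefs A 0 A0) (A_taylor1 : taylor_coefs A 1 A1)
  (A_fredholm : forall z, U z -> fredholm (A z))
  (eta_gt0 : 0 < eta)
  (U_disc : forall z : R[i], `|z| <= (1 + eta)%:C -> U z)
  (A_inv : forall z : R[i], `|z| <= (1 + eta)%:C -> z != 1 ->
    op_invertible (A z))
  (A1_noninv : ~ op_invertible (A 1))
  (* the autoregressive law of motion *)
  (law : forall t : int, 1 <= t ->
    {ae Pr, forall w, law_of_motion A0 X eps t w})
  (* the pre-sample innovations, and the growth of the pre-sample *)
  (law_past : forall t : int, t <= 0 ->
    {ae Pr, forall w, law_of_motion A0 X eps t w})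
  (past_growth : {ae Pr, forall w, exists M : R[i], forall s : nat,
    `|X (- s%:Z) w| <= M * (1 + eta)%:C ^+ s})
  (* the successive factorization of A at 1 *)
  (P : nat -> B -> B) (Aq : nat -> R[i] -> B -> B)
  (P_Aq : successive_factorization U A 1 P Aq) :
  (* (i) *)
  (Aq 1%N 1 = A1 0%N + ((id - P 1%N) \o A1 1%N) /\
   (op_invertible (Aq 1%N 1) ->
    let Psi := Psi_formula P A1 1 in
    [/\ inverse_has_pole A 1 1,
        laurent_coefs A 1 1 Psi &
        exists Phi : nat -> B -> B, Phi_coefs (1 + eta)%:C Psi Phi /\
        exists tau0 : Omega -> B, random_element tau0 /\
        {ae Pr, forall w, forall t : nat, (1 <= t)%N ->
          exists nu : B, linear_process Phi eps t%:Z w nu /\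
          X t%:Z w = tau0 w - Psi (- 1) (\sum_(1 <= s < t.+1) eps s%:Z w)
                     + nu}])) /\
  (* (ii) *)
  ((range (P 1%N) `<=` range (P 2%N) ->
    Aq 2%N 1 = A1 0%N + ((P 2%N - P 1%N) \o A1 1%N)
                + ((id - P 2%N) \o A1 2%N)) /\
   (op_invertible (Aq 2%N 1) -> ~ op_invertible (Aq 1%N 1) ->
    exists Psi : int -> B -> B,
    [/\ inverse_has_pole A 1 2,
        laurent_coefs A 1 2 Psi,
        range (P 1%N) `<=` range (P 2%N) ->
          forall j : int, - 2 <= j -> Psi j = Psi_formula P A1 2 j &
        exists Phi : nat -> B -> B, Phi_coefs (1 + eta)%:C Psi Phi /\
        exists tau0 tau1 : Omega -> B,
        [/\ random_element tau0, random_element tau1 &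
        {ae Pr, forall w, forall t : nat, (1 <= t)%N ->
          exists nu : B, linear_process Phi eps t%:Z w nu /\
          X t%:Z w = tau0 w + t%:R *: tau1 w
            + Psi (- 2) (\sum_(1 <= s < t.+1) \sum_(1 <= r < s.+1) eps r%:Z w)
            - Psi (- 1) (\sum_(1 <= s < t.+1) eps s%:Z w)
            + nu}]])).
Proof.
pose rho := 1 + eta; have rho1 : 1 < rho by rewrite /rho; lra.
have [[P0 Aq0] PP AqP AqU] := P_Aq.
have disc_an w : rnorm w <= rho -> exists c, taylor_coefs A w c.
  by move=> wrho; apply: A_analytic; apply: U_disc; rewrite rnorm_le.
have disc_inv w : rnorm w <= rho -> w != 1 -> op_invertible (A w).
  by move=> wrho; apply: A_inv; rewrite rnorm_le.
have pP k : projection (P k.+1) by case: (PP k).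
have rP k : range (P k.+1) = range (Aq k 1) by case: (PP k).
have AqE k : \forall z \near (1 : Num.NumField.sort R[i]),
    Aq k z = (P k.+1 + (z - 1) *: (id - P k.+1)) \o Aq k.+1 z.
  apply/near_rnormP; exists eta => // z z1; apply: AqU; apply: U_disc.
  rewrite rnorm_le; have := ler_rnormD (z - 1) 1.
  by rewrite subrK rnorm1 /rho; lra.
have [c1 c1P] : exists c, taylor_coefs (Aq 1%N) 1 c by case: (AqP 0%N) => /(_ 1 U1).
have [c2 c2P] : exists c, taylor_coefs (Aq 2%N) 1 c by case: (AqP 1%N) => /(_ 1 U1).
have A_c : taylor_coefs (Aq 0%N) 1 A1 by rewrite Aq0.
have law_all t : {ae Pr, forall w, law_of_motion A0 X eps t w}.
  by have [t1|t1] := leP 1 t; [exact: law|apply: law_past; lia].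
have repr d Psi (laurent : laurent_coefs A 1 d Psi) :=
  random_representation B_separable eps_random rho1 disc_an disc_inv A_taylor0
    laurent law_all past_growth.
split; split.
- exact: quotient1_val (pP) rP AqE A_c c1P.
- move=> inv1 Psi.
  have laurent : laurent_coefs A 1 1 Psi.
    by have := laurent_pole1 P0 pP rP AqE A_c c1P inv1; rewrite Aq0.
  have Psi_neq0 : Psi (- 1) <> 0.
    by apply: (pole1_neq0 P0 pP rP AqE A_c c1P inv1); rewrite Aq0.
  split=> //; first by split=> //; exists Psi.
  have [Phi [PhiC [nu [nu_random nuP]]]] := repr _ _ laurent.
  exists Phi; split=> //; exists (fun w => X 0 w - nu 0 w); split.
    exact: random_element_sub.
  apply: filterS nuP => w [noise V0 _] t _; exists (nu t%:Z w); split=> //.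
  have lPsi : linear (Psi (- 1)) by have [/(_ (- 1))[]] := laurent.
  have := first_order_sum (fun t => X t w - nu t w) (eps ^~ w) lPsi t.
  rewrite big1 => [|s _]; last exact: V0.
  by rewrite subr0 => <-; rewrite subrK.
- exact: quotient2_val pP rP AqE A_c c1P c2P.
- move=> inv2 ninv1.
  have [h [hP]] := laurent_pole2 pP AqE c2P inv2; rewrite Aq0 => laurent.
  have Psi_neq0 := pole2_neq0 pP rP AqE inv2 ninv1 hP.
  have formula := laurent_pole2_formula P0 pP rP AqE A_c c1P c2P inv2 ^~ hP.
  set Psi := laurent_of _ 2 in laurent Psi_neq0 formula.
  exists Psi; split=> //.
  + by split=> //; exists Psi.
  + by move=> P12 j j2; apply: formula.
  have [Phi [PhiC [nu [nu_random nuP]]]] := repr _ _ laurent.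
  exists Phi; split=> //; pose Y t w := X t w - nu t w.
  have bPsi := laurent.1; have lPsi j : linear (Psi j) := bounded_lin (bPsi j).
  have Y_random t : random_element (Y t) by exact: random_element_sub.
  pose V0 w := Y (0 - 1) w - Y 0 w - Psi (- 1) (eps 0 w).
  exists (Y 0), (fun w => - V0 w); split=> //.
    apply: (random_element_op (bounded_opN bounded_op_id)).
    apply: random_element_sub => //; first exact: random_element_sub.
    exact: random_element_op.
  apply: filterS nuP => w [noise _ V2] t _; exists (nu t%:Z w); split=> //.
  have := first_order_sum (Y ^~ w) (eps ^~ w) (lPsi (- 1)) t.
  rewrite (second_order_sum (V := fun s => Y (s - 1) w - Y s w - Psi (- 1) (eps s w))
    (lPsi (- 2)) (V2 erefl)).
  rewrite opprB addrA => YE; rewrite -[LHS](subrK (nu t%:Z w)) -/(Y t%:Z w) YE.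
  by rewrite -/(V0 w) scalerN [Y 0 w + _ - _]addrAC.
Qed.
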